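(* There exists a sequence of configurations $C_n$ of smooth cubic curves in the complex projective plane $\mathbb{P}^2$ (i.e. each $C_n$ is a reduced union of finitely many smooth plane cubic curves) such that, denoting by $\mathrm{Sing}(C_n)$ the set of singular points of $C_n$, $$\lim_{n\to\infty}H(C_n,\mathrm{Sing}(C_n))=-4,$$ and therefore $-4\geq H_{El,\mathbb{P}^2}\geq H_{\mathbb{P}^2}$.
   Context: For a smooth projective complex surface $X$, a reduced curve $C\subset X$ and a finite set $\mathcal{P}$ of $s>0$ distinct points of $X$, let $\bar C$ be the strict transform of $C$ in the blow-up of $X$ at $\mathcal{P}$, and put $H(C,\mathcal{P})=\bar C^{2}/s$. The $H$-constant of $X$ is $H_X=\inf_{C,\mathcal{P}}H(C,\mathcal{P})$, over all reduced curves $C$ on $X$ and all non-empty finite sets $\mathcal{P}$ of points. The elliptic $H$-constant $H_{El,X}$ is the infimum of $H(C,\mathcal{P})$ where $C$ ranges only over (reduced, finite) unions of smooth elliptic curves (smooth genus one curves) on $X$ and $\mathcal{P}$ over all non-empty finite sets of points. *)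

(* Defs.v *)
From HB Require Import structures.
From mathcomp Require Import all_boot all_order all_algebra.
From mathcomp Require Import complex finmap mpoly.
From mathcomp Require Import all_classical reals ereal topology normedtype.
From mathcomp Require Import sequences.

Set Implicit Arguments.
Unset Strict Implicit.
Unset Printing Implicit Defensive.

Import Order.TTheory GRing.Theory Num.Theory.

Local Open Scope classical_set_scope.
Local Open Scope ring_scope.

(** * The projective plane and its curves *)

Definition linear_subspace (K : fieldType) (k : nat) :=
  {U : {vspace 'rV[K]_3} | \dim U == k}.

Definition proj_point (K : fieldType) := linear_subspace K 1.
Definition proj_line (K : fieldType) := linear_subspace K 2.

Definition on_line (K : fieldType) (p : proj_point K) (l : proj_line K) :=
  (val p <= val l)%VS.

(* Only meant for homogeneous [F], so that the choice of homogeneous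
   coordinates of [p] is irrelevant. *)
Definition vanishes (K : fieldType) (F : {mpoly K[3]}) (p : proj_point K) :=
  F.@[vpick (val p) 0] = 0.

Definition homogeneous (K : fieldType) (F : {mpoly K[3]}) (d : nat) :=
  F \is d.-homog for mdeg.

(* The plane curve [F = 0], possibly with multiple components. *)
Definition plane_curve (K : fieldType) (F : {mpoly K[3]}) :=
  F != 0 /\ exists2 d, (0 < d)%N & homogeneous F d.

Definition reduced_curve (K : fieldType) (F : {mpoly K[3]}) :=
  plane_curve F /\ forall g h : {mpoly K[3]}, F = g ^+ 2 * h -> (msize g <= 1)%N.

Definition Sing (K : fieldType) (F : {mpoly K[3]}) : set (proj_point K) :=
  [set p | vanishes F p /\ forall i : 'I_3, vanishes F^`M(i) p].

(* Over an algebraically closed field a curve satisfying this is reduced and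
   irreducible, as two plane curves always meet. *)
Definition smooth_curve (K : fieldType) (F : {mpoly K[3]}) :=
  plane_curve F /\ Sing F = set0.

Definition smooth_cubic (K : fieldType) (F : {mpoly K[3]}) :=
  smooth_curve F /\ homogeneous F 3.

(* [dim V / (I \cap V) = n], for subspaces [V] and [I] of [E]. *)
Definition quotient_dim (K : fieldType) (E : lmodType K) (V I : E -> Prop)
    (n : nat) :=
  exists2 b : 'I_n -> E, (forall i, V (b i)) &
    forall v, V v -> exists! c : 'rV[K]_n, I (v - \sum_i c 0 i *: b i).

Definition hilbert_function (K : fieldType) (F : {mpoly K[3]}) (m n : nat) :=
  quotient_dim (fun G => homogeneous G m) (fun G => exists h, G = h * F) n.

(* The Hilbert polynomial of a curve of degree [d] is [d * m + 1 - g]; for a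
   smooth curve the arithmetic genus [g] is the genus. *)
Definition has_genus (K : fieldType) (F : {mpoly K[3]}) (g : nat) :=
  exists d N : nat, forall m, (N <= m)%N ->
    exists2 n, hilbert_function F m n & (n + g = d * m + 1)%N.

Definition smooth_elliptic (K : fieldType) (F : {mpoly K[3]}) :=
  smooth_curve F /\ has_genus F 1.

Definition reduced_union_of (K : fieldType) (Q : {mpoly K[3]} -> Prop)
    (F : {mpoly K[3]}) :=
  reduced_curve F /\
  exists2 s : seq {mpoly K[3]}, (forall G, G \in s -> Q G) & F = \prod_(G <- s) G.

Definition cubic_configuration (K : fieldType) (F : {mpoly K[3]}) :=
  reduced_union_of (@smooth_cubic K) F.

Definition elliptic_configuration (K : fieldType) (F : {mpoly K[3]}) :=
  reduced_union_of (@smooth_elliptic K) F.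

(** * Blow-up of the plane at a finite set of points *)

(* [(q, None)] is the point of the blow-up over a point [q] which is not blown
   up; [(p, Some l)] is the point of the exceptional curve [E_p] given by the
   tangent direction at [p] of a line [l] through [p]. *)
Definition blowup_point (K : fieldType) : Type := proj_point K * option (proj_line K).

Definition blowup (K : fieldType) (P : set (proj_point K)) : set (blowup_point K) :=
  [set x | if x.2 is Some l then P x.1 /\ on_line x.1 l else ~ P x.1].

Definition adapted_frame (K : fieldType) (x : blowup_point K) (B : 'M[K]_3) :=
  [/\ B \in unitmx, row 0 B \in val x.1 &
      if x.2 is Some l then row 1 B \in val l else true].

(* With [u0, u1, u2] the rows of an adapted frame, the affine coordinates
   [(s, t)] centred at [x] are those for which the blow-down map is
   [(s, t) |-> [u0 + s u1 + t u2]] if [x = (q, None)], and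
   [(s, t) |-> [u0 + s (u1 + t u2)]] if [x = (p, Some l)]. In the second case
   [E_p] is [s = 0]. *)
Definition coord_s (K : fieldType) : {mpoly K[2]} := 'X_ord0.
Definition coord_t (K : fieldType) : {mpoly K[2]} := 'X_ord_max.

Definition chart_weight (K : fieldType) (x : blowup_point K) (i : 'I_3) :
    {mpoly K[2]} :=
  nth 0 [:: 1; coord_s K;
            if x.2 is Some _ then coord_s K * coord_t K else coord_t K] i.

Definition pullback (K : fieldType) (x : blowup_point K) (B : 'M[K]_3)
    (F : {mpoly K[3]}) : {mpoly K[2]} :=
  F \mPo [tuple \sum_(i < 3) B i j *: chart_weight x i | j < 3].

Definition split_exceptional (K : fieldType) (f : {mpoly K[2]}) (m : nat)
    (f0 : {mpoly K[2]}) :=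
  f = coord_s K ^+ m * f0 /\ ~ exists h, f0 = coord_s K * h.

(* The vanishing order along [E_p] of the total transform of [F = 0]; it does
   not depend on the point [x] of [E_p] at which it is computed. *)
Definition exceptional_order (K : fieldType) (P : set (proj_point K)) (p : proj_point K)
    (F : {mpoly K[3]}) (m : nat) :=
  exists x B f0, [/\ blowup P x, x.1 = p, adapted_frame x B &
                     split_exceptional (pullback x B F) m f0].

(* The effective divisor [G' + \sum_(p in P) a_p E_p], where [G'] is the strict
   transform of the curve [G = 0], [G = div_curve D] and [a = div_exc D]. All
   effective divisors on the blow-up are of this form. *)
Record divisor (K : fieldType) := Divisor {
  div_curve : {mpoly K[3]};
  div_exc : proj_point K -> nat
}.

Definition effective (K : fieldType) (D : divisor K) :=
  div_curve D != 0 /\ exists d, homogeneous (div_curve D) d.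

Definition strict_transform (K : fieldType) (F : {mpoly K[3]}) : divisor K :=
  Divisor F (fun=> 0%N).

Definition add_divisor (K : fieldType) (D D' : divisor K) : divisor K :=
  Divisor (div_curve D * div_curve D') (fun p => div_exc D p + div_exc D' p)%N.

(* [D - D'] is the divisor on the blow-up of the rational function [a / b]. *)
Definition lin_equiv (K : fieldType) (P : set (proj_point K)) (D D' : divisor K) :=
  exists (d : nat) (a b : {mpoly K[3]}),
    [/\ a != 0, b != 0, homogeneous a d, homogeneous b d &
        div_curve D * b = div_curve D' * a /\
        forall p, P p -> exists m n,
          [/\ exceptional_order P p a m, exceptional_order P p b n &
              (div_exc D p + n = div_exc D' p + m)%N]].

Definition no_common_component (K : fieldType) (P : set (proj_point K))
    (D D' : divisor K) :=
  (forall g h h' : {mpoly K[3]}, div_curve D = g * h -> div_curve D' = g * h' ->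
     (msize g <= 1)%N) /\
  (forall p, P p -> div_exc D p = 0%N \/ div_exc D' p = 0%N).

Definition local_equation (K : fieldType) (x : blowup_point K) (B : 'M[K]_3)
    (D : divisor K) (f : {mpoly K[2]}) :=
  if x.2 is Some _ then
    exists m f0, split_exceptional (pullback x B (div_curve D)) m f0 /\
                 f = coord_s K ^+ div_exc D x.1 * f0
  else f = pullback x B (div_curve D).

(* [p] belongs to the ideal [(f, g)] of the local ring of the plane at 0. *)
Definition local_ideal (K : fieldType) (f g p : {mpoly K[2]}) :=
  exists u a b : {mpoly K[2]}, u.@[fun=> 0] != 0 /\ u * p = a * f + b * g.

(* The dimension of [O / (f, g)], with [O] the local ring of the blow-up at
   [x] and [f], [g] local equations. Polynomials suffice: when
   [K[s, t] / (K[s, t] \cap (f, g))] is finite-dimensional it is isomorphic to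
   [O / (f, g)]. *)
Definition local_intersection (K : fieldType) (x : blowup_point K)
    (D D' : divisor K) (n : nat) :=
  exists B f g, [/\ adapted_frame x B, local_equation x B D f,
    local_equation x B D' g & quotient_dim (fun=> True) (local_ideal f g) n].

Definition intersection_number (K : fieldType) (P : set (proj_point K))
    (D D' : divisor K) (n : nat) :=
  exists i : blowup_point K -> nat,
    [/\ forall x, blowup P x -> local_intersection x D D' (i x),
        finite_set [set x | blowup P x /\ i x <> 0%N] &
        n = \big[addn/0%N]_(x \in blowup P) i x].

(* [D ^ 2 = D . D1 - D . D2] for any effective [D1], [D2] without common
   component with [D] such that [D] is linearly equivalent to [D1 - D2]. *)
Definition self_intersection (K : fieldType) (P : set (proj_point K)) (D : divisor K)
    (n : int) :=
  exists (D1 D2 : divisor K) (n1 n2 : nat),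
    [/\ effective D1 /\ effective D2,
        no_common_component P D D1 /\ no_common_component P D D2,
        lin_equiv P (add_divisor D D2) D1,
        intersection_number P D D1 n1 /\ intersection_number P D D2 n2 &
        n = n1%:Z - n2%:Z].

(** * H-constants of the complex projective plane *)

(* [H (C, P) = h]. *)
Definition H_value (R : realType) (F : {mpoly R[i][3]}) (P : set (proj_point R[i]))
    (h : R) :=
  [/\ finite_set P, P !=set0 &
      exists2 n : int, self_intersection P (strict_transform F) n &
                       h = n%:~R / #|` fset_set P|%:R].

Definition H_P2 (R : realType) : \bar R :=
  ereal_inf [set h%:E | h in
    [set h : R | exists F P, reduced_curve F /\ H_value F P h]].

Definition H_El_P2 (R : realType) : \bar R :=
  ereal_inf [set h%:E | h in
    [set h : R | exists F P, elliptic_configuration F /\ H_value F P h]].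

(* Main.v *)
Require Import Defs.
From HB Require Import structures.
From mathcomp Require Import all_boot all_order all_algebra.
From mathcomp Require Import complex finmap mpoly ring zify.
From mathcomp Require Import all_classical reals ereal topology normedtype.
From mathcomp Require Import sequences.

Set Implicit Arguments.
Unset Strict Implicit.
Unset Printing Implicit Defensive.

Import Order.TTheory GRing.Theory Num.Theory.
Import numFieldNormedType.Exports.

Local Open Scope classical_set_scope.
Local Open Scope ring_scope.

(* Consider the four pencils of cubics [pencil_cubic w k], [k < 4], spanned by
   the Fermat cubics and by their three Hesse transforms. Their base points are
   the 12 triple points of the dual Hesse arrangement, each a base point of
   three of the pencils, and the parameters of the four members through another
   point are collinear by threes, up to sign, as points of the elliptic curve
   [v ^ 3 = u ^ 3 - 1]. Hence, if from each pencil one takes the [M] members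
   whose parameters come from [n]-th level torsion points, two of these that
   meet outside the base points meet in a quadruple point of the configuration.
   There are then 12 points of multiplicity [3 M] and [3 M ^ 2 - O(M)] quadruple
   points. Since the members are smooth, the self-intersection of the strict
   transform is the square [(12 M) ^ 2] of the degree minus the sum of the
   squared multiplicities, namely [36 M ^ 2 - 48 M ^ 2 + O(M)], and dividing by
   [3 M ^ 2 + O(M)] points gives the limit [-4]. *)

(** Two members of different pencils meet in 9 points, and two pencils share 6 of the 12 base
    points, so 3 further points belong to each pair of parameters: this is the 3 in [3 M ^ 2]. A
    quadruple point lies on a member of the Fermat pencil and on one of pencil 0, so these two
    pencils suffice for the count. The loss [O(M)] comes from further points that fall onto base
    points. The group law of the elliptic curve is never constructed. Torsion means that an iterate
    of [lattes] lands in [crit], addition is the polynomial relation [collinear], and it suffices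
    that [lattes] preserves this relation and that [crit] is closed under it. On the geometric side,
    intersection numbers are dimensions of quotients of local rings. The linear equivalence is
    chosen such that the divisors to intersect with are multiples of a general line or of
    exceptional curves. Their local equations are units or powers of a coordinate, and the only
    quotients to compute are those by [(f, 'X_i ^+ e)]. *)

Lemma mpoly_ring_ind (n : nat) (R : comNzRingType) (P : {mpoly R[n]} -> Prop) :
  (forall c, P c%:MP) -> (forall i, P 'X_i) ->
  (forall p q, P p -> P q -> P (p + q)) -> (forall p q, P p -> P q -> P (p * q)) ->
  forall p, P p.
Proof.
move=> PC PX PD PM p; rewrite [p]mpolyE.
apply: (big_ind P); [by rewrite -mpolyC0 | exact: PD |] => m _.
rewrite -mul_mpolyC; apply/PM => //; rewrite mpolyXE_id.
apply: (big_ind P); [by rewrite -mpolyC1 | exact: PM |] => i _.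
elim: (m i) => [|k ih]; first by rewrite expr0 -mpolyC1.
by rewrite exprS; apply/PM.
Qed.

Lemma mpolyX_neq0 (n : nat) (R : nzRingType) (m : 'X_{1..n}) : 'X_[R, m] != 0.
Proof. by rewrite -msize_poly_eq0 msizeX. Qed.

(** * Local intersection with a smooth branch *)

Section LocalAlgebra.
Variable K : fieldType.
Implicit Types (f g u v : {mpoly K[2]}) (p q : {poly K}) (i j : 'I_2).

Definition axis_val i : 'I_2 -> {poly K} := fun l => if l == i then 0 else 'X.

(** Reduction modulo ['X_i], that is, restriction to the axis where that variable vanishes;
    [of_axis j], for the other variable, is a section of it. *)
Definition axis i : {mpoly K[2]} -> {poly K} := mmap (@polyC K) (axis_val i).
HB.instance Definition _ i := GRing.RMorphism.copy (axis i) (mmap (@polyC K) (axis_val i)).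

Definition of_axis j : {poly K} -> {mpoly K[2]} :=
  horner_morph (fun c => mulrC 'X_j (mpolyC 2 c)).
HB.instance Definition _ j := GRing.RMorphism.copy (of_axis j)
  (horner_morph (fun c => mulrC 'X_j (mpolyC 2 c))).

Lemma axisC i c : axis i c%:MP = c%:P.
Proof. exact: mmapC. Qed.

Lemma axisXi i : axis i 'X_i = 0.
Proof. by rewrite /axis mmapX mmap1U /axis_val eqxx. Qed.

Lemma axisXj i j : i != j -> axis i 'X_j = 'X.
Proof. by rewrite /axis mmapX mmap1U /axis_val eq_sym => /negPf ->. Qed.

Lemma of_axisC j c : of_axis j c%:P = c%:MP.
Proof. exact: horner_morphC. Qed.

Lemma of_axisX j : of_axis j 'X = 'X_j.
Proof. exact: horner_morphX. Qed.

Lemma of_axisK i j : i != j -> cancel (of_axis j) (axis i).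
Proof.
move=> ij; elim/poly_ind => [|p c ih]; first by rewrite !rmorph0.
by rewrite !rmorphD !rmorphM /= ih of_axisX of_axisC axisC axisXj.
Qed.

Lemma axis_decomp i j v : i != j -> exists r, v = of_axis j (axis i v) + 'X_i * r.
Proof.
move=> ij; elim/mpoly_ring_ind: v => [c|l|p q [r ep] [r' eq]|p q [r ep] [r' eq]].
- by exists 0; rewrite axisC of_axisC mulr0 addr0.
- have [->|li] := eqVneq l i.
    by exists 1; rewrite axisXi rmorph0 mulr1 add0r.
  have -> : l = j by case: i j l ij li => [[|[|?]] ?] [[|[|?]] ?] [[|[|?]] ?] //= _ _; apply: val_inj.
  by exists 0; rewrite axisXj // of_axisX mulr0 addr0.
- by exists (r + r'); rewrite rmorphD rmorphD /= {1}ep {1}eq mulrDr addrACA.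
- exists (of_axis j (axis i p) * r' + r * q); rewrite rmorphM rmorphM /= {1}ep mulrDl {1}eq.
  ring.
Qed.

Lemma axis_eq0 i v : axis i v = 0 -> exists r, v = 'X_i * r.
Proof.
move=> v0; have [|r] := @axis_decomp i (lift i ord0) v; first exact: neq_lift.
by rewrite v0 rmorph0 add0r; exists r.
Qed.

Lemma axis_horner0 i v : (axis i v).[0] = v.@[fun=> 0].
Proof.
elim/mpoly_ring_ind: v => [c|l|p q ep eq|p q ep eq].
- by rewrite axisC hornerC mevalC.
- by rewrite /axis mmapX mmap1U mevalXU /axis_val; case: ifP => _; rewrite ?hornerC ?hornerX.
- by rewrite rmorphD hornerD mevalD ep eq.
- by rewrite rmorphM hornerM mevalM ep eq.
Qed.

Lemma coprimep_Xn u k : u.@[fun=> 0] != 0 -> forall i, coprimep 'X^k (axis i u).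
Proof.
move=> u0 i; rewrite coprimep_sym; apply: coprimep_expr.
by rewrite -['X]subr0 -polyC0 coprimep_XsubC rootE axis_horner0.
Qed.

Section AxisIdeal.
Variables (i : 'I_2) (f : {mpoly K[2]}) (k : nat) (g : {poly K}).
Hypotheses (fE : axis i f = 'X^k * g) (g0 : g.[0] != 0).
Let j := lift i ord0.
Let ij : i != j. Proof. exact: neq_lift. Qed.

(** Modulo ['X_i] the local ring of the plane becomes that of the axis, where [f] is ['X^k] times a
    unit; the denominators are prime to ['X] and do not affect divisibility by ['X^k]. *)
Lemma local_ideal_axis v : local_ideal f 'X_i v <-> 'X^k %| axis i v.
Proof.
split=> [[u [a [b [u0 /(congr1 (axis i))]]]]|/dvdpP [q vE]].
  rewrite rmorphM rmorphD !rmorphM /= axisXi mulr0 addr0 fE => e.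
  rewrite -(Gauss_dvdpr _ (coprimep_Xn k u0 i)) e.
  by rewrite dvdp_mull // dvdp_mulr.
have [r rE] := axis_decomp v ij; have [h hE] := axis_decomp f ij.
exists (of_axis j g), (of_axis j q), (of_axis j g * r - of_axis j q * h); split.
  by rewrite -(axis_horner0 i) of_axisK.
rewrite {1}rE {1}hE fE vE !rmorphM /=; ring.
Qed.

(** The denominators of the local ring are not invertible as polynomials; Bezout on the axis
    supplies an inverse modulo the ideal. *)
Lemma unit_inverse_mod u : u.@[fun=> 0] != 0 -> exists u', local_ideal f 'X_i (1 - u * u').
Proof.
move=> u0; have /Bezout_eq1_coprimepP [[a b] /= e] := coprimep_Xn k u0 i.
exists (of_axis j b); apply/local_ideal_axis.
by rewrite rmorphB rmorphM rmorph1 /= of_axisK // -e mulrC [b * _]mulrC addrK dvdp_mulr.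
Qed.

Lemma quotient_dim_axis1 : quotient_dim (fun=> True) (local_ideal f 'X_i) k.
Proof.
exists (fun l : 'I_k => of_axis j 'X^l) => // v _.
have axisS (c : 'rV_k) :
    axis i (v - \sum_l c 0 l *: of_axis j 'X^l) = axis i v - rVpoly c.
  rewrite rmorphB rmorph_sum /= /rVpoly poly_def; congr (_ - _).
  apply: eq_bigr => l _; rewrite -mul_mpolyC rmorphM /= axisC of_axisK // mul_polyC.
  by congr (_ *: _); case: insubP => [l' _ /val_inj ->|]; rewrite ?ltn_ord.
exists (poly_rV (take_poly k (axis i v))); split.
  apply/local_ideal_axis; rewrite axisS poly_rV_K ?size_take_poly //.
  by rewrite -{1}(poly_take_drop k (axis i v)) addrAC subrr add0r dvdp_mull.
move=> c /local_ideal_axis; rewrite axisS => D.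
apply: (can_inj rVpolyK); rewrite poly_rV_K ?size_take_poly //.
have {D} : 'X^k %| take_poly k (axis i v) - rVpoly c.
  have -> : take_poly k (axis i v) - rVpoly c = (axis i v - rVpoly c) - drop_poly k (axis i v) * 'X^k.
    by rewrite -{2}(poly_take_drop k (axis i v)); ring.
  by apply: dvdp_sub => //; rewrite dvdp_mull.
move=> /dvdp_leq; rewrite size_polyXn => D; apply/eqP; rewrite -subr_eq0; apply/negPn/negP => /D.
rewrite leqNgt ltnS (leq_trans (size_polyD _ _)) // geq_max size_polyN size_take_poly.
exact: size_poly.
Qed.

Lemma axis_neq0 : axis i f != 0.
Proof.
rewrite fE mulf_eq0 expf_eq0 polyX_eq0 andbF /=.
by apply/negP => /eqP g00; case/eqP: g0; rewrite g00 horner0.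
Qed.

(** The prime ['X_i] does not divide [f], whose restriction to the axis is nonzero, so
    multiplication by [f] is injective modulo ['X_i ^+ e]. *)
Lemma dvdX_axis e a h : 'X_i ^+ e * h = a * f -> exists a', a = 'X_i ^+ e * a'.
Proof.
elim: e a h => [|e ih] a h; first by exists a; rewrite expr0 mul1r.
rewrite exprS -mulrA => E; have /axis_eq0 [a' aE] : axis i a = 0.
  move/(congr1 (axis i)): E; rewrite !rmorphM /= axisXi mul0r => /esym/eqP.
  by rewrite mulf_eq0 (negPf axis_neq0) orbF => /eqP.
move: E; rewrite aE -mulrA => /mulfI E; have {}E := E (mpolyX_neq0 _ _).
have [a'' ->] := ih _ _ E; by exists a''; rewrite mulrA.
Qed.

(** Induction along the exact sequence [0 -> O/(f, 'X_i) -> O/(f, 'X_i ^+ e.+1) -> O/(f, 'X_i ^+ e)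
    -> 0], whose first map is multiplication by ['X_i ^+ e]. The basis is that of the previous level
    followed by ['X_i ^+ e] times that of [O/(f, 'X_i)]. *)
Lemma quotient_dim_axis e : quotient_dim (fun=> True) (local_ideal f ('X_i ^+ e)) (e * k).
Proof.
elim: e => [|e [b _ bP]].
  exists (fun=> 0) => // v _; exists 0; split=> [|c _]; last by rewrite !thinmx0.
  exists 1, 0, v; rewrite meval1 oner_eq0 big1 => [|l _]; last by rewrite scaler0.
  by split=> //; rewrite expr0; ring.
rewrite mulSn addnC; have [b' _ b'P] := quotient_dim_axis1.
pose bb (x : 'I_(e * k + k)) := match fintype.split x with inl l => b l | inr l => 'X_i ^+ e * b' l end.
have bbS (c : 'rV_(e * k + k)) : \sum_x c 0 x *: bb x =
    \sum_l lsubmx c 0 l *: b l + 'X_i ^+ e * \sum_l rsubmx c 0 l *: b' l.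
  rewrite big_split_ord mulr_sumr /=; congr (_ + _); apply: eq_bigr => l _.
    by rewrite mxE /bb (unsplitK (inl l)).
  by rewrite mxE /bb (unsplitK (inr l)) scalerAr.
exists bb => // v _; have [c [[u [a [d [u0 E]]]] cP]] := bP v I.
(* The remainder at level [e] is [(a * f + d * 'X_i ^+ e) / u], so the element to expand in the
   basis [b'] is [d / u], represented by [u' * d]. *)
have [u' [u1 [a1 [d1 [u10 E1]]]]] := unit_inverse_mod u0.
have [c' [[u2 [a2 [d2 [u20 E2]]]] c'P]] := b'P (u' * d) I.
exists (row_mx c c'); split.
  exists (u * u1 * u2), (u1 * u2 * a + 'X_i ^+ e * (u2 * a1 * d + u * u1 * a2)),
    (u2 * d1 * d + u * u1 * d2); split.
    by rewrite !mevalM !mulf_neq0.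
  rewrite bbS row_mxKl row_mxKr.
  set B := \sum_l _; set B' := \sum_l _.
  have -> : u * u1 * u2 * (v - (B + 'X_i ^+ e * B')) =
     u1 * u2 * (u * (v - B)) - 'X_i ^+ e * u * u1 * (u2 * (u' * d)) +
     'X_i ^+ e * u * u1 * (u2 * (u' * d - B')) by ring.
  rewrite E2 E.
  have -> : u1 * u2 * (a * f + d * 'X_i ^+ e) - 'X_i ^+ e * u * u1 * (u2 * (u' * d)) =
     u1 * u2 * a * f + 'X_i ^+ e * u2 * d * (u1 * (1 - u * u')) by ring.
  rewrite E1 exprSr; ring.
move=> cc [u3 [a3 [d3 [u30]]]]; rewrite bbS exprSr.
set B := \sum_l lsubmx cc _ _ *: _; set B' := \sum_l _ => E3.
have cE : c = lsubmx cc.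
  apply: cP; exists u3, a3, (d3 * 'X_i + u3 * B'); split=> //; rewrite -/B.
  have -> : u3 * (v - B) = u3 * (v - (B + 'X_i ^+ e * B')) + u3 * 'X_i ^+ e * B' by ring.
  by rewrite E3; ring.
rewrite -[cc]hsubmxK -cE; congr row_mx; apply: c'P; rewrite -/B'.
(* The two expansions differ by ['X_i ^+ e] times a relation for the second block; [dvdX_axis]
   allows cancelling this factor, which reduces to exponent 1. *)
have E4 : 'X_i ^+ e * (u3 * d - u * u3 * B' - u * d3 * 'X_i) = (u * a3 - u3 * a) * f.
  have : u * (u3 * (v - (B + 'X_i ^+ e * B'))) = u3 * (u * (v - B)) - u * u3 * 'X_i ^+ e * B' by ring.
  rewrite {2}/B -cE E E3 => /eqP; rewrite -subr_eq0 => /eqP E4.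
  by apply/eqP; rewrite eq_sym -subr_eq0 -E4; apply/eqP; ring.
have [a' aE] := dvdX_axis E4.
have E5 : u * u3 * B' = u3 * d - a' * f - u * d3 * 'X_i.
  apply: (@mulfI _ ('X_i ^+ e)); first exact/expf_neq0/mpolyX_neq0.
  have -> : 'X_i ^+ e * (u3 * d - a' * f - u * d3 * 'X_i) =
    'X_i ^+ e * (u3 * d - u * d3 * 'X_i) - 'X_i ^+ e * a' * f by ring.
  by rewrite -aE -E4; ring.
exists (u1 * u * u3), (u1 * a' - u3 * d * a1), (u1 * u * d3 - u3 * d * d1); split.
  by rewrite !mevalM !mulf_neq0.
have -> : u1 * u * u3 * (u' * d - B') = - u3 * d * (u1 * (1 - u * u')) + u1 * u3 * d - u1 * (u * u3 * B') by ring.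
by rewrite E1 E5; ring.
Qed.

End AxisIdeal.
End LocalAlgebra.

Lemma homog_eval (R : comNzRingType) (n d : nat) (F : {mpoly R[n]}) (c : R) (v : 'I_n -> R) :
  F \is d.-homog for mdeg -> F.@[fun i => c * v i] = c ^+ d * F.@[v].
Proof.
move=> /dhomogP hF; rewrite !mevalE mulr_sumr !big_seq; apply: eq_bigr => m /hF md.
have {md} <- : mdeg m = d by []; rewrite mulrCA mdegE; congr (_ * _); rewrite -prodrXr -big_split /=.
by apply: eq_bigr => i _; rewrite exprMn.
Qed.

Lemma euler_homog (R : comNzRingType) (n d : nat) (F : {mpoly R[n]}) :
  F \is d.-homog for mdeg -> \sum_i 'X_i * F^`M(i) = d%:R *: F.
Proof.
move=> /dhomogP hF; rewrite {2}[F]mpolyE scaler_sumr.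
under eq_bigr => i _ do rewrite {1}[F]mpolyE linear_sum mulr_sumr /=.
rewrite exchange_big /= !big_seq; apply: eq_bigr => m /hF md; have {md} <- : mdeg m = d by [].
under eq_bigr => i _ do rewrite linearZ /= mderivX -scalerAr -scalerAr.
rewrite -scaler_sumr scalerA mulrC -scalerA; congr (_ *: _); rewrite mdegE natr_sum scaler_suml.
apply: eq_bigr => i _; have [->|mi] := eqVneq (m i) 0%N; first by rewrite !scale0r.
by rewrite -mpolyXD addmC submK // lep1mP.
Qed.

(** * Pullbacks to the blow-up *)

Section Frames.
Variable K : fieldType.
Implicit Types (u v : 'rV[K]_3) (p q : proj_point K) (F G : {mpoly K[3]}) (B : 'M[K]_3).

Lemma exists_notin (U : {vspace 'rV[K]_3}) : (\dim U < 3)%N -> exists u, u \notin U.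
Proof.
move=> dU; have /subvPn [u _ uU] : ~~ (fullv <= U)%VS; last by exists u.
by apply: contraL dU => /dimvS; rewrite dimvf /dim /= mul1n -leqNgt.
Qed.

Lemma frame_of3 u0 u1 u2 : u0 != 0 -> u1 \notin <[u0]>%VS -> u2 \notin (<[u0]> + <[u1]>)%VS ->
  exists B, [/\ B \in unitmx, row 0 B = u0, row 1 B = u1 & row 2%:R B = u2].
Proof.
move=> u00 u10 u20; pose B := \matrix_(i < 3) nth 0 [:: u0; u1; u2] i.
exists B; rewrite !rowK; split=> //; rewrite -row_free_unit; apply: inj_row_free => c.
rewrite mulmx_sum_row !big_ord_recl big_ord0 !rowK /= addr0 => e.
have c2 : c 0 (lift ord0 (lift ord0 ord0)) = 0.
  apply/eqP/negPn/negP => c2; case/negP: u20.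
  rewrite -[u2](scalerK c2) memvZ //; move/eqP: e.
  rewrite addrA addr_eq0 => /eqP e; rewrite -[_ *: u2]opprK -e memvN.
  by apply: memv_add; rewrite memvZ ?memv_line.
rewrite c2 scale0r addr0 in e.
have c1 : c 0 (lift ord0 ord0) = 0.
  apply/eqP/negPn/negP => c1; case/negP: u10.
  rewrite -[u1](scalerK c1) memvZ //; move/eqP: e.
  by rewrite addr_eq0 => /eqP e; rewrite -[_ *: u1]opprK -e memvN memvZ ?memv_line.
rewrite c1 scale0r addr0 in e; move/eqP: e; rewrite scaler_eq0 (negPf u00) orbF => /eqP c0.
by apply/rowP => i; rewrite mxE; case: i => [[|[|[|?]]] ?] //;
  [rewrite -c0|rewrite -c1|rewrite -c2]; congr (c _ _); apply: val_inj.
Qed.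

Lemma frame_of2 u0 u1 : u0 != 0 -> u1 \notin <[u0]>%VS ->
  exists B, [/\ B \in unitmx, row 0 B = u0 & row 1 B = u1].
Proof.
move=> u00 u10; have [|u2 u20] := @exists_notin (<[u0]> + <[u1]>)%VS.
  by rewrite (leq_ltn_trans (dimv_add_leqif _ _)) // !dim_vline; case: eqP; case: eqP.
by have [B [? ? ? _]] := frame_of3 u00 u10 u20; exists B.
Qed.

Lemma frame_of1 u0 : u0 != 0 -> exists B, B \in unitmx /\ row 0 B = u0.
Proof.
move=> u00; have [|u1 u10] := @exists_notin <[u0]>%VS; first by rewrite dim_vline u00.
by have [B [? ? _]] := frame_of2 u00 u10; exists B.
Qed.

Definition pt_vec p : 'rV[K]_3 := vpick (val p).

Lemma pt_vec_neq0 p : pt_vec p != 0.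
Proof. by rewrite vpick0 -dimv_eq0 (eqP (valP p)). Qed.

Lemma pt_vec_in p : pt_vec p \in val p.
Proof. exact: memv_pick. Qed.

Lemma val_line p v : v != 0 -> v \in val p -> val p = <[v]>%VS.
Proof.
move=> v0 vp; apply/esym/eqP.
by rewrite eqEdim dim_vline v0 (eqP (valP p)) leqnn andbT -memvE.
Qed.

Lemma val_pt_vec p : val p = <[pt_vec p]>%VS.
Proof. exact: val_line (pt_vec_neq0 p) (pt_vec_in p). Qed.

Lemma in_pointP p v : reflect (exists c, v = c *: pt_vec p) (v \in val p).
Proof. by rewrite val_pt_vec; exact: vlineP. Qed.

Definition point_of u (u0 : u != 0) : proj_point K :=
  exist (fun U : {vspace 'rV[K]_3} => \dim U == 1%N) <[u]>%VS
    (introT eqP (etrans (dim_vline u) (congr1 nat_of_bool u0))).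

Lemma point_eq p q v : v != 0 -> v \in val p -> v \in val q -> p = q.
Proof. by move=> v0 vp vq; apply: val_inj; rewrite /= (val_line v0 vp) (val_line v0 vq). Qed.

Definition vanb F p := F.@[pt_vec p 0] == 0.

Lemma vanbP F p : reflect (vanishes F p) (vanb F p).
Proof. exact: eqP. Qed.

Lemma mevalZv F d c v : homogeneous F d -> F.@[(c *: v) 0] = c ^+ d * F.@[v 0].
Proof.
by move=> hF; rewrite -(homog_eval _ _ hF); apply: meval_eq => i; rewrite mxE.
Qed.

Lemma vanb_at F d p v : homogeneous F d -> v != 0 -> v \in val p -> vanb F p = (F.@[v 0] == 0).
Proof.
move=> hF v0 /in_pointP [c e]; rewrite /vanb e (mevalZv _ _ hF) mulf_eq0.
have c0 : c != 0 by apply: contraNneq v0 => c0; rewrite e c0 scale0r.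
by rewrite expf_eq0 (negPf c0) andbF.
Qed.

Lemma frame_at x : (if x.2 is Some l then on_line x.1 l else true) ->
  exists B, adapted_frame x B /\ row 0 B = pt_vec x.1.
Proof.
case: x => p [l|] /= => [pl|_]; last first.
  have [B [uB r0]] := frame_of1 (pt_vec_neq0 p).
  by exists B; split=> //; split=> //=; rewrite r0 pt_vec_in.
have /subvPn [u1 u1l u1p] : ~~ (val l <= val p)%VS.
  by apply/negP => /dimvS; rewrite (eqP (valP p)) (eqP (valP l)).
have [|B [uB r0 r1]] := @frame_of2 (pt_vec p) u1 (pt_vec_neq0 p); first by rewrite -val_pt_vec.
by exists B; split=> //; split=> //=; rewrite ?r0 ?r1 ?pt_vec_in.
Qed.

Definition grad F u : 'cV[K]_3 := \col_j F^`M(j).@[u 0].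
Definition dform F u v : K := \sum_j F^`M(j).@[u 0] * v 0 j.

Lemma dformE F u v : v *m grad F u = (dform F u v)%:M.
Proof.
apply/matrixP => i j; rewrite !ord1 !mxE eqxx mulr1n.
by apply: eq_bigr => l _; rewrite !mxE mulrC.
Qed.

Lemma dform_euler F d u : homogeneous F d -> F.@[u 0] = 0 -> dform F u u = 0.
Proof.
move=> /euler_homog /(congr1 (meval (u 0))); rewrite mevalZ raddf_sum /= => e e0.
rewrite e0 mulr0 in e; rewrite -e; apply: eq_bigr => j _.
by rewrite mevalM mevalXU mulrC.
Qed.

(** The step [s] and the direction [h] live in an arbitrary ring over [K], which covers the blow-up
    charts, with [s] the equation of the exceptional curve, as well as lines, with [s] the
    indeterminate. *)
Lemma mmap_taylor (S : comNzRingType) (f : {rmorphism K -> S}) (s : S) (h : 'I_3 -> S) u F :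
  exists r, mmap f (fun j => f (u 0 j) + s * h j) F =
    f F.@[u 0] + s * (\sum_j f F^`M(j).@[u 0] * h j) + s ^+ 2 * r.
Proof.
elim/mpoly_ring_ind: F => [c|i|F G [r rE] [r' r'E]|F G [r rE] [r' r'E]].
- exists 0; rewrite mmapC mevalC mulr0 addr0 big1 ?mulr0 ?addr0 // => j _.
  by rewrite mderivC meval0 rmorph0 mul0r.
- exists 0; rewrite mmapX mmap1U mevalXU mulr0 addr0; congr (_ + _ * _).
  rewrite (bigD1 i) //= mderivX mnm1E eqxx (_ : (U_(i) - U_(i))%MM = 0%MM); last first.
    by apply/mnmP => k; rewrite mnmBE subnn mnm0E.
  rewrite mpolyX0 mevalZ meval1 mulr1 rmorph1 mul1r.
  rewrite big1 ?addr0 // => j ji; rewrite mderivX mnm1E eq_sym (negPf ji).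
  by rewrite mevalZ mul0r rmorph0 mul0r.
- exists (r + r'); rewrite mmapD rE r'E mevalD rmorphD /=.
  have -> : \sum_j f (F + G)^`M(j).@[u 0] * h j =
    \sum_j f F^`M(j).@[u 0] * h j + \sum_j f G^`M(j).@[u 0] * h j.
    by rewrite -big_split; apply: eq_bigr => j _; rewrite mderivD mevalD rmorphD mulrDl.
  by ring.
rewrite rmorphM /= rE r'E mevalM rmorphM /=.
have -> : \sum_j f (F * G)^`M(j).@[u 0] * h j =
    f G.@[u 0] * (\sum_j f F^`M(j).@[u 0] * h j) + f F.@[u 0] * \sum_j f G^`M(j).@[u 0] * h j.
  rewrite !mulr_sumr -big_split; apply: eq_bigr => j _ /=.
  by rewrite mderivM mevalD !mevalM rmorphD !rmorphM mulrDl !mulrA [f G.@[_] * _]mulrC.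
set A := \sum_j _; set B := \sum_j _.
exists (A * B + f F.@[u 0] * r' + f G.@[u 0] * r + s * (A * r' + B * r) + s ^+ 2 * r * r').
by ring.
Qed.

Lemma pullback_rmorphM x B F G : pullback x B (F * G) = pullback x B F * pullback x B G.
Proof. exact: rmorphM. Qed.

Lemma pullback1 x B : pullback x B 1 = 1.
Proof. exact: rmorph1. Qed.

Lemma pullback_exc p l B F : exists r, pullback (p, Some l) B F =
  F.@[row 0 B 0]%:MP + coord_s K * ((dform F (row 0 B) (row 1 B))%:MP
     + (dform F (row 0 B) (row 2%:R B))%:MP * coord_t K) + coord_s K ^+ 2 * r.
Proof.
have [r rE] := @mmap_taylor _ (@mpolyC 2 K) (coord_s K) (fun j => (B 1 j)%:MP + (B 2%:R j)%:MP * coord_t K) (row 0 B) F.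
exists r; rewrite /pullback /comp_mpoly.
have -> : mmap (@mpolyC 2 K) (tnth [tuple \sum_(i < 3) B i j *: chart_weight (p, Some l) i | j < 3]) F =
   mmap (@mpolyC 2 K) (fun j => (row 0 B 0 j)%:MP + coord_s K * ((B 1 j)%:MP + (B 2%:R j)%:MP * coord_t K)) F.
  rewrite /mmap; apply: eq_bigr => m _; congr (_ * _); apply: mmap1_eq => j.
  rewrite tnth_mktuple !big_ord_recl big_ord0 /chart_weight /= mxE.
  rewrite -!mul_mpolyC; have -> : lift ord0 ord0 = 1 :> 'I_3 by exact: val_inj.
  have -> : lift ord0 (lift ord0 ord0) = 2%:R :> 'I_3 by exact: val_inj.
  by ring.
rewrite rE; congr (_ + _ * _ + _).
under eq_bigr => j _ do rewrite mulrDr -mpolyCM mulrA -mpolyCM.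
rewrite big_split /= -mulr_suml -!raddf_sum /=; congr (_ %:MP + _ %:MP * _).
  by apply: eq_bigr => j _; rewrite mxE.
by apply: eq_bigr => j _; rewrite mxE.
Qed.

Lemma local_dim0l (f g : {mpoly K[2]}) :
  f.@[fun=> 0] != 0 -> quotient_dim (fun=> True) (local_ideal f g) 0.
Proof.
move=> f0; exists (fun=> 0) => // v _; exists 0; split=> [|c _]; last by rewrite !thinmx0.
by exists f, v, 0; split=> //; rewrite big_ord0; ring.
Qed.

Lemma local_dim0r (f g : {mpoly K[2]}) :
  g.@[fun=> 0] != 0 -> quotient_dim (fun=> True) (local_ideal f g) 0.
Proof.
move=> g0; exists (fun=> 0) => // v _; exists 0; split=> [|c _]; last by rewrite !thinmx0.
by exists g, 0, v; split=> //; rewrite big_ord0; ring.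
Qed.

Definition smooth_at u F := F.@[u 0] = 0 -> exists v, dform F u v != 0.

(** By Euler's relation the differential kills [row 0 B]; were it zero on the two other rows too, it
    would vanish on a basis, against smoothness. *)
Lemma frame_dform F d B : homogeneous F d -> B \in unitmx -> smooth_at (row 0 B) F ->
  F.@[row 0 B 0] = 0 -> dform F (row 0 B) (row 1 B) = 0 -> dform F (row 0 B) (row 2%:R B) != 0.
Proof.
move=> hF uB sm F0 d1; have [v] := sm F0; apply: contraNneq => d2.
have dlin c w w' : dform F (row 0 B) (c *: w + w') = c * dform F (row 0 B) w + dform F (row 0 B) w'.
  rewrite mulr_sumr -big_split; apply: eq_bigr => j _; rewrite !mxE mulrDr; congr (_ + _); ring.
have -> : v = (v *m invmx B) *m B by rewrite mulmxKV.
rewrite mulmx_sum_row !big_ord_recl big_ord0.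
have -> : lift ord0 ord0 = 1 :> 'I_3 by exact: val_inj.
have -> : lift ord0 (lift ord0 ord0) = 2%:R :> 'I_3 by exact: val_inj.
rewrite !dlin d1 d2 (dform_euler hF F0) !mulr0 !add0r.
by rewrite /dform big1 // => j _; rewrite mxE mulr0.
Qed.

Lemma exc_factor (R : comNzRingType) (s a r y f : R) :
  (0 + s * a + s ^+ 2 * r) * (y * f) = s * y * ((a + s * r) * f).
Proof. ring. Qed.

Lemma axisM i (a b : {mpoly K[2]}) : axis i (a * b) = axis i a * axis i b.
Proof. exact: rmorphM. Qed.

Lemma axisD i (a b : {mpoly K[2]}) : axis i (a + b) = axis i a + axis i b.
Proof. exact: rmorphD. Qed.

Lemma axisDX i (a b : {mpoly K[2]}) : axis i (a + 'X_i * b) = axis i a.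
Proof. by rewrite rmorphD rmorphM /= axisXi mul0r addr0. Qed.

(** Each smooth factor through [p] contributes one power of [coord_s], its linear term being
    nonzero. What remains of it restricts to [E_p] as [d1 + d2 * t]: a unit at the origin unless
    [d1 = 0], that is, unless [row 1 B] is a tangent direction, and then a simple zero. *)
Lemma pullback_exc_prod p l B (s : seq {mpoly K[3]}) :
  B \in unitmx -> (forall G, G \in s -> smooth_at (row 0 B) G /\ exists d, homogeneous G d) ->
  exists f0 g, [/\ pullback (p, Some l) B (\prod_(G <- s) G) =
      coord_s K ^+ (count (fun G => G.@[row 0 B 0] == 0) s) * f0,
      axis ord0 f0 = 'X^(count (fun G => (G.@[row 0 B 0] == 0) &&
                               (dform G (row 0 B) (row 1 B) == 0)) s) * g
      & g.[0] != 0].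
Proof.
move=> uB; elim: s => [|G s ih] hs.
  by exists 1, 1; rewrite big_nil pullback1 rmorph1 !expr0 !mulr1 hornerC oner_eq0.
have [|f0 [g [fE aE g0]]] := ih; first by move=> H Hs; apply: hs; rewrite inE Hs orbT.
have [smG [d hG]] := hs G (mem_head _ _); rewrite big_cons pullback_rmorphM fE /=.
have [r rE] := pullback_exc p l B G; rewrite rE.
set d1 := dform _ _ (row 1 B); set d2 := dform _ _ (row 2%:R B).
have [G0|G0] /= := eqVneq; last first.
  exists ((G.@[row 0 B 0]%:MP + coord_s K * (d1%:MP + d2%:MP * coord_t K + coord_s K * r)) * f0).
  exists (G.@[row 0 B 0]%:P * g); rewrite !add0n; split.
  - rewrite mulrCA; congr (_ * (_ * _)); ring.
  - by rewrite axisM axisDX axisC aE mulrCA.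
  - by rewrite hornerM hornerC mulf_neq0.
exists ((d1%:MP + d2%:MP * coord_t K + coord_s K * r) * f0).
have axG : axis ord0 (d1%:MP + d2%:MP * coord_t K + coord_s K * r) = d1%:P + d2%:P * 'X.
  by rewrite axisDX axisD axisM !axisC axisXj.
have [d10|d10] /= := eqVneq d1 0; last first.
  exists ((d1%:P + d2%:P * 'X) * g); rewrite add0n add1n; split.
  - rewrite G0 mpolyC0 [in RHS]exprS; exact: exc_factor.
  - by rewrite axisM axG aE mulrCA.
  - by rewrite hornerM hornerD hornerM !hornerC hornerX mulr0 addr0 mulf_neq0.
exists (d2%:P * g); rewrite !add1n; split.
- rewrite G0 mpolyC0 [in RHS]exprS; exact: exc_factor.
- rewrite axisM axG aE d10 polyC0 add0r exprS; move: 'X^(count _ _) => Y.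
  by rewrite [d2%:P * _]mulrC -[LHS]mulrA -[RHS]mulrA; congr (_ * _); exact: mulrCA.
- by rewrite hornerM hornerC mulf_neq0 //; apply: (frame_dform hG).
Qed.

Definition tspace F p : {vspace 'rV[K]_3} := lker (linfun (mulmxr (grad F (pt_vec p)))).

Lemma tspaceP F p v : (v \in tspace F p) = (dform F (pt_vec p) v == 0).
Proof.
rewrite memv_ker lfunE /= dformE; apply/eqP/eqP => [/matrixP/(_ 0 0)|->]; last by rewrite raddf0.
by rewrite !mxE eqxx mulr1n.
Qed.

Lemma dim_tspace F p : smooth_at (pt_vec p) F -> F.@[pt_vec p 0] = 0 -> \dim (tspace F p) == 2%N.
Proof.
move=> sm F0; have [v dv] := sm F0; pose f : 'Hom('rV[K]_3, 'M[K]_1) := linfun (mulmxr (grad F (pt_vec p))).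
have := limg_ker_dim f fullv.
rewrite capfv -/(tspace F p) dimvf /dim /= mul1n => e.
have le1 := dimvS (subvf (f @: fullv)%VS).
rewrite dimvf /dim /= mul1n in le1.
have ge : (\dim (tspace F p) < 3)%N.
  rewrite ltn_neqAle; apply/andP; split; last by have := leq_addr (\dim (limg f)) (\dim (tspace F p)); rewrite e.
  apply: contraNneq dv => e3; rewrite -tspaceP.
  have /eqP -> : tspace F p == fullv by rewrite eqEdim subvf dimvf /dim /= mul1n e3.
  exact: memvf.
by move: e le1 ge; case: (\dim (tspace F p)) => [|[|[|]]] //=; case: (\dim _) => [|[|[|]]].
Qed.

(** Rows 0 and 1 of the frame span [l], and row 0 is always tangent by Euler's relation, so row 1
    decides. *)
Lemma tangent_frame F d p (l : proj_line K) B : homogeneous F d -> smooth_at (pt_vec p) F ->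
  F.@[pt_vec p 0] = 0 -> adapted_frame (p, Some l) B -> row 0 B = pt_vec p ->
  on_line p l -> (dform F (pt_vec p) (row 1 B) == 0) = (tspace F p == val l).
Proof.
move=> hF sm F0 [uB _ /= r1l] r0 pl; rewrite -tspaceP; apply/idP/eqP => [r1t|->//].
set u0 := row 0 B in r0 *; set u1 := row 1 B in r1l r1t *.
have r1p : u1 \notin <[u0]>%VS.
  apply/negP => /vlineP [c e].
  have : \row_j ((j == 1)%:R - c *+ (j == 0)) *m B = 0 :> 'rV_3.
    rewrite mulmx_sum_row !big_ord_recl big_ord0 !mxE /=.
    have -> : lift ord0 ord0 = 1 :> 'I_3 by exact: val_inj.
    by rewrite -/u1 e !mulr0n !mulr1n sub0r subr0 scale1r subrr scale0r !addr0 scaleNr addNr.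
  move=> /(congr1 (mulmx^~ (invmx B))); rewrite mulmxK // mul0mx => /rowP/(_ 1).
  by rewrite !mxE /= mulr0n subr0 => /eqP; rewrite oner_eq0.
have dl : \dim (<[u0]> + <[u1]>) = 2%N.
  have /directvP -> : directv (<[u0]> + <[u1]>).
    apply/directv_addP; rewrite capvC; apply/eqP; rewrite -subv0; apply/subvP => w; rewrite memv_cap memv0 => /andP [/vlineP [c ->]].
    have [->|c0] := eqVneq c 0; first by rewrite scale0r.
    by move=> /(memvZ c^-1); rewrite scalerK // (negPf r1p).
  rewrite /= !dim_vline r0 pt_vec_neq0; case: eqP => // e; case/negP: r1p; rewrite e; exact: mem0v.
have dE (U : {vspace 'rV[K]_3}) : \dim U == 2%N -> u0 \in U -> u1 \in U ->
    U = (<[u0]> + <[u1]>)%VS.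
  move=> /eqP dU a b; apply/esym/eqP; rewrite eqEdim dU dl leqnn andbT subv_add.
  by rewrite -!memvE a b.
have u0t : u0 \in tspace F p by rewrite tspaceP r0 (dform_euler hF F0).
have u0l : u0 \in sval l by rewrite r0; apply: (subvP pl); rewrite pt_vec_in.
by rewrite (dE _ (dim_tspace sm F0) u0t r1t) (dE _ (valP l) u0l r1l).
Qed.

End Frames.

(** * Lines avoiding finitely many points, and polynomials with few zeros *)

Section Generic.
Variable K : numClosedFieldType.
Implicit Types (u v w : 'rV[K]_3) (F G g : {mpoly K[3]}) (p q : {poly K}).

Lemma poly_zero_everywhere p : (forall c, p.[c] = 0) -> p = 0.
Proof.
move=> p0; apply/eqP/negPn/negP => pn0.
have := @max_poly_roots _ p [seq i%:R | i <- iota 0 (size p)] pn0.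
rewrite size_map size_iota ltnn => /(_ _ _)/notF; apply.
  by apply/allP => _ /mapP [i _ ->]; rewrite rootE p0.
by rewrite map_inj_uniq ?iota_uniq // => i j /eqP; rewrite eqr_nat => /eqP.
Qed.

Lemma avoid_seq (s : seq K) : exists c, c \notin s.
Proof.
apply: contrapT => /forallNP h.
have /eqP : \prod_(z <- s) ('X - z%:P) = 0.
  apply: poly_zero_everywhere => c; apply/rootP; rewrite root_prod_XsubC.
  by apply/negPn/negP => /h.
by rewrite (negPf (monic_neq0 (monic_prod_XsubC _ _ _))).
Qed.

(** Restriction to the line through [u] and [w]. The point [w] is at infinity in this
    parametrisation; for a form of degree [d], the value there is the coefficient of degree [d]. *)
Definition lineF u w : {mpoly K[3]} -> {poly K} :=
  mmap (@polyC K) (fun j => (u 0 j)%:P + 'X * (w 0 j)%:P).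

HB.instance Definition _ u w := GRing.RMorphism.copy (lineF u w)
  (mmap (@polyC K) (fun j => (u 0 j)%:P + 'X * (w 0 j)%:P)).

Lemma lineFX u w j : lineF u w 'X_j = (u 0 j)%:P + 'X * (w 0 j)%:P.
Proof. by rewrite /lineF mmapX mmap1U. Qed.

Lemma lineFC u w c : lineF u w c%:MP = c%:P.
Proof. exact: mmapC. Qed.

Lemma lineF_horner u w c F : (lineF u w F).[c] = F.@[(u + c *: w) 0].
Proof.
elim/mpoly_ring_ind: F => [a|j|F G ep eq|F G ep eq].
- by rewrite lineFC hornerC mevalC.
- by rewrite lineFX mevalXU hornerD hornerM hornerX !hornerC !mxE.
- by rewrite rmorphD hornerD mevalD ep eq.
- by rewrite rmorphM hornerM mevalM ep eq.
Qed.

Lemma lineF_shift u w c F : lineF (u + c *: w) w F = lineF u w F \Po ('X + c%:P).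
Proof.
elim/mpoly_ring_ind: F => [a|j|F G ep eq|F G ep eq].
- by rewrite !lineFC comp_polyC.
- rewrite !lineFX !mxE comp_polyD comp_polyM comp_polyX !comp_polyC polyCD polyCM; ring.
- by rewrite [in LHS]rmorphD [in RHS]rmorphD comp_polyD /= ep eq.
- by rewrite [in LHS]rmorphM [in RHS]rmorphM comp_polyM /= ep eq.
Qed.

(** If a polynomial vanishes everywhere, so do its partial derivatives, and in characteristic 0 its
    coefficient at [m] is recovered from that of a derivative at [m - U_(i)]. The induction ends at
    the constant coefficient, the value at 0. *)
Lemma mpoly_zero_everywhere F : (forall v, F.@[v 0] = 0) -> F = 0.
Proof.
have vanD (G : {mpoly K[3]}) i : (forall v, G.@[v 0] = 0) -> forall v, G^`M(i).@[v 0] = 0.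
  move=> G0 v; have [r] := mmap_taylor (@polyC K) 'X (fun j => (delta_mx (0 : 'I_1) i 0 j)%:P) v G.
  have -> : mmap (@polyC K) (fun j => (v 0 j)%:P + 'X * (delta_mx (0 : 'I_1) i 0 j)%:P) G = 0.
    by apply: poly_zero_everywhere => c; rewrite [LHS]lineF_horner.
  rewrite G0 (bigD1 i) //= big1 ?addr0 => [|j ji]; last first.
    by rewrite mxE eqxx (negPf ji) /= polyC0 mulr0.
  rewrite mxE !eqxx /= mulr1 => /(congr1 (fun p : {poly K} => p`_1)).
  by rewrite !coefD coefXM !coefC coefXnM /= add0r addr0 => <-.
suff coef0 m G : (forall v, G.@[v 0] = 0) -> G@_m = 0.
  by move=> F0; apply/mpolyP => m; rewrite coef0 // mcoeff0.
have [k] := ubnP (mdeg m); elim: k m G => // k ih m G mk G0.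
have [->|] := eqVneq m 0%MM.
  have := G0 0; rewrite [G]mpolyE raddf_sum /= => e0.
  rewrite -[RHS]e0 -mpolyE.
  have [m0|m0] := boolP (0%MM \in msupp G); last first.
    rewrite (memN_msupp_eq0 m0) big_seq big1 // => m1 m1G; rewrite mevalZ mevalX.
    have [i mi] : exists i, m1 i != 0%N.
      apply: contrapT => /forallNP h; case/negP: m0; rewrite (_ : 0%MM = m1) //.
      by apply/mnmP => i; rewrite mnm0E; apply/esym/eqP/negPn/negP/h.
    by rewrite (bigD1 i) //= mxE expr0n (negPf mi) mul0r mulr0.
  rewrite (bigD1_seq _ m0 (msupp_uniq _)) /= mevalZ mevalX big1 ?mulr1 => [|i _]; last first.
    by rewrite mnm0E expr0.
  rewrite big1 ?addr0 // => m1 m1n; rewrite mevalZ mevalX.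
  have [i mi] : exists i, m1 i != 0%N.
    apply: contrapT => /forallNP h; case/eqP: m1n.
    by apply/mnmP => i; rewrite mnm0E; apply/eqP/negPn/negP/h.
  by rewrite (bigD1 i) //= mxE expr0n (negPf mi) mul0r mulr0.
move=> mn0; have [i mi] : exists i, m i != 0%N.
  apply: contrapT => /forallNP h; case/eqP: mn0.
  by apply/mnmP => i; rewrite mnm0E; apply/eqP/negPn/negP/h.
have mE : m = (m - U_(i) + U_(i))%MM by rewrite submK // lep1mP.
have md : (mdeg (m - U_(i))%MM < k)%N by move: mk; rewrite {1}mE mdegD mdeg1 addn1.
have /eqP := ih _ _ md (vanD _ i G0); rewrite mcoeff_deriv -mE mulrn_eq0 /=.
exact: eqP.
Qed.

(* [lform B] is the third coordinate in the frame [B]. *)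
Definition lform (B : 'M[K]_3) : {mpoly K[3]} := \sum_j invmx B j 2%:R *: 'X_j.

Lemma lform_eval B v : (lform B).@[v 0] = (v *m invmx B) 0 2%:R.
Proof. by rewrite raddf_sum mxE /=; apply: eq_bigr => j _; rewrite mevalZ mevalXU mulrC. Qed.

Lemma lform_homog B : homogeneous (lform B) 1.
Proof. by apply: rpred_sum => j _; apply: rpredZ; rewrite dhomogX; apply/eqP/mdeg1. Qed.

Lemma row_invmx (B : 'M[K]_3) i : B \in unitmx -> row i B *m invmx B = row i 1%:M.
Proof. by move=> uB; rewrite -row_mul mulmxV. Qed.

Lemma lform_row (B : 'M[K]_3) i : B \in unitmx -> (lform B).@[row i B 0] = (i == 2%:R)%:R.
Proof. by move=> uB; rewrite lform_eval row_invmx // !mxE. Qed.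

Lemma lform_neq0 (B : 'M[K]_3) : B \in unitmx -> lform B != 0.
Proof.
move=> uB; have := lform_row 2%:R uB; rewrite eqxx; apply: contra_eqN => /eqP ->.
by rewrite meval0 eq_sym oner_eq0.
Qed.

Definition row3 (a b c : K) : 'rV[K]_3 := \row_j nth 0 [:: a; b; c] j.

Lemma mul_row3 a b c (B : 'M[K]_3) : row3 a b c *m B = a *: row 0 B + b *: row 1 B + c *: row 2%:R B.
Proof.
rewrite mulmx_sum_row !big_ord_recl big_ord0 !mxE /= addr0 addrA.
have -> : lift ord0 ord0 = 1 :> 'I_3 by exact: val_inj.
by have -> : lift ord0 (lift ord0 ord0) = 2%:R :> 'I_3 by exact: val_inj.
Qed.

Lemma row3K v : v = row3 (v 0 0) (v 0 1) (v 0 2%:R).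
Proof.
by apply/rowP => -[[|[|[|j]]] hj] //; rewrite mxE /=; congr (v _ _); apply: val_inj.
Qed.

Lemma row3_eq0 a b c : row3 a b c = 0 -> [/\ a = 0, b = 0 & c = 0].
Proof. by move=> /rowP e; have := (e 0, e 1, e 2%:R); rewrite !mxE => -[[]]. Qed.

(** The lines through [v] form a pencil with parameter [c], and each vector of [L] excludes at most
    one value of [c]. The line found is spanned by rows 0 and 1 of [B] and has equation
    [lform B]. *)
Lemma line_avoiding v (L : seq 'rV[K]_3) : v != 0 ->
  (forall u, u \in L -> u \notin <[v]>%VS) ->
  exists B, [/\ B \in unitmx, row 1 B = v & forall u, u \in L -> (lform B).@[u 0] != 0].
Proof.
move=> v0 hL; have [B' [uB' r0]] := frame_of1 v0.
pose al u := (u *m invmx B') 0 0; pose be u := (u *m invmx B') 0 1; pose ga u := (u *m invmx B') 0 2%:R.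
have uE u : u = al u *: v + be u *: row 1 B' + ga u *: row 2%:R B'.
  by rewrite -r0 -mul_row3 -row3K mulmxKV.
(* The line of parameter [c] is [ga = c * be]. If [be u = 0] the quotient is a harmless 0: such a
   [u] on the line would be a multiple of [v]. *)
have [c cL] := avoid_seq [seq ga u / be u | u <- L].
pose B := \matrix_(i < 3) nth 0 [:: row 1 B' + c *: row 2%:R B'; v; row 2%:R B'] i.
have BE x y z : row3 x y z *m B = row3 y x (z + c * x) *m B'.
  rewrite !mul_row3 !rowK /= r0 scalerDr scalerDl scalerA [c * x]mulrC.
  by rewrite [y *: v + _]addrC [z *: _ + _]addrC [RHS]addrACA [RHS]addrA.
have uB : B \in unitmx.
  rewrite -row_free_unit; apply: inj_row_free => x; rewrite [x]row3K BE.
  move=> /(congr1 (mulmx^~ (invmx B'))); rewrite mulmxK // mul0mx => /row3_eq0 [-> ->].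
  by rewrite mulr0 addr0 => ->; apply/rowP => j; rewrite !mxE; case: j => [[|[|[|]]]].
exists B; split; rewrite ?rowK // => u uL; rewrite lform_eval.
have -> : u = row3 (be u) (al u) (ga u - c * be u) *m B.
  by rewrite BE subrK mul_row3 r0 -uE.
rewrite mulmxK // mxE /= subr_eq0; apply/eqP => gaE.
have [be0|be0] := eqVneq (be u) 0.
  case/negP: (hL u uL); rewrite [u]uE gaE be0 mulr0 !scale0r !addr0 memvZ ?memv_line //.
by case/negP: cL; apply/mapP; exists u; rewrite // gaE mulfK.
Qed.

(** Homogeneity of [g] is not assumed, because reducedness and common components are defined by
    arbitrary factors. Each vector off [L] lies in a plane of vectors where [g] has no zero except
    possibly the origin; on the affine lines of this plane that miss the origin, [g] is a
    one-variable polynomial without root, hence constant. *)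
Lemma nonvanishing_const g (L : seq 'rV[K]_3) : (forall u, u \in L -> u != 0) ->
  (forall v, v != 0 -> g.@[v 0] = 0 -> exists2 u, u \in L & v \in <[u]>%VS) ->
  (msize g <= 1)%N.
Proof.
move=> L0 hg.
have noroot p : (forall c, p.[c] != 0) -> forall c c', p.[c] = p.[c'].
  move=> np c c'; have [/size1_polyC ->|] := leqP (size p) 1; first by rewrite !hornerC.
  move=> sp; have /closed_rootP [x] : size p != 1%N by apply: contraTneq sp => ->.
  by rewrite rootE (negPf (np x)).
have gE v : (forall u, u \in L -> v \notin <[u]>%VS) -> g.@[v 0] = g.@[(0 : 'rV_3) 0].
  move=> vL; have [->//|v0] := eqVneq v 0.
  have [u uL|B [uB r1 BL]] := @line_avoiding v L v0.
    apply/negP => /vlineP [c uE]; case/negP: (vL u uL).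
    have c0 : c != 0 by apply: contraNneq (L0 u uL) => c0; rewrite uE c0 scale0r.
    by apply/vlineP; exists c^-1; rewrite uE scalerK.
  pose w := row 0 B.
  have gn0 x y : (x != 0) || (y != 0) -> g.@[(x *: v + y *: w) 0] != 0.
    move=> xy; apply/negP => /eqP /hg [|u uL /vlineP [c e]].
      apply: contraTneq xy => e.
      have : row3 y x 0 *m B = 0 by rewrite mul_row3 r1 scale0r addr0 addrC.
      move=> /(congr1 (mulmx^~ (invmx B))); rewrite mulmxK // mul0mx => /row3_eq0 [-> -> _].
      by rewrite eqxx.
    have := congr1 (fun z : 'rV_3 => (lform B).@[z 0]) e.
    rewrite -{1}r1 (mevalZv _ _ (lform_homog B)).
    have -> : x *: row 1 B + y *: w = row3 y x 0 *m B by rewrite mul_row3 scale0r addr0 addrC.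
    rewrite lform_eval mulmxK // mxE /= => /esym/eqP; rewrite mulf_eq0 (negPf (BL u uL)) orbF expf_eq0 /=.
    move=> /eqP c0; move: e; rewrite c0 scale0r => e.
    have : row3 y x 0 *m B = 0 by rewrite mul_row3 r1 scale0r addr0 addrC.
    move=> /(congr1 (mulmx^~ (invmx B))); rewrite mulmxK // mul0mx => /row3_eq0 [y0 x0 _].
    by rewrite x0 y0 eqxx in xy.
  (* The vector [v + t *: w] is joined to [v] and to [t *: w], by lines that miss the origin. *)
  have gw t : t != 0 -> g.@[(t *: w) 0] = g.@[v 0].
    move=> t0.
    have := noroot (lineF v (t *: w) g) _ 1 0; rewrite !lineF_horner scale1r scale0r addr0 => <-; last first.
      by move=> c; rewrite lineF_horner scalerA -[X in X + _]scale1r gn0 ?oner_eq0.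
    have := noroot (lineF (t *: w) v g) _ 1 0; rewrite !lineF_horner scale1r scale0r addr0 => <-; last first.
      by move=> c; rewrite lineF_horner addrC gn0 ?t0 ?orbT.
    by rewrite addrC.
  (* The line spanned by [w] contains the origin; the factor ['X] discards that parameter, and the
     resulting polynomial identity then gives the value there as well. *)
  have /eqP : 'X * (lineF 0 w g - (g.@[v 0])%:P) = 0.
    apply: poly_zero_everywhere => c; rewrite hornerM hornerX hornerD hornerN hornerC lineF_horner add0r.
    by have [->|c0] := eqVneq c 0; rewrite ?mul0r // gw // subrr mulr0.
  rewrite mulf_eq0 polyX_eq0 /= subr_eq0 => /eqP /(congr1 (horner^~ 0)).
  by rewrite lineF_horner scale0r addr0 hornerC => ->.
suff -> : g = (g.@[(0 : 'rV_3) 0])%:MP by rewrite msizeC leq_b1.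
apply/eqP; rewrite -subr_eq0; set h := g - _.
(* A product of linear forms, one for each element of [L], kills the vectors that [gE] does not
   reach. *)
have [M ML] : exists M, M != 0 /\ forall v u, u \in L -> v \in <[u]>%VS -> M.@[v 0] = 0.
  elim: L L0 {hg gE} => [|u L ih] L0; first by exists 1; rewrite oner_eq0.
  have [|M [M0 hM]] := ih; first by move=> x xL; apply: L0; rewrite inE xL orbT.
  have [B [uB r0]] := frame_of1 (L0 u (mem_head _ _)).
  exists (lform B * M); rewrite mulf_neq0 ?lform_neq0 //; split=> // v x.
  rewrite inE mevalM => /predU1P [->|xL] vx; last by rewrite (hM v x) ?mulr0.
  have /vlineP [c ->] := vx; rewrite (mevalZv _ _ (lform_homog B)) -r0 lform_row //=.
  by rewrite mulr0 mul0r.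
have : M * h = 0.
  apply: mpoly_zero_everywhere => v; rewrite mevalM.
  have [[u uL vu]|vL] := pselect (exists2 u, u \in L & v \in <[u]>%VS).
    by rewrite (ML.2 v u) ?mul0r.
  rewrite mevalB mevalC gE ?subrr ?mulr0 // => u uL; apply/negP => vu.
  by apply: vL; exists u.
by move/eqP; rewrite mulf_eq0 (negPf ML.1).
Qed.

End Generic.

(** Local intersection numbers will be given by weighted labels, the label [a] sitting at the point
    [f a]; the global number is then the total weight. Labels of weight 0 may sit outside [A]. *)
Lemma fsbig_fibers (T : choiceType) (A : set T) (I : eqType) (L : seq I) (W : I -> nat) (f : I -> T) :
  (forall a, a \in L -> W a != 0%N -> A (f a)) ->
  finite_set [set x | A x /\ (\sum_(a <- L) W a * (f a == x))%N <> 0%N] /\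
  \big[addn/0%N]_(x \in A) (\sum_(a <- L) W a * (f a == x))%N = (\sum_(a <- L) W a)%N.
Proof.
move=> hA.
have [X XE] : exists X : {fset T}, forall x, (x \in X) = (x \in [seq f a | a <- L & W a != 0%N]).
  by exists (seq_fset tt [seq f a | a <- L & W a != 0%N]) => x; rewrite seq_fsetE.
have XP x : A x -> (\sum_(a <- L) W a * (f a == x))%N <> 0%N -> x \in X.
  move=> Ax i0; rewrite XE; apply: contra_notT i0 => xX.
  rewrite big_seq big1 // => a aL; have [fx|] := eqVneq (f a) x; last by rewrite muln0.
  rewrite muln1; apply/eqP/negPn/negP => Wa; case/negP: xX.
  by apply/mapP; exists a; rewrite // mem_filter Wa.
have XA x : x \in X -> A x.
  by rewrite XE => /mapP [a]; rewrite mem_filter => /andP [Wa aL] ->; apply: hA.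
split.
  by apply: (sub_finite_set _ (finite_fset X)) => x /= [Ax]; apply: XP.
rewrite (fsbigE (enum_fset X)) ?fset_uniq //=.
- rewrite big_mkcond /= [LHS]big_seq.
  under eq_bigr => x xX do rewrite (mem_set (XA x xX)).
  rewrite -big_seq exchange_big /= !big_seq; apply: eq_bigr => a aL.
  have [->|Wa] := eqVneq (W a) 0%N; first by rewrite big1.
  have faX : f a \in X by rewrite XE; apply/mapP; exists a; rewrite // mem_filter Wa.
  rewrite (bigD1_seq (f a)) //= eqxx muln1 big1 ?addn0 // => x.
  by rewrite eq_sym => /negPf ->; rewrite muln0.
- by move=> x Ax xX; apply: contraNP xX; apply: XP.
Qed.

(** * Self-intersection of a union of smooth curves *)

Section Lines.
Variable K : numClosedFieldType.
Implicit Types (u v w : 'rV[K]_3) (F G : {mpoly K[3]}) (p q : proj_point K).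
Local Notation lineF := (@lineF K).

Lemma coefM_top (p q : {poly K}) (d e : nat) : (size p <= d.+1)%N -> (size q <= e.+1)%N ->
  (size (p * q)%R <= (d + e).+1)%N /\ (p * q)`_(d + e) = p`_d * q`_e.
Proof.
move=> sp sq; split.
  apply: (leq_trans (size_polyMleq _ _)).
  have := leq_add sp sq; rewrite addnS addSn.
  by case: (size p + size q)%N.
have dle : (d < (d + e).+1)%N by rewrite ltnS leq_addr.
rewrite coefM (bigD1 (Ordinal dle)) //= addKn big1 ?addr0 // => i id.
have [lt|lt|eq] := ltngtP i d.
- have -> : q`_(d + e - i) = 0; last by rewrite mulr0.
  by apply: nth_default; rewrite (leq_trans sq) // ltn_subRL ltn_add2r.
- by rewrite (nth_default _ (leq_trans sp lt)) mul0r.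
- by case/eqP: id; apply: val_inj.
Qed.

Lemma lineF_top u w F d : homogeneous F d ->
  (size (lineF u w F) <= d.+1)%N /\ (lineF u w F)`_d = F.@[w 0].
Proof.
have mon m : (size (lineF u w 'X_[m]) <= (mdeg m).+1)%N /\ (lineF u w 'X_[m])`_(mdeg m) = 'X_[m].@[w 0].
  rewrite mpolyXE_id rmorph_prod rmorph_prod mdegE /=.
  elim: (index_enum _) => [|i r ih]; first by rewrite !big_nil size_poly1 coefC.
  rewrite !big_cons; suff [s1 c1] : (size (lineF u w ('X_i ^+ m i)) <= (m i).+1)%N /\
     (lineF u w ('X_i ^+ m i))`_(m i) = ('X_i ^+ m i).@[w 0].
    by have [s2 c2] := coefM_top s1 ih.1; rewrite s2 c2 c1 ih.2.
  elim: (m i) => [|k [s1 c1]]; first by rewrite !expr0 !rmorph1 size_poly1 coefC.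
  have sX : (size (lineF u w 'X_i) <= 2)%N.
    rewrite lineFX (leq_trans (size_polyD _ _)) // geq_max (leq_trans (size_polyC_leq1 _)) //=.
    by rewrite (leq_trans (size_polyMleq _ _)) // size_polyX /= ltnS size_polyC_leq1.
  rewrite exprS [lineF _ _ _]rmorphM [meval _ _]rmorphM /=.
  have [s2 c2] := coefM_top sX s1; rewrite add1n in s2 c2; rewrite s2 c2 c1.
  by rewrite lineFX coefD coefC coefXM coefC mevalXU /= add0r.
move=> /dhomogP hF; rewrite [F]mpolyE !rmorph_sum /= !big_seq.
suff h : forall r : seq 'X_{1..3}, {in r, forall m, mdeg m = d} ->
   (size (\sum_(m <- r) lineF u w (F@_m *: 'X_[m]))%R <= d.+1)%N /\
   (\sum_(m <- r) lineF u w (F@_m *: 'X_[m]))`_d = \sum_(m <- r) (F@_m *: 'X_[m]).@[w 0].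
  by have := h (msupp F) hF; rewrite !big_seq.
elim=> [|m r ih] hr; first by rewrite !big_nil size_poly0 coef0.
have [|s1 c1] := ih; first by move=> x xr; apply: hr; rewrite inE xr orbT.
have md : mdeg m = d by apply: hr; rewrite mem_head.
rewrite !big_cons coefD c1 -mul_mpolyC [lineF _ _ (_ * _)]rmorphM /= lineFC mul_polyC.
have [s2 c2] := mon m; rewrite md in s2 c2; split.
  by rewrite (leq_trans (size_polyD _ _)) // geq_max s1 andbT (leq_trans (size_scale_leq _ _)).
by rewrite coefZ c2 [meval _ _ in RHS]rmorphM /= mevalC.
Qed.

Lemma lineF_roots u w F d : homogeneous F d -> F.@[w 0] != 0 ->
  exists rs : seq K, size rs = d /\ lineF u w F = F.@[w 0] *: \prod_(z <- rs) ('X - z%:P).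
Proof.
move=> hF Fw; have [sz lc] := lineF_top u w hF.
have szE : size (lineF u w F) = d.+1.
  apply/eqP; rewrite eqn_leq sz /= ltnNge; apply: contra Fw => le.
  by rewrite -lc nth_default.
have [rs rsE] := closed_field_poly_normal (lineF u w F).
have lcE : lead_coef (lineF u w F) = F.@[w 0] by rewrite lead_coefE szE.
exists rs; split; last by rewrite {1}rsE lcE.
by move: szE; rewrite rsE lcE size_scale // size_prod_XsubC => -[].
Qed.

Lemma comp_roots (c r : K) (rs : seq K) : c != 0 ->
  exists2 g, (c *: \prod_(z <- rs) ('X - z%:P)) \Po ('X + r%:P) = 'X^(count_mem r rs) * g & g.[0] != 0.
Proof.
move=> c0; elim: rs => [|z rs [g gE g0]].
  exists c%:P; rewrite ?hornerC // big_nil comp_polyZ -polyC1 comp_polyC.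
  by rewrite /= expr0 mul1r -mul_polyC mulr1.
rewrite big_cons scalerAr comp_polyM gE comp_polyB comp_polyX comp_polyC /=.
have [->|zr] := eqVneq z r.
  by exists g; rewrite // addrK add1n exprS mulrA.
exists (('X + r%:P - z%:P) * g); first by rewrite mulrCA.
by rewrite hornerM mulf_neq0 // !hornerE subr_eq0 eq_sym.
Qed.

Lemma pullback_lineF (q : proj_point K) (B : 'M[K]_3) F :
  axis ord_max (pullback (q, None) B F) = lineF (row 0 B) (row 1 B) F.
Proof.
elim/mpoly_ring_ind: F => [c|j|F G ep eq|F G ep eq].
- by rewrite /pullback comp_mpolyC axisC lineFC.
- rewrite /pullback comp_mpolyXU -tnth_nth tnth_mktuple lineFX !mxE.
  rewrite !big_ord_recl big_ord0 /chart_weight /= addr0.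
  rewrite !axisD -!mul_mpolyC !axisM !axisC rmorph1 mulr1 axisXi mulr0 addr0.
  by rewrite axisXj // mulrC; congr (_ + _ * (B _ _)%:P); apply: val_inj.
- by rewrite [lineF _ _ _]rmorphD /= -ep -eq -axisD; congr axis; apply: rmorphD.
- by rewrite [lineF _ _ _]rmorphM /= -ep -eq -axisM -pullback_rmorphM.
Qed.

Lemma pullback_eval0 x (B : 'M[K]_3) F : (pullback x B F).@[fun=> 0] = F.@[row 0 B 0].
Proof.
rewrite comp_mpoly_meval; apply: meval_eq => j; rewrite tnth_mktuple mxE.
rewrite !big_ord_recl big_ord0 /chart_weight /= !mevalD !mevalZ meval1 mulr1 meval0.
rewrite /coord_s /coord_t mevalXU mulr0 add0r.
by case: x.2 => [?|]; rewrite ?mevalM !mevalXU !mulr0 !addr0.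
Qed.

Lemma pullback_lform x (B B' : 'M[K]_3) :
  pullback x B (lform B') = \sum_(i < 3) (lform B').@[row i B 0] *: chart_weight x i.
Proof.
rewrite /pullback [lform B' in LHS]/lform linear_sum /=.
under [in RHS]eq_bigr => i _ do rewrite lform_eval mxE scaler_suml.
rewrite exchange_big /=; apply: eq_bigr => j _; rewrite linearZ /= comp_mpolyXU.
rewrite -tnth_nth tnth_mktuple scaler_sumr; apply: eq_bigr => i _.
by rewrite scalerA mxE mulrC.
Qed.

Lemma smooth_curve_at G (p : proj_point K) : smooth_curve G -> smooth_at (pt_vec p) G.
Proof.
move=> [_ S0] Gp; apply: contrapT => /forallNP h.
have : Sing G p; last by rewrite S0.
split=> // i; have /negP/negPn/eqP := h (delta_mx 0 i).
rewrite /dform (bigD1 i) //= big1 ?addr0 => [|j ji]; last by rewrite mxE eqxx (negPf ji) mulr0.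
by rewrite mxE !eqxx mulr1.
Qed.

Lemma unitmx_shift (B : 'M[K]_3) r : B \in unitmx ->
  exists B', [/\ B' \in unitmx, row 0 B' = row 0 B + r *: row 1 B, row 1 B' = row 1 B
    & row 2%:R B' = row 2%:R B].
Proof.
move=> uB; pose B' := \matrix_(i < 3) nth 0 [:: row 0 B + r *: row 1 B; row 1 B; row 2%:R B] i.
have BE x y z : row3 x y z *m B' = row3 x (y + x * r) z *m B.
  by rewrite !mul_row3 !rowK /= scalerDr scalerDl scalerA -!addrA; congr (_ + _); rewrite addrCA.
exists B'; rewrite !rowK; split=> //.
rewrite -row_free_unit; apply: inj_row_free => x; rewrite [x]row3K BE.
move=> /(congr1 (mulmx^~ (invmx B))); rewrite mulmxK // mul0mx => /row3_eq0 [-> + ->].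
by rewrite mul0r addr0 => ->; apply/rowP => j; rewrite !mxE; case: j => [[|[|[|]]]].
Qed.

Lemma split_exceptional_axis (f f0 : {mpoly K[2]}) m :
  f = coord_s K ^+ m * f0 -> axis ord0 f0 != 0 -> split_exceptional f m f0.
Proof.
move=> fE f00; split=> // -[h hE]; case/eqP: f00.
by rewrite hE axisM axisXi mul0r.
Qed.

Lemma Xn_mul_neq0 (k : nat) (g : {poly K}) : g.[0] != 0 -> 'X^k * g != 0.
Proof.
move=> g0; rewrite mulf_eq0 expf_eq0 polyX_eq0 andbF /=.
by apply: contraNneq g0 => ->; rewrite horner0.
Qed.

Lemma exists_line_through p : exists l, on_line p l.
Proof.
have [u1 u1p] : exists u1, u1 \notin val p by apply: exists_notin; rewrite (eqP (valP p)).
have dl : \dim (val p + <[u1]>) == 2%N.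
  have /directvP -> : directv (val p + <[u1]>).
    apply/directv_addP; apply/eqP; rewrite -subv0; apply/subvP => w.
    rewrite memv_cap memv0 => /andP [wp /vlineP [c wE]]; move: wp; rewrite wE.
    have [->|c0] := eqVneq c 0; first by rewrite scale0r.
    by move=> /(memvZ c^-1); rewrite scalerK // (negPf u1p).
  rewrite /= (eqP (valP p)) dim_vline (_ : u1 != 0) //.
  by apply: contraNneq u1p => ->; rewrite mem0v.
by exists (exist (fun U : {vspace 'rV[K]_3} => \dim U == 2%N) _ dl); rewrite /on_line /= addvSl.
Qed.

Section SelfIntersection.
Variables (cs : seq {mpoly K[3]}) (d : nat).
Let F := \prod_(G <- cs) G.
Hypotheses (csS : forall G, G \in cs -> smooth_curve G) (hF : homogeneous F d).

Lemma csP G (p : proj_point K) : G \in cs -> smooth_at (pt_vec p) G /\ exists e, homogeneous G e.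
Proof.
move=> Gcs; split; first exact/smooth_curve_at/csS.
by have [[_ [e _ he]] _] := csS Gcs; exists e.
Qed.

(** Since the members are smooth, this is the multiplicity at [p] of their union, and the order of
    the total transform along [E_p]. *)
Definition curve_mult (p : proj_point K) := count (fun G => vanb G p) cs.

(** The exponent of ['X] is the local intersection number of the strict transform with [E_p] at
    [(p, l)]: every member through [p] meets [E_p] once, in its tangent direction. *)
Lemma exceptional_split (p : proj_point K) l : on_line p l -> exists B f0 g,
  [/\ adapted_frame (p, Some l) B, row 0 B = pt_vec p,
      split_exceptional (pullback (p, Some l) B F) (curve_mult p) f0,
      axis ord0 f0 = 'X^(count (fun G => vanb G p && (tspace G p == val l)) cs) * g & g.[0] != 0].
Proof.
move=> pl; have [B [aB r0]] := @frame_at _ (p, Some l) pl; have [uB _ _] := aB.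
have [|f0 [g [fE axE g0]]] := @pullback_exc_prod _ p l B cs uB.
  by move=> G Gcs; rewrite r0; apply: csP.
rewrite r0 in fE axE; exists B, f0, g; split=> //.
  by apply: split_exceptional_axis => //; rewrite axE Xn_mul_neq0.
rewrite axE; congr ('X^_ * _); apply: eq_in_count => G Gcs.
have [Gp|] := boolP (vanb G p); last by move=> /negPf Gp; rewrite -[_ == 0]/(vanb G p) Gp.
have [smG [e hG]] := csP p Gcs.
by rewrite -[X in X && _]/(vanb G p) Gp (tangent_frame hG smG (eqP Gp) aB r0 pl).
Qed.

(** The line meets the curve at the points [pt r], for the roots [r] of the restriction of [F]; each
    root weighs [d] because the divisor is [d] times the line. *)
Lemma local_line (rs : seq K) (B : 'M[K]_3) (pt : K -> proj_point K) x : B \in unitmx ->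
  F.@[row 1 B 0] != 0 ->
  lineF (row 0 B) (row 1 B) F = F.@[row 1 B 0] *: \prod_(z <- rs) ('X - z%:P) ->
  (forall r, row 0 B + r *: row 1 B \in val (pt r)) ->
  (if x.2 is Some l then on_line x.1 l /\ (lform B).@[pt_vec x.1 0] != 0 else true) ->
  local_intersection x (strict_transform F) (strict_transform (lform B ^+ d))
    (\sum_(r <- rs) d * ((pt r, None) == x))%N.
Proof.
move=> uB F1 rsE ptE; case: x => p [l|] /=.
  (* On an exceptional curve both sides are 0: the line avoids the blown-up point, so its equation
     is a unit there. *)
  move=> [pl lp]; rewrite big1 => [|r _]; last by apply/eqP; rewrite muln_eq0 eqb0; apply/orP; right; apply/eqP => -[].
  have [B' [f0 [g [aB r0 sF _ _]]]] := exceptional_split pl.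
  have lp0 : (pullback (p, Some l) B' (lform B ^+ d)).@[fun=> 0] != 0.
    by rewrite pullback_eval0 r0 rmorphXn expf_neq0.
  exists B', f0, (pullback (p, Some l) B' (lform B ^+ d)); split=> //.
  - by exists (curve_mult p), f0; rewrite expr0 mul1r.
  - exists 0%N, (pullback (p, Some l) B' (lform B ^+ d)); rewrite expr0 mul1r; split=> //.
    apply: split_exceptional_axis; first by rewrite expr0 mul1r.
    by apply: contraNneq lp0 => e; rewrite -(axis_horner0 ord0) e horner0.
  - exact: local_dim0r.
move=> _.
have nz r : row 0 B + r *: row 1 B != 0.
  apply/eqP => e; have : row3 1 r 0 *m B = 0 by rewrite mul_row3 scale1r scale0r addr0.
  move=> /(congr1 (mulmx^~ (invmx B))); rewrite mulmxK // mul0mx => /row3_eq0 [/eqP].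
  by rewrite oner_eq0.
have [B0 [aB0 r00]] := @frame_at _ (p, None) isT.
have lB r : (lform B).@[(row 0 B + r *: row 1 B) 0] = 0.
  have -> : row 0 B + r *: row 1 B = row3 1 r 0 *m B by rewrite mul_row3 scale1r scale0r addr0.
  by rewrite lform_eval mulmxK // mxE.
have [lp|lp] := boolP (vanb (lform B) p); last first.
  rewrite big1 => [|r _]; last first.
    have [[e]|] := eqVneq; last by rewrite muln0.
    by case/negP: lp; rewrite (vanb_at (lform_homog B) (nz r)) ?lB // -e.
  exists B0, (pullback (p, None) B0 F), (pullback (p, None) B0 (lform B ^+ d)); split=> //.
  by apply: local_dim0r; rewrite pullback_eval0 r00 rmorphXn expf_neq0.
have [Fp|Fp] := boolP (vanb F p); last first.
  rewrite big_seq big1 => [|r rrs]; last first.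
    have [[e]|] := eqVneq; last by rewrite muln0.
    case/negP: Fp; rewrite (vanb_at hF (nz r)) -?e ?ptE // -lineF_horner rsE.
    by rewrite hornerZ mulf_eq0; apply/orP; right; rewrite -rootE root_prod_XsubC.
  exists B0, (pullback (p, None) B0 F), (pullback (p, None) B0 (lform B ^+ d)); split=> //.
  by apply: local_dim0l; rewrite pullback_eval0 r00.
(* The parametrisation reaches every common point, as its point at infinity [row 1 B] is not on the
   curve. *)
have [r0 r0p] : exists r0, row 0 B + r0 *: row 1 B \in val p.
  have pE : pt_vec p = row3 ((pt_vec p *m invmx B) 0 0) ((pt_vec p *m invmx B) 0 1) 0 *m B.
    rewrite -{1}[pt_vec p](mulmxKV uB) {1}[pt_vec p *m _]row3K; congr (row3 _ _ _ *m _).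
    by rewrite -lform_eval; apply/eqP.
  move: pE; rewrite mul_row3 scale0r addr0; set a := (_ *m _) 0 0; set b := (_ *m _) 0 1 => pE.
  have a0 : a != 0.
    apply: contraNneq F1 => a0; move: Fp; rewrite /vanb pE a0 scale0r add0r (mevalZv _ _ hF).
    rewrite mulf_eq0 expf_eq0 => /orP [/andP [_ /eqP b0]|//].
    by case/eqP: (pt_vec_neq0 p); rewrite pE a0 b0 !scale0r addr0.
  exists (b / a); apply/in_pointP; exists a^-1; rewrite pE scalerDr !scalerA mulVf // scale1r.
  by rewrite mulrC.
have ptr r : ((pt r, None) == (p, None) :> proj_point K * option (proj_line K)) = (r0 == r).
  apply/eqP/eqP => [[e]|<-]; last by rewrite (point_eq (nz r0) (ptE r0) r0p).
  have := ptE r; rewrite e (val_line (nz r0) r0p) => /vlineP [c].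
  have rE r' : row 0 B + r' *: row 1 B = row3 1 r' 0 *m B.
    by rewrite mul_row3 scale1r scale0r addr0.
  rewrite !rE scalemxAl => /(congr1 (mulmx^~ (invmx B))); rewrite !mulmxK // => /rowP ee.
  have := ee 0; rewrite !mxE /= mulr1 => c1.
  by have := ee 1; rewrite !mxE /= -c1 mul1r => ->.
under eq_bigr => r _ do rewrite ptr.
rewrite -big_distrr /= (_ : (\sum_(r <- rs) (r0 == r))%N = count_mem r0 rs); last first.
  by elim: (rs) => [|r rs' ih]; rewrite ?big_nil // big_cons ih /= eq_sym.
(* The frame slides along the line until the point is the origin. The line becomes [t = 0], where
   [F] vanishes to the order of [r0] among the roots. *)
have [B' [uB' r0' r1' r2']] := unitmx_shift r0 uB.
have [g gE g0] := comp_roots r0 rs F1.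
exists B', (pullback (p, None) B' F), (coord_t K ^+ d); split=> //.
- by split=> //=; rewrite r0'.
- rewrite /local_equation /= [pullback _ _ _]rmorphXn; congr (_ ^+ _).
  rewrite /= -[RHS]/(pullback (p, None) B' (lform B)) pullback_lform !big_ord_recl big_ord0 /chart_weight /=.
  have -> : lift ord0 ord0 = 1 :> 'I_3 by exact: val_inj.
  have -> : lift ord0 (lift ord0 ord0) = 2%:R :> 'I_3 by exact: val_inj.
  by rewrite r0' r1' r2' lB !lform_row //= !scale0r !add0r addr0 scale1r.
- apply: (@quotient_dim_axis _ ord_max _ _ g) => //.
  by rewrite pullback_lineF r0' r1' lineF_shift rsE gE.
Qed.

Lemma homog_pos : cs != [::] -> (0 < d)%N /\ F != 0.
Proof.
case: cs csS @F hF => // G s hS F' hF' _.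
have prod_homog (t : seq {mpoly K[3]}) : (forall H, H \in t -> plane_curve H) ->
    \prod_(H <- t) H != 0 /\ exists e, homogeneous (\prod_(H <- t) H) e.
  elim: t => [|H t ih] ht; first by rewrite big_nil oner_eq0; split=> //; exists 0%N; apply: dhomog1.
  have [|t0 [e te]] := ih; first by move=> H' H't; apply: ht; rewrite inE H't orbT.
  have [H0 [e' _ He]] := ht H (mem_head _ _); rewrite big_cons mulf_neq0 //; split=> //.
  by exists (e' + e)%N; apply: dhomogM.
have [[G0 [e e0 he]] _] := hS G (mem_head _ _).
have [|s0 [e' he']] := prod_homog s; first by move=> H Hs; have [] := hS H; rewrite // inE Hs orbT.
have F'0 : F' != 0 by rewrite /F' big_cons mulf_neq0.
split=> //; have -> : d = (e + e')%N.
  by apply: (dhomog_uniq F'0 hF'); rewrite /F' big_cons; apply: dhomogM.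
by rewrite addn_gt0 e0.
Qed.

(** The strict transform plus the sum of the [curve_mult p] times [E_p] is the total transform,
    linearly equivalent to [d] times a line avoiding [P]. The line contributes [d ^ 2]. As the
    strict transform meets [E_p] in [curve_mult p] points, counted with multiplicity, the
    exceptional part contributes the squares. *)
Theorem self_intersection_smooth_union (P : set (proj_point K)) : cs != [::] -> finite_set P ->
  (forall p, P p -> vanishes F p) ->
  self_intersection P (strict_transform F)
    ((d ^ 2)%N%:Z - (\sum_(p <- fset_set P) curve_mult p ^ 2)%N%:Z).
Proof.
move=> cs0 finP PF; have [d0 F0] := homog_pos cs0.
have PE p : (p \in fset_set P) = (p \in P) by rewrite in_fset_set.
(* The line is drawn through a vector [v] off the curve: the points of [P] are on the curve, so [v]
   represents none of them and the line can avoid them all. *)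
have [v Fv] : exists v, F.@[v 0] != 0.
  by apply: contrapT => /forallNP h; case/eqP: F0; apply: mpoly_zero_everywhere => v;
    apply/eqP/negPn/negP/h.
have v0 : v != 0.
  apply: contraNneq Fv => ->; rewrite -(scale0r (0 : 'rV[K]_3)) (mevalZv _ _ hF).
  by rewrite expr0n eqn0Ngt d0 mul0r.
have [u|B [uB r1 BL]] := @line_avoiding _ v [seq pt_vec p | p <- fset_set P] v0.
  move=> /mapP [p]; rewrite PE => /set_mem Pp ->; apply/negP => /vlineP [c pE].
  have /eqP := PF p Pp; rewrite -[_ == 0]/(F.@[pt_vec p 0] == 0) pE (mevalZv _ _ hF) mulf_eq0 (negPf Fv) orbF expf_eq0.
  by move=> /andP [_ /eqP c0]; case/eqP: (pt_vec_neq0 p); rewrite pE c0 scale0r.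
have lP p : P p -> (lform B).@[pt_vec p 0] != 0.
  by move=> Pp; apply: BL; apply: map_f; rewrite PE; apply: mem_set.
have F1 : F.@[row 1 B 0] != 0 by rewrite r1.
have [rs [szrs rsE]] := lineF_roots (row 0 B) hF F1.
have nz r : row 0 B + r *: row 1 B != 0.
  apply/eqP => e; have : row3 1 r 0 *m B = 0 by rewrite mul_row3 scale1r scale0r addr0.
  move=> /(congr1 (mulmx^~ (invmx B))); rewrite mulmxK // mul0mx => /row3_eq0 [/eqP].
  by rewrite oner_eq0.
have lB r : (lform B).@[(row 0 B + r *: row 1 B) 0] = 0.
  have -> : row 0 B + r *: row 1 B = row3 1 r 0 *m B by rewrite mul_row3 scale1r scale0r addr0.
  by rewrite lform_eval mulmxK // mxE.
pose pt r := point_of (nz r).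
have ptE r : row 0 B + r *: row 1 B \in val (pt r) by rewrite /= memv_line.
pose D1 := strict_transform (lform B ^+ d).
pose D2 := Divisor (1 : {mpoly K[3]}) curve_mult.
have lhom : homogeneous (lform B ^+ d) d by have := dhomogMn d (lform_homog B); rewrite mul1n.
exists D1, D2, (d ^ 2)%N, (\sum_(p <- fset_set P) curve_mult p ^ 2)%N; split=> //.
- split; split=> /=.
  + by rewrite expf_neq0 // lform_neq0.
  + by exists d.
  + exact: oner_neq0.
  + by exists 0%N; apply: dhomog1.
- split; split=> /=; try by left.
  (* A common factor vanishes only at the common points of the line and the curve, which are finite
     in number. *)
  + move=> g h h' FE lE.
    apply: (@nonvanishing_const _ g [seq row 0 B + r *: row 1 B | r <- rs]).
      by move=> u /mapP [r _ ->].
    move=> w w0 gw.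
    have Fw : F.@[w 0] = 0 by rewrite FE mevalM gw mul0r.
    have : (lform B ^+ d).@[w 0] = 0 by rewrite lE mevalM gw mul0r.
    rewrite rmorphXn => /eqP; rewrite expf_eq0 => /andP [_ /eqP lw].
    have wE : w = row3 ((w *m invmx B) 0 0) ((w *m invmx B) 0 1) 0 *m B.
      rewrite -{1}[w](mulmxKV uB) {1}[w *m _]row3K; congr (row3 _ _ _ *m _).
      by rewrite -lform_eval.
    move: wE; rewrite mul_row3 scale0r addr0; set a := (_ *m _) 0 0; set b := (_ *m _) 0 1 => wE.
    have a0 : a != 0.
      apply: contraNneq F1 => a0; move/eqP: Fw; rewrite wE a0 scale0r add0r (mevalZv _ _ hF).
      rewrite mulf_eq0 expf_eq0 => /orP [/andP [_ /eqP b0]|//].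
      by case/eqP: w0; rewrite wE a0 b0 !scale0r addr0.
    have wE' : w = a *: (row 0 B + (b / a) *: row 1 B) by rewrite scalerDr scalerA mulrCA divff // mulr1.
    exists (row 0 B + (b / a) *: row 1 B); last by rewrite wE' memvZ // memv_line.
    apply: map_f; rewrite -root_prod_XsubC.
    move/eqP: Fw; rewrite wE' (mevalZv _ _ hF) mulf_eq0 expf_eq0 (negPf a0) andbF /=.
    by rewrite -lineF_horner rsE hornerZ mulf_eq0 (negPf F1).
  + move=> g h h' _ gE; apply: (@nonvanishing_const _ g [::]) => // w _ gw.
    have : (1 : {mpoly K[3]}).@[w 0] = 0 by rewrite gE mevalM gw mul0r.
    by move/eqP; rewrite meval1 oner_eq0.
(* The rational function is [F / lform B ^+ d]; its order along [E_p] is [curve_mult p], since the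
   line does not contain [p]. *)
- exists d, F, (lform B ^+ d); split=> //; first by rewrite expf_neq0 // lform_neq0.
  split; first by rewrite /= mulr1 mulrC.
  move=> p Pp.
  have [l pl] := exists_line_through p.
  have [B' [f0 [g [aB r0 sF _ _]]]] := exceptional_split pl.
  exists (curve_mult p), 0%N; split.
  + by exists (p, Some l), B', f0; split.
  + exists (p, Some l), B', (pullback (p, Some l) B' (lform B ^+ d)); split=> //.
    apply: split_exceptional_axis; first by rewrite expr0 mul1r.
    apply: contraNneq (lP p Pp) => e.
    have : (pullback (p, Some l) B' (lform B ^+ d)).@[fun=> 0] = 0 by rewrite -(axis_horner0 ord0) e horner0.
    by rewrite pullback_eval0 r0 rmorphXn => /eqP; rewrite expf_eq0 => /andP [].
  + by rewrite /= add0n addn0.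
- split.
  + have [|fin sumE] := @fsbig_fibers (proj_point K * option (proj_line K))%type (blowup P) _ rs (fun=> d) (fun r => (pt r, None)).
      move=> r _ _ /= Pr; have := lP _ Pr.
      have : vanb (lform B) (pt r) by rewrite (vanb_at (lform_homog B) (nz r)) ?lB.
      by rewrite /vanb => ->.
    exists (fun x => (\sum_(r <- rs) d * ((pt r, None) == x))%N); split=> //.
      by move=> x xP; apply: local_line => //; case: x xP => p [l|] //= [Pp pl]; split=> //; apply: lP.
    by rewrite sumE big_const_seq count_predT szrs iter_addn_0 mulnn.
  (* A label is a point [p] with a member [G], located at the tangent direction of [G] at [p]. The
     default line [l0] is harmless, as pairs with [G] not through [p] have weight 0. *)
  + have [l0 _] := exists_line_through (pt 0).
    pose tl p G : proj_line K := insubd l0 (tspace G p).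
    have tlE p G : G \in cs -> vanb G p -> val (tl p G) = tspace G p.
      by move=> Gcs Gp; apply: insubdK; apply: dim_tspace; [exact: (csP p Gcs).1|exact/eqP].
    pose L := [seq (p, G) | p <- enum_fset (fset_set P), G <- cs].
    pose W (a : proj_point K * {mpoly K[3]}) := if vanb a.2 a.1 then curve_mult a.1 else 0%N.
    pose f (a : proj_point K * {mpoly K[3]}) := (a.1, Some (tl a.1 a.2)).
    have [|fin sumE] := @fsbig_fibers (proj_point K * option (proj_line K))%type (blowup P) _ L W f.
      move=> _ /allpairsP [[p G] /= [+ Gcs ->]]; rewrite PE /W /= => /set_mem Pp.
      case: ifP => // Gp _; split=> //=; have [smG [e hG]] := csP p Gcs.
      rewrite /on_line (tlE _ _ Gcs Gp) val_pt_vec -memvE tspaceP (dform_euler hG) //.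
      exact/eqP.
    exists (fun x => (\sum_(a <- L) W a * (f a == x))%N); split=> //; last first.
      rewrite sumE big_allpairs_dep /=; apply: eq_bigr => p _; rewrite /W /= -big_mkcond /=.
      by rewrite big_const_seq iter_addn_0 mulnn.
    case=> p [l|] /= xP; last first.
      have [B0 [aB0 r00]] := @frame_at _ (p, None) isT.
      rewrite big1 => [|a _]; last by apply/eqP; rewrite muln_eq0 eqb0; apply/orP; right; apply/eqP => -[].
      exists B0, (pullback (p, None) B0 F), (pullback (p, None) B0 1); split=> //.
      by apply: local_dim0r; rewrite pullback_eval0 meval1 oner_neq0.
    have [Pp pl] := xP; have [B' [f0 [g [aB r0 sF axE g0]]]] := exceptional_split pl.
    exists B', f0, (coord_s K ^+ curve_mult p); split=> //.
    * by exists (curve_mult p), f0; rewrite expr0 mul1r.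
    * exists 0%N, 1; rewrite mulr1; split=> //; apply: split_exceptional_axis.
        by rewrite expr0 mul1r pullback1.
      by rewrite rmorph1 oner_neq0.
    rewrite (_ : (\sum_(a <- L) _)%N =
       (curve_mult p * count (fun G => vanb G p && (tspace G p == val l)) cs)%N).
      exact: (@quotient_dim_axis _ ord0 _ _ g).
    have pP : p \in fset_set P by rewrite PE; apply: mem_set.
    rewrite big_allpairs_dep /= (bigD1_seq p pP (fset_uniq _)) /=.
    rewrite [X in (_ + X)%N]big1 ?addn0 => [|q qp]; last first.
      rewrite big1 // => G _; apply/eqP; rewrite muln_eq0 eqb0; apply/orP; right.
      by apply: contraNneq qp => -[->].
    rewrite -sum1_count big_distrr /= [RHS]big_mkcond /= !big_seq; apply: eq_bigr => G Gcs.
    rewrite /W /f /=; have [Gp|] := boolP (vanb G p); last by rewrite mul0n.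
    rewrite -(tlE _ _ Gcs Gp) /= muln1.
    have -> : ((p, Some (tl p G)) == (p, Some l)) = (val (tl p G) == val l).
      by apply/eqP/eqP => [[->]|/val_inj ->].
    by case: eqP; rewrite ?muln1 ?muln0.
Qed.

End SelfIntersection.
End Lines.

Lemma mderiv_homog (R : comNzRingType) (n d : nat) (F : {mpoly R[n]}) i :
  F \is d.-homog for mdeg -> F^`M(i) \is d.-1.-homog for mdeg.
Proof.
move=> /dhomogP hF; apply/dhomogP => m; rewrite mcoeff_msupp mcoeff_deriv => h.
have : (m + U_(i))%MM \in msupp F.
  by rewrite mcoeff_msupp; apply: contraNneq h => ->; rewrite mul0rn.
by move=> /hF e; have {e} <- : mdeg (m + U_(i))%MM = d := e; rewrite mdegD mdeg1 addn1.
Qed.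

(** The ideal in [hilbert_function] allows arbitrary multipliers [h]; comparing the parts of degree
    [d + e] shows that the part of degree [d] of [h] suffices. *)
Lemma homog_quotient (R : idomainType) (n d e : nat) (F G h : {mpoly R[n]}) :
  F \is (d + e).-homog for mdeg -> G \is e.-homog for mdeg -> F = h * G ->
  exists2 h', h' \is d.-homog for mdeg & F = h' * G.
Proof.
move=> hF hG FE; exists (pihomog mdeg d h); first exact: pihomogP.
rewrite -[LHS](pihomog_dE hF) FE {1}(pihomog_partitionE (leqnn (mmeasure mdeg h))).
pose k := (mmeasure mdeg h + d.+1)%N.
have hk : (mmeasure mdeg h <= k)%N by rewrite leq_addr.
have dk : (d < k)%N by rewrite /k addnS ltnS leq_addl.
rewrite -(pihomog_partitionE (leqnn _)) {1}(pihomog_partitionE hk) mulr_suml linear_sum /=.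
rewrite (bigD1 (Ordinal dk)) //= big1 ?addr0 => [|i id].
  by rewrite pihomog_dE //; apply: dhomogM => //; apply: pihomogP.
apply: (@pihomog_ne0 _ _ _ (i + e)%N).
  by rewrite eqn_add2r; apply: contraNneq id => e'; apply/eqP/val_inj.
by apply: dhomogM => //; apply: pihomogP.
Qed.

(** * Singular points, reducedness, genus *)

Section Configurations.
Variable K : numClosedFieldType.
Implicit Types (F G : {mpoly K[3]}) (p q : proj_point K).

Lemma vanb_prod (cs : seq {mpoly K[3]}) p :
  vanb (\prod_(G <- cs) G) p = (0 < count (fun G => vanb G p) cs)%N.
Proof.
rewrite /vanb; elim: cs => [|G cs ih]; first by rewrite big_nil meval1 oner_eq0.
by rewrite big_cons mevalM mulf_eq0 ih /= addn_gt0 lt0b.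
Qed.

(** By the product rule the gradient is zero once two factors vanish at [p], and a nonzero multiple
    of that of [G] if [G] alone vanishes. *)
Lemma Sing_prod (cs : seq {mpoly K[3]}) p : (forall G, G \in cs -> smooth_curve G) ->
  Sing (\prod_(G <- cs) G) p <-> (1 < count (fun G => vanb G p) cs)%N.
Proof.
move=> csS; set F := \prod_(G <- cs) G.
suff [h1 h2] : ((count (fun G => vanb G p) cs = 1)%N -> exists i, F^`M(i).@[pt_vec p 0] != 0) /\
    ((1 < count (fun G => vanb G p) cs)%N -> forall i, F^`M(i).@[pt_vec p 0] = 0).
  split=> [[/vanbP Fp dF]|c2].
    move: Fp; rewrite vanb_prod leq_eqVlt => /predU1P [/esym /h1 [i /eqP]|//].
    by case; apply: dF.
  by split; [apply/vanbP; rewrite vanb_prod; apply: leq_trans c2 | move=> i; apply: h2].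
rewrite /F {F}; elim: cs csS => [|G cs ih] csS //=.
have [|ih1 ih2] := ih; first by move=> H Hcs; apply: csS; rewrite inE Hcs orbT.
have dE i : ((\prod_(H <- G :: cs) H)^`M(i)).@[pt_vec p 0] =
    G^`M(i).@[pt_vec p 0] * (\prod_(H <- cs) H).@[pt_vec p 0]
    + G.@[pt_vec p 0] * (\prod_(H <- cs) H)^`M(i).@[pt_vec p 0].
  by rewrite big_cons mderivM mevalD !mevalM.
have vE := vanb_prod cs p; rewrite /vanb in vE.
have [Gp|Gp] := boolP (vanb G p).
  rewrite add1n; split=> [[c0]|].
    have [v] := smooth_curve_at (csS G (mem_head _ _)) (eqP Gp).
    move=> dv; have [i di] : exists i, G^`M(i).@[pt_vec p 0] != 0.
      apply: contrapT => /forallNP h; case/eqP: dv; rewrite /dform big1 // => j _.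
      by have /negP/negPn/eqP -> := h j; rewrite mul0r.
    by exists i; rewrite dE (eqP Gp) mul0r addr0 mulf_neq0 // vE c0.
  rewrite ltnS => c0 i; rewrite dE (eqP Gp) mul0r addr0.
  by move: vE; rewrite c0 => /eqP ->; rewrite mulr0.
rewrite add0n; split=> [c1|c2 i].
  have [i di] := ih1 c1; exists i; rewrite dE.
  by move: vE; rewrite c1 => /eqP ->; rewrite mulr0 add0r mulf_neq0.
by rewrite dE ih2 // mulr0 addr0; move: vE; rewrite (ltnW c2) => /eqP ->; rewrite mulr0.
Qed.

Lemma prod_plane_curve (cs : seq {mpoly K[3]}) : cs != [::] ->
  (forall G, G \in cs -> plane_curve G) -> plane_curve (\prod_(G <- cs) G).
Proof.
elim: cs => // G cs ih _ csS; have [G0 [d d0 hG]] := csS G (mem_head _ _).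
rewrite big_cons; have [->|cs0] := eqVneq cs [::].
  by rewrite big_nil mulr1; split=> //; exists d.
have [|F0 [e e0 hF]] := ih cs0; first by move=> H Hcs; apply: csS; rewrite inE Hcs orbT.
by split; [rewrite mulf_neq0 | exists (d + e)%N; [rewrite addn_gt0 d0 | apply: dhomogM]].
Qed.

(** Every zero of [g] is a singular point when [g ^+ 2] divides [F], so [g] has finitely many zeros
    up to scaling and [nonvanishing_const] applies. *)
Lemma finite_Sing_reduced F : plane_curve F -> finite_set (Sing F) -> reduced_curve F.
Proof.
move=> cF finS; split=> // g h FE; have [_ [d _ hF]] := cF.
apply: (@nonvanishing_const _ g [seq pt_vec p | p <- fset_set (Sing F)]).
  by move=> u /mapP [p _ ->]; apply: pt_vec_neq0.
move=> v v0 gv; exists (pt_vec (point_of v0)).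
  apply: map_f; rewrite in_fset_set //; apply: mem_set.
  have vp : v \in val (point_of v0) by rewrite /= memv_line.
  split; first by apply/vanbP; rewrite (vanb_at hF v0 vp) FE mevalM rmorphXn /= gv expr0n mul0r.
  move=> i; apply/vanbP; rewrite (vanb_at (mderiv_homog i hF) v0 vp) FE expr2 !mderivM.
  by rewrite !(mevalD, mevalM) gv !(mulr0, mul0r, addr0).
by rewrite -val_pt_vec /= memv_line.
Qed.

Lemma bin2_add3 n : 'C(n.+3, 2) = ('C(n, 2) + 3 * n.+1)%N.
Proof. by rewrite 3!binS !bin1; lia. Qed.

(** Multiplication by [F] embeds the forms of degree [m - 3] into those of degree [m], with a
    complement of dimension ['C(m + 2, 2) - 'C(m - 1, 2) = 3 * m], which is [3 * m + 1 - g] for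
    [g = 1]. *)
Lemma cubic_genus F : F != 0 -> homogeneous F 3 -> has_genus F 1.
Proof.
move=> F0 hF; exists 3%N, 3%N => m m3; exists (3 * m)%N => //.
pose k := (m - 3)%N; have mE : m = (k + 3)%N by rewrite subnK.
have Fk (h : dhomog 3 K k) : (h : {mpoly K[3]}) * F \is m.-homog for mdeg.
  by rewrite mE; apply: dhomogM => //; apply: dhomog_is_dhomog.
pose phi (h : dhomog 3 K k) : dhomog 3 K m := DHomog (Fk h).
have phi_lin : linear phi.
  by move=> c h h'; apply: val_inj; rewrite /= mulrDl scalerAl.
pose phiL : {linear dhomog 3 K k -> dhomog 3 K m} := HB.pack phi
  (GRing.isLinear.Build K (dhomog 3 K k) (dhomog 3 K m) _ phi phi_lin).
pose f := linfun phiL.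
have kf : lker f == 0%VS.
  apply/lker0P => h h'; rewrite !lfunE /= => /(congr1 val) /= e; apply: val_inj => /=.
  exact: (mulIf F0).
have dimC : \dim (limg f)^C = (3 * m)%N.
  rewrite dimv_compl limg_dim_eq; last by rewrite (eqP kf) capv0.
  rewrite !dimvf /dim /= -['C(m + 2, m)]bin_sub ?leq_addr // addKn.
  rewrite -['C(k + 2, k)]bin_sub ?leq_addr // addKn.
  have -> : (m + 2 = (k + 2).+3)%N by rewrite mE; lia.
  by rewrite bin2_add3 addKn mE; lia.
rewrite -dimC; set C := (limg f)^C%VS; pose X := vbasis C.
have dirC : (limg f :&: C = 0)%VS by rewrite capv_compl.
have CE (c : 'rV[K]_(\dim C)) : \sum_i c 0 i *: X`_i \in C.
  by apply: memv_suml => i _; apply: memvZ; apply: vbasis_mem; rewrite mem_nth // size_tuple.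
exists (fun i => val X`_i) => [i|v hv].
  exact: dhomog_is_dhomog.
have sumE (c : 'rV[K]_(\dim C)) : v - \sum_i c 0 i *: val X`_i =
    val (DHomog hv - \sum_i c 0 i *: X`_i).
  transitivity (v - val (\sum_i c 0 i *: X`_i)); last by [].
  congr (_ - _).
  rewrite [RHS](big_morph (fun a : dhomog 3 K m => val a) (id1 := 0) (op1 := +%R)) //.
have IE (w : dhomog 3 K m) : (exists h, val w = h * F) <-> w \in limg f.
  split=> [[h wE]|/memv_imgP [h _ ->]]; last by exists (val h); rewrite lfunE.
  have [|h' hh' wE'] := @homog_quotient _ _ k 3 (val w) F h _ hF wE.
    by rewrite -mE; apply: dhomog_is_dhomog.
  apply/memv_imgP; exists (DHomog hh'); rewrite ?memvf // lfunE; exact: val_inj.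
have /memv_addP [v1 v1f [v2 v2C vE]] : DHomog hv \in (limg f + C)%VS by rewrite addv_complf memvf.
exists (\row_i coord X i v2); split.
  rewrite sumE; apply/IE; rewrite vE.
  under eq_bigr => i _ do rewrite mxE.
  by rewrite -(coord_vbasis v2C) addrK.
move=> c; rewrite sumE => /IE; rewrite vE => h; apply/rowP => i; rewrite mxE.
have e0 : v2 - \sum_i c 0 i *: X`_i = 0.
  apply/eqP; rewrite -memv0 -dirC memv_cap; apply/andP; split.
    by rewrite -[v2](addKr v1) -addrA memvD // memvN.
  by rewrite memvB ?CE.
move/eqP: e0; rewrite subr_eq0 => /eqP ->; rewrite coord_sum_free //.
by have /andP [] := vbasisP C.
Qed.

End Configurations.

(** * Torsion parameters *)

Section CubeRoots.
Variables (K : numClosedFieldType) (w : K).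
Hypothesis hw : w ^+ 2 = - w - 1.
Implicit Types (t u : K * K) (x y z a b c : K).

Lemma w3 : w ^+ 3 = 1.
Proof. ring: hw. Qed.

Lemma w_neq0 : w != 0.
Proof.
by apply/eqP => w0; move/eqP: hw; rewrite w0 expr0n oppr0 sub0r eq_sym oppr_eq0 oner_eq0.
Qed.

Lemma three_neq0 : 3%:R != 0 :> K.
Proof. by rewrite pnatr_eq0. Qed.

Lemma w_neq1 : w != 1.
Proof.
apply/eqP => w1; have e : w ^+ 2 + w + 1 = 0 by ring: hw.
by case/eqP: three_neq0; rewrite -e w1; ring.
Qed.

Lemma cube_roots x y : x ^+ 3 = y ^+ 3 -> exists2 j, (j < 3)%N & x = w ^+ j * y.
Proof.
move=> e; have /eqP : (x - y) * ((x - w * y) * (x - w ^+ 2 * y)) = 0.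
  have -> : (x - y) * ((x - w * y) * (x - w ^+ 2 * y)) = x ^+ 3 - y ^+ 3 by ring: hw.
  by rewrite e subrr.
rewrite !mulf_eq0 !subr_eq0 => /or3P [] /eqP ->; [exists 0%N|exists 1%N|exists 2%N] => //.
by rewrite expr0 mul1r.
Qed.

Lemma wX3 j : (w ^+ j) ^+ 3 = 1.
Proof. by rewrite -exprM mulnC exprM w3 expr1n. Qed.

Lemma wX_neq0 j : w ^+ j != 0.
Proof. by rewrite expf_neq0 // w_neq0. Qed.

Lemma wX_inj i j : (i < 3)%N -> (j < 3)%N -> w ^+ i = w ^+ j -> i = j.
Proof.
have w2n1 : w ^+ 2 != 1.
  apply/eqP => e; have := w3; rewrite exprS e mulr1 => w1.
  by move: w_neq1; rewrite w1 eqxx.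
have w2nw : w ^+ 2 != w.
  by apply/eqP => e; move: w_neq1; rewrite -(inj_eq (mulfI w_neq0)) mulr1 -expr2 e eqxx.
case: i j => [|[|[|i]]] [|[|[|j]]] //= _ _; rewrite ?expr0 ?expr1 => /eqP;
  by rewrite ?[1 == _]eq_sym ?[w == w ^+ 2]eq_sym ?(negPf w_neq1) ?(negPf w2n1) ?(negPf w2nw).
Qed.

(* The coordinate [u] makes the curve [v ^ 3 = u ^ 3 - 1] a triple cover of the
   projective line, branched at the points [crit]; [lattes] is induced by an
   endomorphism of degree 3 of the curve, so its iterates map to [crit] exactly
   the images of certain torsion points. *)
Definition crit t := t.1 ^+ 3 == t.2 ^+ 3.
Definition lattes t : K * K := (w ^+ 2 * t.1 ^+ 3 + t.2 ^+ 3, t.1 ^+ 3 + w ^+ 2 * t.2 ^+ 3).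
(** Induced by negation on the elliptic curve: [(u : z : v)] goes to [(z : u : - v)] on
    [v ^ 3 = u ^ 3 - z ^ 3], with origin [(1 : 1 : 0)]. *)
Definition swap t : K * K := (t.2, t.1).
(** Pairs are homogeneous coordinates of parameters. The zero pair, the value of a pencil at its
    base points, is [prop] to every pair, just as a base point lies on every member. *)
Definition prop t u := t.1 * u.2 == t.2 * u.1.

(* Collinearity of three points with first coordinates [a_i / b_i] on the
   elliptic curve [v ^ 3 = u ^ 3 - 1], with [v] eliminated. *)
Definition collinear t1 t2 t3 :=
  (t1.1 * t2.1 * t3.1 - t1.2 * t2.2 * t3.2) ^+ 3 =
  (t1.1 ^+ 3 - t1.2 ^+ 3) * (t2.1 ^+ 3 - t2.2 ^+ 3) * (t3.1 ^+ 3 - t3.2 ^+ 3).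

Lemma pair_neq0 t : (t != 0) = (t.1 != 0) || (t.2 != 0).
Proof. by case: t => a b /=; rewrite -negb_and; congr negb; apply/eqP/andP => [[-> ->]//|[/eqP -> /eqP ->]]. Qed.

Lemma ncrit_neq0 t : ~~ crit t -> t != 0.
Proof. by apply: contraNneq => ->; rewrite /crit. Qed.

Lemma crit_swap t : crit (swap t) = crit t.
Proof. by rewrite /crit /= eq_sym. Qed.

Lemma swap_neq0 t : (swap t != 0) = (t != 0).
Proof. by rewrite !pair_neq0 orbC. Qed.

Lemma lattes_swap t : lattes (swap t) = swap (lattes t).
Proof. by rewrite /lattes /swap /=; congr pair; ring. Qed.

Lemma iter_lattes_swap n t : iter n lattes (swap t) = swap (iter n lattes t).
Proof. by elim: n => //= n ->; rewrite lattes_swap. Qed.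

Lemma lattes_neq0 t : t != 0 -> lattes t != 0.
Proof.
rewrite !pair_neq0 -!negb_and; apply: contra => /andP [/eqP /= e1 /eqP /= e2].
have w2n1 : w - 1 != 0 by rewrite subr_eq0 w_neq1.
have : (w - 1) * t.1 ^+ 3 = 0.
  have -> : (w - 1) * t.1 ^+ 3 = w ^+ 2 * (w ^+ 2 * t.1 ^+ 3 + t.2 ^+ 3) - (t.1 ^+ 3 + w ^+ 2 * t.2 ^+ 3).
    by ring: hw.
  by rewrite e1 e2 mulr0 subrr.
have : (w - 1) * t.2 ^+ 3 = 0.
  have -> : (w - 1) * t.2 ^+ 3 = w ^+ 2 * (t.1 ^+ 3 + w ^+ 2 * t.2 ^+ 3) - (w ^+ 2 * t.1 ^+ 3 + t.2 ^+ 3).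
    by ring: hw.
  by rewrite e1 e2 mulr0 subrr.
move=> /eqP; rewrite mulf_eq0 (negPf w2n1) expf_eq0 => /andP [_ ->].
by move=> /eqP; rewrite mulf_eq0 (negPf w2n1) expf_eq0 => /andP [_ ->].
Qed.

Lemma iter_lattes_neq0 n t : t != 0 -> iter n lattes t != 0.
Proof. by elim: n => //= n ih /ih /lattes_neq0. Qed.

(** The preimages of the critical parameters are these parameters themselves together with 0 and
    infinity. *)
Lemma lattes_cubes t : (lattes t).1 ^+ 3 - (lattes t).2 ^+ 3 =
  3%:R * (2%:R * w + 1) * (t.1 ^+ 3 - t.2 ^+ 3) * (t.1 * t.2) ^+ 3.
Proof. rewrite /lattes /=; ring: hw. Qed.

Lemma critE t : crit t = (t.1 ^+ 3 - t.2 ^+ 3 == 0).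
Proof. by rewrite subr_eq0. Qed.

Lemma crit_lattes t : crit t -> crit (lattes t).
Proof. by rewrite !critE lattes_cubes => /eqP ->; rewrite mulr0 mul0r. Qed.

Lemma crit_lattes_axis t : t.1 * t.2 = 0 -> crit (lattes t).
Proof. by move=> t0; rewrite critE lattes_cubes t0 expr0n mulr0. Qed.

Lemma crit_iter n t : crit t -> crit (iter n lattes t).
Proof. by elim: n => //= n ih /ih /crit_lattes. Qed.

(** Collinear points are those with sum zero in the group, and [lattes] comes from an
    endomorphism. *)
Lemma collinear_lattes t1 t2 t3 : collinear t1 t2 t3 ->
  collinear (lattes t1) (lattes t2) (lattes t3).
Proof.
rewrite /collinear !lattes_cubes => h.
(* The second term is a multiple of the defect of [h]; once it is dropped, the left side is a
   monomial in [D] whose cube is again known from [h]. *)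
have -> : (lattes t1).1 * (lattes t2).1 * (lattes t3).1 - (lattes t1).2 * (lattes t2).2 * (lattes t3).2 =
  (2%:R * w + 1) * (3%:R * (t1.1 * t2.1 * t3.1) * (t1.2 * t2.2 * t3.2) * (t1.1 * t2.1 * t3.1 - t1.2 * t2.2 * t3.2)
   - ((t1.1 ^+ 3 - t1.2 ^+ 3) * (t2.1 ^+ 3 - t2.2 ^+ 3) * (t3.1 ^+ 3 - t3.2 ^+ 3)
      - (t1.1 * t2.1 * t3.1 - t1.2 * t2.2 * t3.2) ^+ 3)).
  rewrite /lattes /=; ring: hw.
rewrite h subrr subr0.
set D := (t1.1 * t2.1 * t3.1 - t1.2 * t2.2 * t3.2) in h *.
have -> : ((2%:R * w + 1) * (3%:R * (t1.1 * t2.1 * t3.1) * (t1.2 * t2.2 * t3.2) * D)) ^+ 3 =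
  (3%:R * (2%:R * w + 1)) ^+ 3 * (t1.1 * t2.1 * t3.1 * (t1.2 * t2.2 * t3.2)) ^+ 3 * D ^+ 3 by ring.
rewrite h; ring.
Qed.

Lemma collinear_iter n t1 t2 t3 : collinear t1 t2 t3 ->
  collinear (iter n lattes t1) (iter n lattes t2) (iter n lattes t3).
Proof. by elim: n => //= n ih /ih /collinear_lattes. Qed.

(** The critical points form a subgroup of order 3. In coordinates the right side of the relation
    vanishes, so the two triple products agree, and their cubes give the claim. *)
Lemma collinear_crit t1 t2 t3 : t1 != 0 -> t2 != 0 -> collinear t1 t2 t3 ->
  crit t1 -> crit t2 -> crit t3.
Proof.
rewrite /collinear /crit => n1 n2 h /eqP c1 /eqP c2.
have nz t : t != 0 -> t.1 ^+ 3 = t.2 ^+ 3 -> t.1 ^+ 3 != 0.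
  move=> tn0 e; rewrite expf_eq0 /=; move: tn0; rewrite pair_neq0; apply: contraTN => /eqP t10.
  rewrite t10 eqxx /= negbK; move/esym/eqP: e; rewrite t10 expr0n /= expf_eq0 /=.
  by [].
move/eqP: h; rewrite c1 subrr !mul0r expf_eq0 /= subr_eq0 => /eqP e.
have := congr1 (fun x => x ^+ 3) e; rewrite !exprMn -c1 -c2 => /mulfI -> //.
by rewrite mulf_neq0 ?nz.
Qed.

Lemma critn_collinear n t1 t2 t3 : t1 != 0 -> t2 != 0 -> collinear t1 t2 t3 ->
  crit (iter n lattes t1) -> crit (iter n lattes t2) -> crit (iter n lattes t3).
Proof.
by move=> n1 n2 /(collinear_iter n) h; apply: collinear_crit h; apply: iter_lattes_neq0.
Qed.

Lemma lattes_prop t u : (lattes t).1 * (lattes u).2 - (lattes t).2 * (lattes u).1 =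
  (w - 1) * (t.1 ^+ 3 * u.2 ^+ 3 - t.2 ^+ 3 * u.1 ^+ 3).
Proof. rewrite /lattes /=; ring: hw. Qed.

Lemma prop_lattes t u : prop (lattes t) (lattes u) = ((t.1 * u.2) ^+ 3 == (t.2 * u.1) ^+ 3).
Proof.
rewrite /prop -subr_eq0 lattes_prop mulf_eq0 subr_eq0 (negPf w_neq1) /=.
by rewrite subr_eq0 !exprMn.
Qed.

Lemma lattes_preimage t : ~~ crit t -> exists u, [/\ u.1 != 0, u.2 != 0 & lattes u = t].
Proof.
move=> tc; have w1 : w - 1 != 0 by rewrite subr_eq0 w_neq1.
(* [A] and [B] solve the linear system that [lattes] imposes on the cubes of the coordinates; they
   can vanish only if [t] is critical. *)
pose A := (w ^+ 2 * t.1 - t.2) / (w - 1); pose B := (w ^+ 2 * t.2 - t.1) / (w - 1).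
have rootE' a b : w ^+ 2 * a = b -> a ^+ 3 = b ^+ 3 by move=> <-; rewrite exprMn wX3 mul1r.
exists (3.-root A, 3.-root B); rewrite /= !rootC_eq0 //; split.
- rewrite mulf_eq0 invr_eq0 (negPf w1) orbF subr_eq0; apply: contraNneq tc => /rootE'.
  by rewrite /crit => ->.
- rewrite mulf_eq0 invr_eq0 (negPf w1) orbF subr_eq0; apply: contraNneq tc => /rootE'.
  by rewrite /crit => ->.
- rewrite /lattes /= !rootCK // /A /B [RHS]surjective_pairing; congr pair.
    apply: (mulIf w1); rewrite mulrDl mulrA !divfK //; ring: hw.
  apply: (mulIf w1); rewrite mulrDl divfK // -(mulrA (w ^+ 2)) divfK //; ring: hw.
Qed.

Lemma prop_trans t u v : u != 0 -> prop t u -> prop u v -> prop t v.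
Proof.
rewrite pair_neq0 /prop => un0 /eqP tu /eqP uv.
have h1 : u.1 * (t.1 * v.2 - t.2 * v.1) = 0.
  have -> : u.1 * (t.1 * v.2 - t.2 * v.1) = t.1 * (u.1 * v.2 - u.2 * v.1) + v.1 * (t.1 * u.2 - t.2 * u.1) by ring.
  by rewrite tu uv !subrr !mulr0 addr0.
have h2 : u.2 * (t.1 * v.2 - t.2 * v.1) = 0.
  have -> : u.2 * (t.1 * v.2 - t.2 * v.1) = t.2 * (u.1 * v.2 - u.2 * v.1) + v.2 * (t.1 * u.2 - t.2 * u.1) by ring.
  by rewrite tu uv !subrr !mulr0 addr0.
rewrite -subr_eq0; case/orP: un0 => un0; [move/eqP: h1|move/eqP: h2];
  by rewrite mulf_eq0 (negPf un0).
Qed.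

Lemma prop_sym t u : prop t u = prop u t.
Proof. by rewrite /prop eq_sym mulrC [X in _ == X]mulrC. Qed.

(** Passing from [n] to [n.+1] replaces each parameter by its three preimages under [lattes] and
    adds 0 and infinity, which become critical in one step: [3 * (3 ^ n - 1) + 2 = 3 ^ n.+1 - 1]. *)
Lemma torsion_seq n : exists T : seq (K * K),
  [/\ size T = (3 ^ n).-1, uniq T,
      {in T &, forall t u, prop t u -> t = u},
      {in T, forall t, ~~ crit t /\ crit (iter n lattes t)} &
      forall t, ~~ crit t -> crit (iter n lattes t) -> exists2 u, u \in T & prop t u].
Proof.
elim: n => [|n [T [szT uT inT cT TT]]].
  by exists [::]; split=> // t /= tc; rewrite (negPf tc).
have /choice [pre preE] : forall t, exists u : K * K, t \in T ->
    [/\ u.1 != 0, u.2 != 0 & lattes u = t].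
  move=> t.
  have [tT|] := boolP (t \in T); last by exists 0.
  by have [u hu] := lattes_preimage (cT t tT).1; exists u.
(* [lattes] depends on the cubes of the coordinates only, so its fibres are the orbits of the cube
   roots of unity. *)
pose rot j t : K * K := (w ^+ j * t.1, t.2).
have lrot j t : lattes (rot j t) = lattes t.
  by rewrite /lattes /= !exprMn -exprM mulnC exprM w3 expr1n mul1r.
pose T' := [:: (0, 1); (1, 0)] ++ [seq rot j (pre t) | t <- T, j <- iota 0 3].
have T'P u : reflect ([\/ u = (0, 1), u = (1, 0) | exists t j, [/\ t \in T, (j < 3)%N & u = rot j (pre t)]]) (u \in T').
  rewrite !inE; apply: (iffP or3P) => [[/eqP ->|/eqP ->|/allpairsP [[t j] /= [tT jI ->]]]|[->|->|[t [j [tT j3 ->]]]]].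
  - exact: Or31. - exact: Or32. - by apply: Or33; exists t, j; split=> //; move: jI; rewrite -[[:: _; _; _]]/(iota 0 3) mem_iota.
  - exact: Or31. - exact: Or32. - by apply: Or33; apply/allpairsP; exists (t, j); rewrite mem_iota.
have inT' : {in T' &, forall t u, prop t u -> t = u}.
  move=> t u /T'P tP /T'P uP; rewrite /prop; case: tP => [->|->|[t1 [j [t1T j3 ->]]]];
    case: uP => [->|->|[t2 [j' [t2T j'3 ->]]]]; rewrite /= ?(mul0r, mul1r, mulr0, mulr1) ?oner_eq0 ?[0 == 1]eq_sym ?oner_eq0 //.
  - by rewrite eq_sym mulf_eq0 (negPf (wX_neq0 _)) /= => /eqP e; have [/eqP] := preE _ t2T.
  - by move=> /eqP e; have [_ /eqP] := preE _ t2T.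
  - by rewrite mulf_eq0 (negPf (wX_neq0 _)) /= => /eqP e; have [/eqP] := preE _ t1T.
  - by rewrite eq_sym => /eqP e; have [_ /eqP] := preE _ t1T.
  move=> e; have [p1 p2 pE] := preE _ t1T; have [q1 q2 qE] := preE _ t2T.
  have t12 : t1 = t2.
    apply: inT => //; rewrite -pE -qE -(lrot j (pre t1)) -(lrot j' (pre t2)) prop_lattes /=.
    by rewrite (eqP e).
  rewrite -t12 in e *; congr (rot _ _); apply: wX_inj => //.
  by move/eqP: e; rewrite [RHS]mulrC => /(mulIf p2) /(mulIf p1).
exists T'; split=> //.
- rewrite size_cat size_allpairs szT /= expnS; have : (0 < 3 ^ n)%N by rewrite expn_gt0.
  by case: (3 ^ n)%N => // k _; rewrite /=; lia.
- have notin u : u.1 = 0 \/ u.2 = 0 -> u \notin [seq rot j (pre t) | t <- T, j <- iota 0 3].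
    move=> u0; apply/negP => /allpairsP [[t j] /= [tT _ uE]]; have [p1 p2 _] := preE _ tT.
    case: u0; rewrite uE /= => /eqP; last by rewrite (negPf p2).
    by rewrite mulf_eq0 (negPf p1) orbF (negPf (wX_neq0 _)).
  rewrite /T' cat_uniq; apply/and3P; split.
  + by rewrite /= inE andbT; apply/eqP => -[/eqP]; rewrite eq_sym oner_eq0.
  + rewrite has_sym /= orbF negb_or; apply/andP; split; apply: notin; [left|right] => //.
  + apply: allpairs_uniq; rewrite ?iota_uniq // => -[t j] [t' j'].
    move=> /allpairsP [[t1 j1] [t1T j1I [-> ->]]] /allpairsP [[t2 j2] [t2T j2I [-> ->]]].
    rewrite !mem_iota in j1I j2I; move: t1T j1I t2T j2I => /= t1T j1I t2T j2I e.
    have [p1 p2 pE] := preE _ t1T; have [q1 q2 qE] := preE _ t2T.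
    have t12 : t1 = t2 by rewrite -pE -qE -(lrot j1 (pre t1)) -(lrot j2 (pre t2)) e.
    move: e; rewrite -t12 => -[/(mulIf p1) e].
    by congr pair; apply: wX_inj.
- move=> u /T'P [->|->|[t [j [tT j3 ->]]]]; rewrite iterSr.
  + by rewrite crit_iter ?crit_lattes_axis /= ?mul0r // /crit /= expr0n expr1n eq_sym oner_eq0.
  + by rewrite crit_iter ?crit_lattes_axis /= ?mulr0 // /crit /= expr0n expr1n oner_eq0.
  + have [p1 p2 pE] := preE _ tT; have [tc tn] := cT _ tT; rewrite lrot pE; split=> //.
    by apply: contra tc => /crit_lattes; rewrite lrot pE.
- move=> t tc; rewrite iterSr => ct; have [cl|cl] := boolP (crit (lattes t)).
    move: cl; rewrite critE lattes_cubes !mulf_eq0 -critE (negPf tc) (negPf three_neq0) /= orbF.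
    have -> : 2%:R * w + 1 == 0 = false.
      apply/eqP => e; have : (2%:R * w + 1) ^+ 2 = - 3%:R by ring: hw.
      by rewrite e expr0n => /esym/eqP; rewrite oppr_eq0 (negPf three_neq0).
    move=> h; have /orP [/eqP t0|/eqP t0] : (t.1 == 0) || (t.2 == 0).
      by move: h; case: (t.1 == 0); case: (t.2 == 0).
      by exists (0, 1); [apply/T'P; apply: Or31 | rewrite /prop /= t0 mul0r mulr0].
    by exists (1, 0); [apply/T'P; apply: Or32 | rewrite /prop /= t0 mul0r mulr0].
  have [u inTu] := TT _ cl ct; have [p1 p2 pE] := preE _ inTu.
  rewrite -pE prop_lattes => /eqP /cube_roots [j j3 e].
  exists (rot j (pre u)); first by apply/T'P; apply: Or33; exists u, j.
  by rewrite /prop /= e mulrCA.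
Qed.

End CubeRoots.

(** * The four pencils *)

Section Pencils.
Variables (K : numClosedFieldType) (w : K).
Hypothesis hw : w ^+ 2 = - w - 1.
Implicit Types (t u : K * K) (x y z a b c e : K) (v : 'rV[K]_3).

Local Notation lattes := (lattes w).

Definition formU x y z := x ^+ 2 * y + y ^+ 2 * z + z ^+ 2 * x.
Definition formV x y z := x ^+ 2 * z + y ^+ 2 * x + z ^+ 2 * y.
(** The nine lines of the dual Hesse arrangement. *)
Definition form_disc x y z := (x ^+ 3 - y ^+ 3) * (y ^+ 3 - z ^+ 3) * (z ^+ 3 - x ^+ 3).

(** The value of a pencil at a point is the pair of homogeneous coordinates of the parameter of the
    member through it. *)
Definition hesse e x y z : K * K := (formV (e * x) y z, formU (e * x) y z).
Definition fermat x y z : K * K :=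
  (x ^+ 3 + w * y ^+ 3 + w ^+ 2 * z ^+ 3, x ^+ 3 + w ^+ 2 * y ^+ 3 + w * z ^+ 3).

(** This relation and the next two are also linear in [x], [y], [z] once the forms and the
    differences of cubes are fixed; [kersys] is based on that reading. *)
Lemma formUV_x x y z : y * formU x y z - x * formV x y z = z * (y ^+ 3 - x ^+ 3).
Proof. rewrite /formU /formV; ring. Qed.
Lemma formUV_y x y z : z * formU x y z - y * formV x y z = x * (z ^+ 3 - y ^+ 3).
Proof. rewrite /formU /formV; ring. Qed.
Lemma formUV_z x y z : x * formU x y z - z * formV x y z = y * (x ^+ 3 - z ^+ 3).
Proof. rewrite /formU /formV; ring. Qed.

Lemma formUV_cubes x y z : formV x y z ^+ 3 - formU x y z ^+ 3 = form_disc x y z.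
Proof. rewrite /formU /formV /form_disc; ring. Qed.

Lemma hesse_cubes e x y z : e ^+ 3 = 1 ->
  (hesse e x y z).1 ^+ 3 - (hesse e x y z).2 ^+ 3 = form_disc x y z.
Proof. by move=> e3; rewrite formUV_cubes /form_disc exprMn e3 mul1r. Qed.

Lemma fermat_cubes x y z :
  (fermat x y z).1 ^+ 3 - (fermat x y z).2 ^+ 3 = (2%:R * w + 1) ^+ 3 * form_disc x y z.
Proof. rewrite /form_disc /=; ring: hw. Qed.

Lemma hesse_collinear x y z :
  collinear (hesse 1 x y z) (hesse w x y z) (hesse (w ^+ 2) x y z).
Proof.
rewrite /collinear !hesse_cubes ?expr1n ?(wX3 hw) //; last exact: (w3 hw).
rewrite (_ : _ - _ = form_disc x y z); first by ring.
rewrite /= /formU /formV /form_disc; ring: hw.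
Qed.

(** In the group, the Fermat parameter is the difference of two consecutive Hesse parameters; [swap]
    carries the sign. *)
Lemma hesse_fermat_collinear e x y z : e ^+ 3 = 1 ->
  collinear (swap (hesse e x y z)) (hesse (w * e) x y z) (fermat x y z).
Proof.
move=> e3; rewrite /collinear fermat_cubes hesse_cubes; last by rewrite exprMn (w3 hw) e3 mulr1.
rewrite (_ : _ - (swap _).2 * _ * _ = - (2%:R * w + 1) * form_disc x y z); last first.
  have -> : form_disc x y z = form_disc (e * x) y z by rewrite /form_disc exprMn e3 mul1r.
  have -> : fermat x y z = fermat (e * x) y z by rewrite /fermat exprMn e3 mul1r.
  rewrite /hesse -[w * e * x]mulrA; move: (e * x) => x'.
  by rewrite /= /formU /formV /form_disc; ring: hw.
have -> : (swap (hesse e x y z)).1 ^+ 3 - (swap (hesse e x y z)).2 ^+ 3 = - form_disc x y z.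
  by rewrite -(hesse_cubes _ _ _ e3) opprB.
by ring.
Qed.

Definition pencil (k : nat) x y z := if k == 3%N then fermat x y z else hesse (w ^+ k) x y z.

(** The singular members of each of the four pencils are made of the same nine lines, so criticality
    does not depend on the pencil. *)
Lemma crit_pencil k x y z : crit (pencil k x y z) = (form_disc x y z == 0).
Proof.
rewrite critE /pencil; case: ifP => _; last by rewrite hesse_cubes ?(wX3 hw).
rewrite fermat_cubes mulf_eq0 expf_eq0 /=; case: eqP => //= e; exfalso.
have : (2%:R * w + 1) ^+ 2 = - 3%:R by ring: hw.
by rewrite e expr0n => /esym/eqP; rewrite oppr_eq0 (negPf (three_neq0 K)).
Qed.

(** Any three of the four parameters satisfy a [collinear] relation, up to a [swap], so two torsion
    parameters force the other two. *)
Lemma pencil_two_four n x y z k l : (forall i, (i < 4)%N -> pencil i x y z != 0) ->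
  (k < 4)%N -> (l < 4)%N -> k != l ->
  crit (iter n lattes (pencil k x y z)) -> crit (iter n lattes (pencil l x y z)) ->
  forall i, (i < 4)%N -> crit (iter n lattes (pencil i x y z)).
Proof.
move=> nz; pose C i := crit (iter n lattes (pencil i x y z)).
have nz0 := nz 0%N isT; have nz1 := nz 1%N isT; have nz2 := nz 2%N isT; have nz3 := nz 3%N isT.
have colC t1 t2 t3 : collinear t1 t2 t3 -> collinear t2 t3 t1.
  by rewrite /collinear => h; rewrite [RHS]mulrC mulrA -h; congr (_ ^+ 3); ring.
have tri t1 t2 t3 : t1 != 0 -> t2 != 0 -> t3 != 0 -> collinear t1 t2 t3 ->
   let c t := crit (iter n lattes t) in
   [/\ c t1 -> c t2 -> c t3, c t2 -> c t3 -> c t1 & c t3 -> c t1 -> c t2].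
  move=> n1 n2 n3 h; split; apply: (critn_collinear hw) => //; first exact: colC.
  exact/colC/colC.
have csw t : crit (iter n lattes (swap t)) = crit (iter n lattes t).
  by rewrite iter_lattes_swap crit_swap.
have [h012 h120 h201] := tri _ _ _ nz0 nz1 nz2 (hesse_collinear x y z).
have fer i j : (i < 3)%N -> (j < 3)%N -> w ^+ j = w * w ^+ i -> pencil i x y z != 0 -> pencil j x y z != 0 ->
   [/\ C i -> C j -> C 3%N, C j -> C 3%N -> C i & C 3%N -> C i -> C j].
  move=> i3 j3 e ni nj; have := @hesse_fermat_collinear (w ^+ i) x y z (wX3 hw i); rewrite -e.
  have hE l' : (l' < 3)%N -> hesse (w ^+ l') x y z = pencil l' x y z by rewrite /pencil; case: eqP => // ->.
  rewrite !hE //; move=> /(tri _ _ _ _ nj nz3); rewrite swap_neq0 /= csw => /(_ ni).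
  by [].
have [f03 f30 f00] := fer 0%N 1%N isT isT (exprS w 0) nz0 nz1.
have [g03 g30 g00] := fer 1%N 2%N isT isT (exprS w 1) nz1 nz2.
have [k03 k30 k00] := fer 2%N 0%N isT isT (etrans (esym (w3 hw)) (exprS w 2)) nz2 nz0.
suff all4 : (k < 4)%N -> (l < 4)%N -> k != l -> C k -> C l -> [/\ C 0%N, C 1%N, C 2%N & C 3%N].
  by move=> k4 l4 kl ck cl; have [c0 c1 c2 c3] := all4 k4 l4 kl ck cl; case=> [|[|[|[|i]]]].
rewrite -/(C 0%N) -/(C 1%N) -/(C 2%N) in h012 h120 h201.
by case: k l => [|[|[|[|k]]]] [|[|[|[|l]]]] // _ _ _ ck cl; split; tauto.
Qed.

Lemma hesse_eq0 e x y z : e ^+ 3 = 1 -> hesse e x y z = 0 ->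
  [\/ x ^+ 3 = y ^+ 3 /\ y ^+ 3 = z ^+ 3, x = 0 /\ y = 0, y = 0 /\ z = 0 | x = 0 /\ z = 0].
Proof.
move=> e3 [V0 U0]; have e0 : e != 0 by apply: contra_eq_neq e3 => ->; rewrite expr0n eq_sym oner_eq0.
have E1 := formUV_x (e * x) y z; have E2 := formUV_y (e * x) y z; have E3 := formUV_z (e * x) y z.
rewrite U0 V0 !mulr0 subrr in E1 E2 E3; rewrite exprMn e3 mul1r in E1 E2 E3.
have [x0|xn] := eqVneq x 0.
  move: V0; rewrite /formV x0 mulr0 expr0n /= mul0r mulr0 !add0r => /eqP.
  rewrite mulf_eq0 expf_eq0 /= => /orP [/eqP z0|/eqP y0]; first exact: Or44.
  exact: Or42.
have [y0|yn] := eqVneq y 0.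
  move: V0; rewrite /formV y0 expr0n /= mul0r mulr0 !addr0 => /eqP.
  by rewrite mulf_eq0 expf_eq0 /= mulf_eq0 (negPf e0) (negPf xn) => /eqP z0; apply: Or43.
have [z0|zn] := eqVneq z 0.
  move: V0; rewrite /formV z0 expr0n /= mul0r mulr0 addr0 add0r => /eqP.
  by rewrite mulf_eq0 expf_eq0 /= mulf_eq0 (negPf e0) (negPf xn) (negPf yn).
apply: Or41; split; apply/eqP.
  move/esym/eqP: E1; rewrite mulf_eq0 (negPf zn) subr_eq0 eq_sym //.
move/esym/eqP: E2; rewrite !mulf_eq0 (negPf e0) (negPf xn) subr_eq0 eq_sym //.
Qed.

Lemma fermat_eq0 x y z : (fermat x y z == 0) = (x ^+ 3 == y ^+ 3) && (y ^+ 3 == z ^+ 3).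
Proof.
apply/eqP/andP => [[e1 e2]|[/eqP xy /eqP yz]]; last by rewrite /fermat xy yz; congr pair; ring: hw.
have w0 : w - w ^+ 2 != 0.
  have -> : w - w ^+ 2 = - w * (w - 1) by ring.
  by rewrite mulf_neq0 ?oppr_eq0 ?(w_neq0 hw) // subr_eq0 (w_neq1 hw).
have yz : y ^+ 3 = z ^+ 3.
  apply/eqP; rewrite -subr_eq0 -(mulrI_eq0 _ (mulfI w0)); apply/eqP.
  have -> : (w - w ^+ 2) * (y ^+ 3 - z ^+ 3) =
    (x ^+ 3 + w * y ^+ 3 + w ^+ 2 * z ^+ 3) - (x ^+ 3 + w ^+ 2 * y ^+ 3 + w * z ^+ 3) by ring.
  by rewrite e1 e2 subrr.
rewrite yz eqxx; split=> //; rewrite -subr_eq0; apply/eqP; rewrite -e1 yz; ring: hw.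
Qed.

(** Each of the nine base points of the Fermat pencil is missed by exactly one Hesse pencil; the
    three remaining points of [base_seq], the coordinate vertices, are missed by the Fermat
    pencil. *)
Lemma hesse_base9 k i j : (k < 3)%N -> (i < 3)%N -> (j < 3)%N ->
  (hesse (w ^+ k) 1 (w ^+ i) (w ^+ j) == 0) = ((i + j + k) %% 3 != 0)%N.
Proof.
move=> k3 i3 j3; have [c|c] := boolP ((i + j + k) %% 3 != 0)%N.
  apply/eqP; move: c; case: k i j k3 i3 j3 => [|[|[|//]]] [|[|[|//]]] [|[|[|//]]] //= _ _ _ _;
  by rewrite /hesse /formU /formV; congr pair; ring: hw.
suff UE : formU (w ^+ k * 1) (w ^+ i) (w ^+ j) = 3%:R * ((w ^+ k) ^+ 2 * w ^+ i).
  apply/negbTE/eqP => -[_ /eqP]; rewrite UE mulf_eq0 (negPf (three_neq0 K)) /= mulf_eq0.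
  by rewrite expf_eq0 /= !(negPf (wX_neq0 hw _)).
move: c; case: k i j k3 i3 j3 => [|[|[|//]]] [|[|[|//]]] [|[|[|//]]] //= _ _ _ _;
by rewrite /formU; ring: hw.
Qed.

Lemma pencil_base9 i j : (i < 3)%N -> (j < 3)%N ->
  count (fun k => pencil k 1 (w ^+ i) (w ^+ j) == 0) (iota 0 4) = 3%N.
Proof.
move=> i3 j3; rewrite [LHS]/= /pencil /= !hesse_base9 // fermat_eq0 !(wX3 hw) expr1n eqxx.
by move: i3 j3; case: i j => [|[|[|//]]] [|[|[|//]]].
Qed.

Lemma pencil_base3 x y z : (x, y, z) \in [:: (1, 0, 0); (0, 1, 0); (0, 0, 1)] ->
  count (fun k => pencil k x y z == 0) (iota 0 4) = 3%N.
Proof.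
have h0 e x' y' z' : formV (e * x') y' z' = 0 -> formU (e * x') y' z' = 0 -> (hesse e x' y' z' == 0) = true.
  by rewrite /hesse => -> ->; apply/eqP.
rewrite !inE => /or3P [] /eqP [-> -> ->]; rewrite [LHS]/= /pencil /= fermat_eq0 !h0 /formU /formV;
  by rewrite ?(expr0n, expr1n, mulr0, mul0r, mulr1, mul1r, addr0, add0r) //= ?oner_eq0 ?[0 == 1]eq_sym ?oner_eq0 ?eqxx ?andbF.
Qed.

Definition base_seq : seq 'rV[K]_3 :=
  [:: row3 1 0 0; row3 0 1 0; row3 0 0 1] ++
  [seq row3 1 (w ^+ i) (w ^+ j) | i <- iota 0 3, j <- iota 0 3].

Local Notation pencilv k v := (pencil k (v 0 0) (v 0 1) (v 0 2%:R)).

Lemma base_seqP v : reflect ([\/ v = row3 1 0 0, v = row3 0 1 0, v = row3 0 0 1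
  | exists i j, [/\ (i < 3)%N, (j < 3)%N & v = row3 1 (w ^+ i) (w ^+ j)]]) (v \in base_seq).
Proof.
apply: (iffP idP) => [|[->|->|->|[i [j [i3 j3 ->]]]]]; rewrite mem_cat.
- case/orP => [|/allpairsP [[i j] [iI jI ->]]]; last first.
    by rewrite !mem_iota in iI jI; apply: Or44; exists i, j.
  by rewrite !inE => /or3P [] /eqP ->; [apply: Or41|apply: Or42|apply: Or43].
- by rewrite !inE eqxx.
- by rewrite !inE eqxx !orbT.
- by rewrite !inE eqxx !orbT.
- by apply/orP; right; apply/allpairsP; exists (i, j); rewrite !mem_iota.
Qed.

Lemma row3E a b c : (row3 a b c 0 0 = a) * (row3 a b c 0 1 = b) * (row3 a b c 0 2%:R = c).
Proof. by rewrite !mxE. Qed.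

Lemma base_seq_count v : v \in base_seq -> count (fun k => pencilv k v == 0) (iota 0 4) = 3%N.
Proof.
move=> /base_seqP [->|->|->|[i [j [i3 j3 ->]]]]; rewrite !row3E; last exact: pencil_base9.
all: by apply: pencil_base3; rewrite !inE eqxx ?orbT.
Qed.

Lemma base_seq_span k v : v != 0 -> (k < 4)%N -> pencilv k v = 0 ->
  exists2 u, u \in base_seq & exists2 c, c != 0 & v = c *: u.
Proof.
move=> v0 k4 pv; have vE := row3K v; set x := v 0 0 in pv vE; set y := v 0 1 in pv vE; set z := v 0 2%:R in pv vE.
have nz a b c : v = row3 a b c -> [|| a != 0, b != 0 | c != 0].
  apply: contra_eqT; rewrite !negb_or !negbK => /and3P [/eqP -> /eqP -> /eqP ->].
  apply/eqP => e; case/eqP: v0; rewrite e; apply/rowP => -[[|[|[|//]]] ?]; by rewrite !mxE.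
have sc c a b d : c *: row3 a b d = row3 (c * a) (c * b) (c * d).
  by apply/rowP => j; rewrite !mxE; case: j => [[|[|[|//]]] ?].
have cubes : x ^+ 3 = y ^+ 3 -> y ^+ 3 = z ^+ 3 -> exists2 u, u \in base_seq & exists2 c, c != 0 & v = c *: u.
  move=> xy yz; have x0 : x != 0.
    apply/eqP => x0; move: (nz _ _ _ vE); rewrite x0 eqxx /=.
    move/esym/eqP: xy; rewrite x0 expr0n expf_eq0 /= => /eqP y0.
    move/esym/eqP: yz; rewrite y0 expr0n expf_eq0 /= => /eqP z0.
    by rewrite z0 eqxx.
  have [i i3 yE] := cube_roots hw (esym xy).
  have [j j3 zE] := cube_roots hw (etrans (esym yz) (esym xy)).
  exists (row3 1 (w ^+ i) (w ^+ j)); first by apply/base_seqP; apply: Or44; exists i, j.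
  by exists x => //; rewrite sc {1}vE mulr1 yE zE ![x * _]mulrC.
move: pv; rewrite /pencil; case: eqP => _; first by move/eqP; rewrite fermat_eq0 => /andP [/eqP xy /eqP yz]; apply: cubes.
move=> /(hesse_eq0 (wX3 hw k)) [[xy yz]|[x0 y0]|[y0 z0]|[x0 z0]]; first exact: cubes.
- exists (row3 0 0 1); first by apply/base_seqP; apply: Or43.
  exists z; first by have := nz _ _ _ vE; rewrite x0 y0 eqxx.
  by rewrite sc {1}vE x0 y0 mulr0 mulr1.
- exists (row3 1 0 0); first by apply/base_seqP; apply: Or41.
  exists x; first by have := nz _ _ _ vE; rewrite y0 z0 eqxx !orbF.
  by rewrite sc {1}vE y0 z0 mulr0 mulr1.
- exists (row3 0 1 0); first by apply/base_seqP; apply: Or42.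
  exists y; first by have := nz _ _ _ vE; rewrite x0 z0 eqxx orbF.
  by rewrite sc {1}vE x0 z0 mulr0 mulr1.
Qed.

Lemma base_seq_inj (u v : 'rV[K]_3) c : u \in base_seq -> v \in base_seq -> v = c *: u -> v = u.
Proof.
move=> hu hv e; suff c1 : c = 1 by rewrite e c1 scale1r.
move: hu hv => /base_seqP hu /base_seqP hv.
have e0 : v 0 0 = c * u 0 0 by rewrite e mxE.
have e1 : v 0 1 = c * u 0 1 by rewrite e mxE.
have e2 : v 0 2%:R = c * u 0 2%:R by rewrite e mxE.
have n10 : (1 : K) <> 0 by apply/eqP; rewrite oner_eq0.
have wn0 l : w ^+ l <> 0 by apply/eqP; rewrite (wX_neq0 hw).
case: hu => [uE|uE|uE|[i [j [i3 j3 uE]]]]; case: hv => [vE|vE|vE|[i' [j' [i'3 j'3 vE]]]];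
  rewrite uE vE !row3E ?(mulr1, mulr0) in e0 e1 e2 => //; try by case: n10.
all: try by case: (wn0 i').
all: try by case: (wn0 j').
all: by case: n10; rewrite ?e1 ?e2 -?e0 ?mul0r.
Qed.

Lemma base_seq_uniq : uniq base_seq.
Proof.
rewrite cat_uniq; apply/and3P; split.
- rewrite /= !inE !negb_or !andbT; apply/andP; split; [apply/andP; split|]; apply/eqP => /rowP e;
    [have := e 0|have := e 0|have := e 1]; rewrite !mxE => /eqP; by rewrite ?oner_eq0 // eq_sym oner_eq0.
- apply/hasPn => v /allpairsP [[i j] [_ _ ->]]; rewrite !inE !negb_or.
  by do ![apply/andP; split]; apply/eqP => /rowP e; [have := e 1|have := e 0|have := e 0];
    rewrite !mxE => /eqP; rewrite ?oner_eq0 ?(negPf (wX_neq0 hw _)).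
- apply: allpairs_uniq; rewrite ?iota_uniq // => -[i j] [i' j'].
  move=> /allpairsP [[a b] [aI bI [-> ->]]] /allpairsP [[a' b'] [a'I b'I [-> ->]]] /rowP e.
  rewrite !mem_iota in aI bI a'I b'I.
  have := e 1; have := e 2%:R; rewrite !mxE /= => eb ea.
  by congr pair; [apply: (wX_inj hw aI a'I ea)|apply: (wX_inj hw bI b'I eb)].
Qed.

Lemma size_base_seq : size base_seq = 12%N.
Proof. by rewrite size_cat size_allpairs. Qed.

End Pencils.

(** * Intersections of members of two pencils *)

Section Kernel.
Variables (K : numClosedFieldType) (w : K).
Hypothesis hw : w ^+ 2 = - w - 1.
Implicit Types (t : K * K) (x y z a b c e al be ga : K) (u v m : 'rV[K]_3).

Local Notation vx v := (v 0 0).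
Local Notation vy v := (v 0 1).
Local Notation vz v := (v 0 2%:R).

(* The linear system satisfied by a point where [formU : formV = a : b] and
   [y ^ 3 - x ^ 3], [z ^ 3 - y ^ 3], [x ^ 3 - z ^ 3] are proportional to
   [al], [be], [ga]. *)
Definition kersys a b al be ga v :=
  [/\ a * vy v - b * vx v = al * vz v, a * vz v - b * vy v = be * vx v
    & a * vx v - b * vz v = ga * vy v].

Lemma kersysZ a b al be ga c v : kersys a b al be ga v -> kersys a b al be ga (c *: v).
Proof.
move=> [e1 e2 e3]; split; rewrite !mxE; [rewrite mulrCA [b * _]mulrCA -mulrBr e1|
  rewrite mulrCA [b * _]mulrCA -mulrBr e2|rewrite mulrCA [b * _]mulrCA -mulrBr e3]; exact: mulrCA.
Qed.

Lemma row3_neq0 v : v != 0 -> [|| vx v != 0, vy v != 0 | vz v != 0].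
Proof.
apply: contraNT; rewrite !negb_or !negbK => /and3P [/eqP x0 /eqP y0 /eqP z0].
by rewrite [v]row3K x0 y0 z0; apply/eqP/rowP => -[[|[|[|//]]] ?]; rewrite !mxE.
Qed.

(** The cross products of two of the three rows of the system [kersys], hence the candidates for its
    solution. *)
Definition minor1 a b al be := row3 (a ^+ 2 - b * al) (al * be + a * b) (b ^+ 2 + a * be).
Definition minor2 a b be ga := row3 (b ^+ 2 + a * ga) (a ^+ 2 - b * be) (be * ga + a * b).
Definition minor3 a b ga al := row3 (ga * al + a * b) (b ^+ 2 + a * al) (a ^+ 2 - b * ga).

Definition parallel u v :=
  [/\ vx u * vy v = vy u * vx v, vy u * vz v = vz u * vy v & vz u * vx v = vx u * vz v].

Lemma minor_parallel a b al be x y z : a * y - b * x = al * z -> a * z - b * y = be * x ->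
  [/\ x * (al * be + a * b) = y * (a ^+ 2 - b * al),
      y * (b ^+ 2 + a * be) = z * (al * be + a * b) &
      z * (a ^+ 2 - b * al) = x * (b ^+ 2 + a * be)].
Proof.
move=> e1 e2; split; apply/eqP; rewrite -subr_eq0; apply/eqP.
- have -> : x * (al * be + a * b) - y * (a ^+ 2 - b * al) =
    a * (al * z - (a * y - b * x)) + al * (be * x - (a * z - b * y)) by ring.
  by rewrite e1 e2 !subrr !mulr0 addr0.
- have -> : y * (b ^+ 2 + a * be) - z * (al * be + a * b) =
    be * ((a * y - b * x) - al * z) + b * (be * x - (a * z - b * y)) by ring.
  by rewrite e1 e2 !subrr !mulr0 addr0.
- have -> : z * (a ^+ 2 - b * al) - x * (b ^+ 2 + a * be) =
    b * ((a * y - b * x) - al * z) + a * ((a * z - b * y) - be * x) by ring.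
  by rewrite e1 e2 !subrr !mulr0 addr0.
Qed.

Lemma parallel_scale u v : u != 0 -> parallel u v -> exists c, v = c *: u.
Proof.
move=> /row3_neq0 u0 [e1 e2 e3].
have sc c : vx v = c * vx u -> vy v = c * vy u -> vz v = c * vz u -> exists c, v = c *: u.
  by move=> h1 h2 h3; exists c; rewrite [v]row3K h1 h2 h3 -[in RHS](esym (row3K u)) [u in RHS]row3K;
    apply/rowP => j; rewrite !mxE; case: j => [[|[|[|//]]] ?].
have dv (p q p' q' : K) : p != 0 -> p * q' = q * p' -> q' = p' / p * q.
  by move=> p0 e; apply: (mulfI p0); rewrite e mulrA [p * _]mulrC divfK // mulrC.
case/or3P: u0 => u0.
- by apply: (sc (vx v / vx u)); rewrite ?divfK //; apply: dv.
- by apply: (sc (vy v / vy u)); rewrite ?divfK //; apply: dv.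
- by apply: (sc (vz v / vz u)); rewrite ?divfK //; apply: dv.
Qed.

Lemma parallel_sym u v : parallel u v -> parallel v u.
Proof. by move=> [e1 e2 e3]; split; rewrite mulrC -?e1 -?e2 -?e3 mulrC ?e1 ?e2 ?e3 mulrC. Qed.

Section Solve.
Variables a b al be ga : K.
Hypotheses (s0 : al + be + ga = 0) (ab0 : (a != 0) || (b != 0)).

(** The system has rank at least 2: the entries [a ^+ 2 - b * al], [a ^+ 2 - b * be] and
    [a ^+ 2 - b * ga] of the minors add up to [3 * a ^+ 2]. *)
Lemma minors_neq0 : [|| minor1 a b al be != 0, minor2 a b be ga != 0 | minor3 a b ga al != 0].
Proof.
apply: contraTT ab0; rewrite !negb_or !negbK.
move=> /and3P [/eqP /row3_eq0 [e1 _ f1] /eqP /row3_eq0 [_ e2 _] /eqP /row3_eq0 [_ _ e3]].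
have a0 : a = 0.
  apply/eqP; have : 3%:R * a ^+ 2 == 0.
    have -> : 3%:R * a ^+ 2 = (a ^+ 2 - b * al) + (a ^+ 2 - b * be) + (a ^+ 2 - b * ga) + b * (al + be + ga) by ring.
    by rewrite e1 e2 e3 s0 mulr0 !addr0.
  by rewrite mulf_eq0 (negPf (three_neq0 K)) expf_eq0.
move: f1; rewrite a0 mul0r addr0 eqxx => /eqP; rewrite expf_eq0 /= => ->.
by [].
Qed.

(** As [al + be + ga = 0], the determinant of the system is [a ^+ 3 - b ^+ 3 - al * be * ga]; when
    it vanishes, a nonzero minor is a solution. *)
Lemma kersys_exists : al * be * ga = a ^+ 3 - b ^+ 3 -> exists2 v, v != 0 & kersys a b al be ga v.
Proof.
move=> p0; have gaE : ga = - al - be by apply/eqP; rewrite -subr_eq0 -s0; apply/eqP; ring.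
have pE : a ^+ 3 = b ^+ 3 + al * be * ga by rewrite p0 addrC subrK.
rewrite gaE in pE.
case/or3P: minors_neq0 => h; [exists (minor1 a b al be)|exists (minor2 a b be ga)|exists (minor3 a b ga al)] => //;
  split; rewrite !row3E ?gaE; ring: pE.
Qed.

Lemma kersys_unique u v : u != 0 -> kersys a b al be ga u -> kersys a b al be ga v ->
  exists c, v = c *: u.
Proof.
move=> u0 ku kv.
have [m m0 mP] : exists2 m, m != 0 & forall v', kersys a b al be ga v' -> parallel v' m.
  case/or3P: minors_neq0 => h; [exists (minor1 a b al be)|exists (minor2 a b be ga)|exists (minor3 a b ga al)] => // v' [e1 e2 e3].
  - by have [h1 h2 h3] := minor_parallel e1 e2; split; rewrite !row3E.
  - by have [h1 h2 h3] := minor_parallel e2 e3; split; rewrite !row3E.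
  - by have [h1 h2 h3] := minor_parallel e3 e1; split; rewrite !row3E.
have [c mE] := parallel_scale u0 (mP _ ku).
have [c' vE] := parallel_scale m0 (parallel_sym (mP _ kv)).
by exists (c' * c); rewrite vE mE scalerA.
Qed.

(** The proportion [aVbU] provides [c]. At most one coordinate of [v] is zero, so two of the
    relations [F1], [F2], [F3] can be cancelled, and the third follows since the three cofactors add
    up to zero. *)
Lemma kersys_forms v : v != 0 -> kersys a b al be ga v -> exists c,
  [/\ formU (vx v) (vy v) (vz v) = a * c, formV (vx v) (vy v) (vz v) = b * c,
      vy v ^+ 3 - vx v ^+ 3 = al * c, vz v ^+ 3 - vy v ^+ 3 = be * c
    & vx v ^+ 3 - vz v ^+ 3 = ga * c].
Proof.
move=> /row3_neq0 v0 [e1 e2 e3]; set x := vx v in v0 e1 e2 e3 *; set y := vy v in v0 e1 e2 e3 *.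
set z := vz v in v0 e1 e2 e3 *.
have aVbU : a * formV x y z = b * formU x y z.
  apply/eqP; rewrite -subr_eq0; apply/eqP.
  have -> : a * formV x y z - b * formU x y z =
    (a * y - b * x) * (x * y) + (a * z - b * y) * (y * z) + (a * x - b * z) * (z * x).
    by rewrite /formU /formV; ring.
  rewrite e1 e2 e3; have -> : al * z * (x * y) + be * x * (y * z) + ga * y * (z * x) = x * y * z * (al + be + ga) by ring.
  by rewrite s0 mulr0.
have [c [cU cV]] : exists c, formU x y z = a * c /\ formV x y z = b * c.
  case/orP: ab0 => h0.
    exists (formU x y z / a); split; first by rewrite mulrC divfK.
    by apply: (mulfI h0); rewrite aVbU mulrCA [a * _]mulrC divfK.
  exists (formV x y z / b); split; last by rewrite mulrC divfK.
  by apply: (mulfI h0); rewrite -aVbU mulrCA [b * _]mulrC divfK.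
have E1 := formUV_x x y z; have E2 := formUV_y x y z; have E3 := formUV_z x y z.
have F1 : z * (y ^+ 3 - x ^+ 3 - al * c) = 0.
  have -> : z * (y ^+ 3 - x ^+ 3 - al * c) = z * (y ^+ 3 - x ^+ 3) - al * z * c by ring.
  by rewrite -E1 cU cV -e1; ring.
have F2 : x * (z ^+ 3 - y ^+ 3 - be * c) = 0.
  have -> : x * (z ^+ 3 - y ^+ 3 - be * c) = x * (z ^+ 3 - y ^+ 3) - be * x * c by ring.
  by rewrite -E2 cU cV -e2; ring.
have F3 : y * (x ^+ 3 - z ^+ 3 - ga * c) = 0.
  have -> : y * (x ^+ 3 - z ^+ 3 - ga * c) = y * (x ^+ 3 - z ^+ 3) - ga * y * c by ring.
  by rewrite -E3 cU cV -e3; ring.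
have sum0 : (y ^+ 3 - x ^+ 3 - al * c) + (z ^+ 3 - y ^+ 3 - be * c) + (x ^+ 3 - z ^+ 3 - ga * c) = 0.
  have -> : (y ^+ 3 - x ^+ 3 - al * c) + (z ^+ 3 - y ^+ 3 - be * c) + (x ^+ 3 - z ^+ 3 - ga * c) =
    - c * (al + be + ga) by ring.
  by rewrite s0 mulr0.
have no2 (p r s : K) : (p != 0) -> a * 0 - b * p = r * 0 -> a * p - b * 0 = s * 0 -> False.
  move=> p0; rewrite !mulr0 sub0r subr0 => /eqP; rewrite oppr_eq0 mulf_eq0 (negPf p0) orbF => b0.
  by move=> /eqP; rewrite mulf_eq0 (negPf p0) orbF => a0; move: ab0; rewrite a0 b0.
have fin0 (p q : K) : p != 0 -> p * q = 0 -> q = 0.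
  by move=> p0 /eqP; rewrite mulf_eq0 (negPf p0) => /eqP.
suff [G1 G2 G3] : [/\ y ^+ 3 - x ^+ 3 - al * c = 0, z ^+ 3 - y ^+ 3 - be * c = 0 & x ^+ 3 - z ^+ 3 - ga * c = 0].
  by exists c; split=> //; apply/eqP; rewrite -subr_eq0; apply/eqP.
have [x0|x0] := eqVneq x 0.
  rewrite x0 in e1 e2 e3 v0.
  have y0 : y != 0.
    apply/eqP => y0; move: v0; rewrite y0 !eqxx /= => z0; rewrite y0 in e2 e3.
    exact: (no2 z ga be z0 e3 e2).
  have z0 : z != 0.
    by apply/eqP => z0; rewrite z0 in e1 e2; exact: (no2 y be al y0 e2 e1).
  have G1 := fin0 _ _ z0 F1; have G3 := fin0 _ _ y0 F3.
  by split=> //; move: sum0; rewrite G1 G3 add0r addr0.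
have G2 := fin0 _ _ x0 F2; have [z0|z0] := eqVneq z 0.
  have y0 : y != 0.
    by apply/eqP => y0; rewrite y0 z0 in e1 e2 e3; apply: (no2 x al ga x0).
  have G3 := fin0 _ _ y0 F3; split=> //; by move: sum0; rewrite G2 G3 !addr0.
have G1 := fin0 _ _ z0 F1; split=> //; by move: sum0; rewrite G1 G2 !add0r.
Qed.

End Solve.

Lemma forms_kersys a b al be ga c v : c != 0 ->
  formU (vx v) (vy v) (vz v) = a * c -> formV (vx v) (vy v) (vz v) = b * c ->
  vy v ^+ 3 - vx v ^+ 3 = al * c -> vz v ^+ 3 - vy v ^+ 3 = be * c ->
  vx v ^+ 3 - vz v ^+ 3 = ga * c -> kersys a b al be ga v.
Proof.
move=> c0 U V h1 h2 h3.
have E1 := formUV_x (vx v) (vy v) (vz v); have E2 := formUV_y (vx v) (vy v) (vz v).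
have E3 := formUV_z (vx v) (vy v) (vz v).
rewrite U V ?h1 ?h2 ?h3 in E1 E2 E3.
split; apply: (mulfI c0).
- have -> : c * (a * vy v - b * vx v) = vy v * (a * c) - vx v * (b * c) by ring.
  by rewrite E1; ring.
- have -> : c * (a * vz v - b * vy v) = vz v * (a * c) - vy v * (b * c) by ring.
  by rewrite E2; ring.
- have -> : c * (a * vx v - b * vz v) = vx v * (a * c) - vz v * (b * c) by ring.
  by rewrite E3; ring.
Qed.

Local Notation pencilv k v := (pencil w k (vx v) (vy v) (vz v)).

Lemma pencil0E x y z : pencil w 0 x y z = (formV x y z, formU x y z).
Proof. by rewrite /pencil /= /hesse expr0 mul1r. Qed.

Lemma pencilZ k c v : pencilv k (c *: v) = (c ^+ 3 * (pencilv k v).1, c ^+ 3 * (pencilv k v).2).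
Proof.
rewrite !mxE /pencil; case: ifP => _; rewrite /fermat /hesse /formU /formV /=; congr pair; ring.
Qed.

Lemma pencilZ_eq0 k c v : c != 0 -> (pencilv k (c *: v) == 0) = (pencilv k v == 0).
Proof.
move=> c0; rewrite pencilZ; apply/eqP/eqP => [[/eqP h1 /eqP h2]|->]; last by rewrite !mulr0.
move: h1 h2; rewrite mulf_eq0 expf_eq0 (negPf c0) /= => /eqP h1.
rewrite mulf_eq0 expf_eq0 (negPf c0) /= => /eqP h2.
by rewrite [LHS]surjective_pairing h1 h2.
Qed.

Lemma prop_scale t1 t2 : t2 != 0 -> prop t1 t2 -> exists c, t1 = (c * t2.1, c * t2.2).
Proof.
rewrite pair_neq0 /prop => /orP [h|h] /eqP e.
  exists (t1.1 / t2.1); rewrite [LHS]surjective_pairing divfK //; congr pair.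
  by apply: (mulIf h); rewrite mulrAC divfK // e.
exists (t1.2 / t2.2); rewrite [LHS]surjective_pairing divfK //; congr pair.
by apply: (mulIf h); rewrite mulrAC divfK // -e.
Qed.

(** Linear forms that recover the differences of cubes at a point from its Fermat parameter, up to
    the factor [w ^+ 2 - w] (see [fermat_abg]). *)
Definition al0 t := w * t.1 - w ^+ 2 * t.2.
Definition be0 t := t.1 - t.2.
Definition ga0 t := w ^+ 2 * t.1 - w * t.2.

Lemma abg_sum t s : s * al0 t + s * be0 t + s * ga0 t = 0.
Proof. rewrite /al0 /be0 /ga0; ring: hw. Qed.

Lemma abg_prod t : al0 t * be0 t * ga0 t = t.1 ^+ 3 - t.2 ^+ 3.
Proof. rewrite /al0 /be0 /ga0; ring: hw. Qed.

Lemma prop_abg t1 t2 : al0 t1 * be0 t2 = be0 t1 * al0 t2 -> prop t1 t2.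
Proof.
move=> e; have w0 : w ^+ 2 - w != 0.
  have -> : w ^+ 2 - w = w * (w - 1) by ring.
  by rewrite mulf_neq0 ?(w_neq0 hw) // subr_eq0 (w_neq1 hw).
apply/eqP/(mulfI w0)/eqP; rewrite -subr_eq0; apply/eqP.
have -> : (w ^+ 2 - w) * (t1.1 * t2.2) - (w ^+ 2 - w) * (t1.2 * t2.1) = al0 t1 * be0 t2 - be0 t1 * al0 t2.
  by rewrite /al0 /be0; ring.
by rewrite e subrr.
Qed.

Lemma fermat_abg x y z : [/\ al0 (fermat w x y z) = (w ^+ 2 - w) * (y ^+ 3 - x ^+ 3),
  be0 (fermat w x y z) = (w ^+ 2 - w) * (z ^+ 3 - y ^+ 3) &
  ga0 (fermat w x y z) = (w ^+ 2 - w) * (x ^+ 3 - z ^+ 3)].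
Proof. split; rewrite /al0 /be0 /ga0 /=; ring: hw. Qed.

(** The factor scaling [al0 t1], [be0 t1], [ga0 t1] such that the system with [a = t2.2] and
    [b = t2.1] becomes singular. It matters up to a cube root of unity, which the third index of
    [scal] selects: whence three points for each pair of members. *)
Definition rho t1 t2 := 3.-root ((t2.2 ^+ 3 - t2.1 ^+ 3) / (t1.1 ^+ 3 - t1.2 ^+ 3)).

Section Count.
Variable T : seq (K * K).
Hypotheses (uT : uniq T) (inT : {in T &, forall t1 t2, prop t1 t2 -> t1 = t2})
  (cT : {in T, forall t, ~~ crit t}).
Let M := size T.
Let tn (i : 'I_M) : K * K := nth 0 T i.
Local Notation triple := ('I_M * 'I_M * 'I_3)%type.

Let tnT i : tn i \in T. Proof. exact: mem_nth. Qed.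
Let tn_inj : injective tn.
Proof. by move=> i j /eqP; rewrite nth_uniq // => /eqP /val_inj. Qed.
Let tnc i : (tn i).1 ^+ 3 - (tn i).2 ^+ 3 != 0.
Proof. by rewrite -critE cT. Qed.
Let tnc_opp i : (tn i).2 ^+ 3 - (tn i).1 ^+ 3 != 0.
Proof. by rewrite -oppr_eq0 opprB. Qed.
Let tn0 i : tn i != 0. Proof. exact/ncrit_neq0/cT. Qed.

Definition scal (i : triple) := w ^+ i.2 * rho (tn i.1.1) (tn i.1.2).
Definition ksys (i : triple) v := kersys (tn i.1.2).2 (tn i.1.2).1
  (scal i * al0 (tn i.1.1)) (scal i * be0 (tn i.1.1)) (scal i * ga0 (tn i.1.1)) v.

Let ab0 i : ((tn i).2 != 0) || ((tn i).1 != 0).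
Proof. by rewrite orbC -pair_neq0. Qed.

Lemma rho3 t1 t2 : t1.1 ^+ 3 - t1.2 ^+ 3 != 0 ->
  rho t1 t2 ^+ 3 * (t1.1 ^+ 3 - t1.2 ^+ 3) = t2.2 ^+ 3 - t2.1 ^+ 3.
Proof. by move=> h; rewrite rootCK // divfK. Qed.

Lemma rho_neq0 i j : rho (tn i) (tn j) != 0.
Proof. by rewrite rootC_eq0 // mulf_neq0 // invr_eq0. Qed.

Lemma ksys_exists i : exists2 v, v != 0 & ksys i v.
Proof.
apply: kersys_exists; [exact: abg_sum|exact: ab0|].
have -> : scal i * al0 (tn i.1.1) * (scal i * be0 (tn i.1.1)) * (scal i * ga0 (tn i.1.1)) =
  scal i ^+ 3 * (al0 (tn i.1.1) * be0 (tn i.1.1) * ga0 (tn i.1.1)) by ring.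
by rewrite abg_prod /scal exprMn (wX3 hw) mul1r rho3.
Qed.

Lemma ksys_forms i v : v != 0 -> ksys i v -> exists c,
  [/\ pencilv 0%N v = (c * (tn i.1.2).1, c * (tn i.1.2).2), prop (pencilv 3%N v) (tn i.1.1)
    & c = 0 -> vx v ^+ 3 = vy v ^+ 3 /\ vy v ^+ 3 = vz v ^+ 3].
Proof.
move=> v0 kv; have [c [U V h1 h2 h3]] := kersys_forms (abg_sum _ _) (ab0 _) v0 kv.
exists c; split.
- by rewrite pencil0E U V ![c * _]mulrC.
- apply: prop_abg; rewrite /pencil /=; have [-> -> _] := fermat_abg (vx v) (vy v) (vz v).
  by rewrite h1 h2; ring.
- move=> c0; rewrite c0 !mulr0 in h1 h2.
  by split; apply/eqP; rewrite eq_sym -subr_eq0 ?h1 ?h2.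
Qed.

(** Both parameters fix the point's forms up to the ratio [s] of their scalings, and [formUV_cubes]
    determines [s ^+ 3]. *)
Lemma ksys_complete v i1 i2 : pencilv 0%N v != 0 ->
  prop (pencilv 3%N v) (tn i1) -> prop (pencilv 0%N v) (tn i2) ->
  exists j : 'I_3, ksys (i1, i2, j) v.
Proof.
move=> p0 /(prop_scale (tn0 i1)) [m mE] /(prop_scale (tn0 i2)) [c cE].
have c0 : c != 0 by apply: contraNneq p0 => c0; rewrite cE c0 !mul0r.
pose kap := w ^+ 2 - w; have k0 : kap != 0.
  have -> : kap = w * (w - 1) by rewrite /kap; ring.
  by rewrite mulf_neq0 ?(w_neq0 hw) // subr_eq0 (w_neq1 hw).
have [V U] : formV (vx v) (vy v) (vz v) = c * (tn i2).1 /\ formU (vx v) (vy v) (vz v) = c * (tn i2).2.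
  by move: cE; rewrite pencil0E => -[-> ->].
pose s := m / (kap * c).
have mE' : m = s * (kap * c) by rewrite divfK // mulf_neq0.
have fE : fermat w (vx v) (vy v) (vz v) = (m * (tn i1).1, m * (tn i1).2) by [].
have [f1 f2 f3] := fermat_abg (vx v) (vy v) (vz v).
have h1 : vy v ^+ 3 - vx v ^+ 3 = s * al0 (tn i1) * c.
  by apply: (mulfI k0); rewrite -f1 fE /al0 /= mE'; ring.
have h2 : vz v ^+ 3 - vy v ^+ 3 = s * be0 (tn i1) * c.
  by apply: (mulfI k0); rewrite -f2 fE /be0 /= mE'; ring.
have h3 : vx v ^+ 3 - vz v ^+ 3 = s * ga0 (tn i1) * c.
  by apply: (mulfI k0); rewrite -f3 fE /ga0 /= mE'; ring.
have : s ^+ 3 = rho (tn i1) (tn i2) ^+ 3.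
  apply: (mulIf (tnc i1)); rewrite rho3 // -abg_prod.
  have c3 : c ^+ 3 != 0 by rewrite expf_neq0.
  apply: (mulfI c3).
  have -> : c ^+ 3 * (s ^+ 3 * (al0 (tn i1) * be0 (tn i1) * ga0 (tn i1))) =
    (s * al0 (tn i1) * c) * (s * be0 (tn i1) * c) * (s * ga0 (tn i1) * c) by ring.
  rewrite -h1 -h2 -h3.
  have -> : c ^+ 3 * ((tn i2).2 ^+ 3 - (tn i2).1 ^+ 3) = - ((c * (tn i2).1) ^+ 3 - (c * (tn i2).2) ^+ 3) by ring.
  by rewrite -U -V formUV_cubes /form_disc; ring.
move=> /(cube_roots hw) [j j3 sE]; exists (Ordinal j3); rewrite /ksys /scal /= -sE.
by apply: (@forms_kersys _ _ _ _ _ c) => //; rewrite ?U ?V mulrC.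
Qed.

Lemma scal_inj i i' : i.1 = i'.1 -> scal i = scal i' -> i = i'.
Proof.
case: i i' => [[i1 i2] j] [[i1' i2'] j'] /= [<- <-]; rewrite /scal /=.
by move=> /(mulIf (rho_neq0 _ _)) /(wX_inj hw (ltn_ord j) (ltn_ord j')) /val_inj ->.
Qed.

(** The [3 * M ^ 2] triples index the points. A triple is lost only if its solution is a base point
    of pencil 0. That base point is then one of the nine of the Fermat pencil, and together with the
    member of pencil 0 it determines the triple, so at most [9 * M] are lost. *)
Theorem quadruple_points : exists pts : seq (proj_point K),
  [/\ uniq pts,
      forall p, p \in pts <-> [/\ pencilv 0%N (pt_vec p) != 0,
        exists2 t, t \in T & prop (pencilv 3%N (pt_vec p)) t &
        exists2 t, t \in T & prop (pencilv 0%N (pt_vec p)) t] &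
      (size pts <= 3 * M ^ 2)%N /\ (3 * M ^ 2 <= size pts + 9 * M)%N].
Proof.
have /choice [pv pvP] : forall i : triple, exists v, v != 0 /\ ksys i v.
  by move=> i; have [v v0 kv] := ksys_exists i; exists v.
have pv0 i : pv i != 0 := (pvP i).1; have pvk i : ksys i (pv i) := (pvP i).2.
pose good := [pred i : triple | pencilv 0%N (pv i) != 0].
pose pt i := point_of (pv0 i).
have ptE i : exists2 c, c != 0 & pt_vec (pt i) = c *: pv i.
  have /in_pointP [c e] : pv i \in val (pt i) by rewrite /= memv_line.
  have c0 : c != 0 by apply: contraNneq (pv0 i) => c0; rewrite e c0 scale0r.
  by exists c^-1; rewrite ?invr_eq0 // e scalerK.
have pt_inj : {in good &, injective pt}.
  move=> i i' gi gi' e; have [c c0 cE] := ptE i; have [c' c'0 c'E] := ptE i'.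
  have pvE : pv i' = (c'^-1 * c) *: pv i by rewrite -scalerA -cE e c'E scalerK.
  have kk : ksys i' (pv i).
    have -> : pv i = (c'^-1 * c)^-1 *: pv i' by rewrite pvE scalerK // mulf_neq0 // invr_eq0.
    exact/kersysZ/pvk.
  have [d [pE pr _]] := ksys_forms (pv0 i) (pvk i).
  have [d' [pE' pr' _]] := ksys_forms (pv0 i) kk.
  (* A good solution avoids the nine lines, so its Fermat parameter is a nonzero pair too and
     determines [i.1.1]. *)
  have f0 : pencilv 3%N (pv i) != 0.
    apply: ncrit_neq0; rewrite (crit_pencil hw) -(crit_pencil hw 0%N) critE pE /= !exprMn -mulrBr.
    by rewrite mulf_neq0 // expf_neq0 //; apply: contraNneq gi => d0; rewrite pE d0 !mul0r.
  have e1 : i.1.1 = i'.1.1.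
    by apply/tn_inj/inT => //; apply: (prop_trans f0) pr'; rewrite prop_sym.
  have pP : prop (pencilv 0%N (pv i)) (tn i.1.2) by rewrite pE /prop /=; apply/eqP; ring.
  have pP' : prop (pencilv 0%N (pv i)) (tn i'.1.2) by rewrite pE' /prop /=; apply/eqP; ring.
  have e2 : i.1.2 = i'.1.2.
    by apply/tn_inj/inT => //; apply: (prop_trans gi) pP'; rewrite prop_sym.
  apply: scal_inj; first by rewrite [LHS]surjective_pairing e1 e2 -surjective_pairing.
  have [a1 a2 a3] := pvk i; have [b1 b2 b3] := kk.
  rewrite -e1 -e2 in b1 b2 b3.
  have := tnc i.1.1; rewrite -abg_prod !mulf_eq0 !negb_or => /andP [/andP [al be] ga].
  case/or3P: (row3_neq0 (pv0 i)) => nz; [apply: (mulIf be); apply: (mulIf nz)|apply: (mulIf ga); apply: (mulIf nz)|apply: (mulIf al); apply: (mulIf nz)].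
  - by rewrite -a2 b2. - by rewrite -a3 b3. - by rewrite -a1 b1.
exists [seq pt i | i <- enum good]; split.
- rewrite map_inj_in_uniq ?enum_uniq // => i i'; rewrite !mem_enum; exact: pt_inj.
- move=> p; split=> [pP|[p0 [t1 t1T pr1] [t2 t2T pr2]]].
    have [ i ] : exists2 i, i \in enum good & p = pt i by apply/mapP.
    rewrite mem_enum => gi ->; have [c c0 cE] := ptE i.
    have kc : ksys i (pt_vec (pt i)) by rewrite cE; apply/kersysZ/pvk.
    have [d [pE pr _]] := ksys_forms (pt_vec_neq0 _) kc.
    split; first by rewrite cE pencilZ_eq0.
      by exists (tn i.1.1).
    by exists (tn i.1.2) => //; rewrite pE /prop /=; apply/eqP; ring.
  have i1P : (index t1 T < M)%N by rewrite index_mem.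
  have i2P : (index t2 T < M)%N by rewrite index_mem.
  have [||j kj] := @ksys_complete (pt_vec p) (Ordinal i1P) (Ordinal i2P) p0.
  - by rewrite /tn nth_index.
  - by rewrite /tn nth_index.
  set i := (_, _, _) in kj.
  have [c cE] := kersys_unique (abg_sum _ _) (ab0 _) (pv0 i) (pvk i) kj.
  have c0 : c != 0 by apply: contraNneq (pt_vec_neq0 p) => c0; rewrite cE c0 scale0r.
  have -> : p = pt i; last first.
    by apply: map_f; rewrite mem_enum inE /=; move: p0; rewrite cE pencilZ_eq0.
  apply: (point_eq (pv0 i)); last by rewrite /= memv_line.
  by apply/in_pointP; exists c^-1; rewrite cE scalerK.
- rewrite size_map -cardE.
  have cI : #|{: triple}| = (3 * M ^ 2)%N by rewrite !card_prod !card_ord; lia.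
  rewrite -cI; split; first exact: max_card.
  rewrite -(cardC good) leq_add2l.
  have /choice [kl klP] : forall i : triple, exists a : 'I_3 * 'I_3, i \notin good ->
     exists2 x, x != 0 & pv i = x *: row3 1 (w ^+ a.1) (w ^+ a.2).
    move=> i; have [gi|] := boolP (i \in good); first by exists (ord0, ord0).
    rewrite inE /= negbK => /eqP bi; have [c [pE _ c0]] := ksys_forms (pv0 i) (pvk i).
    have [|xy yz] := c0.
      move: pE; rewrite bi => -[/esym/eqP + /esym/eqP]; rewrite !mulf_eq0.
      by case: eqP => //= _ /eqP t0 /eqP t0'; have := ab0 i.1.2; rewrite t0 t0' eqxx.
    have x0 : vx (pv i) != 0.
      apply/eqP => x0; have := row3_neq0 (pv0 i); rewrite x0 eqxx /=.
      move/esym/eqP: xy; rewrite x0 expr0n expf_eq0 /= => /eqP y0.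
      move/esym/eqP: yz; rewrite y0 expr0n expf_eq0 /= => /eqP z0.
      by rewrite z0 eqxx.
    have [k k3 yE] := cube_roots hw (esym xy).
    have [l l3 zE] := cube_roots hw (etrans (esym yz) (esym xy)).
    exists (Ordinal k3, Ordinal l3) => _; exists (vx (pv i)) => //=.
    rewrite {1}[pv i]row3K yE zE; apply/rowP => j'; rewrite !mxE.
    by case: j' => [[|[|[|//]]] ?] /=; rewrite ?mulr1 // mulrC.
  (* At a fixed point [[1 : w ^ k : w ^ l]] and for a fixed member of pencil 0, the system gives
     [scal i * al0] and [scal i * be0]; their ratio yields the Fermat member, and then the scalar
     the cube root. *)
  pose h (i : triple) := (i.1.2, kl i).
  rewrite (_ : (9 * M)%N = #|{: 'I_M * ('I_3 * 'I_3)}|); last by rewrite !card_prod !card_ord; lia.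
  have h_inj : {in [predC good] &, injective h}.
    move=> i i' /klP [x x0 xE] /klP [x' x'0 x'E] [e2 ekl].
    have ki : ksys i (row3 1 (w ^+ (kl i).1) (w ^+ (kl i).2)).
      by rewrite -[row3 _ _ _](scalerK x0) -xE; apply/kersysZ/pvk.
    have ki' : ksys i' (row3 1 (w ^+ (kl i).1) (w ^+ (kl i).2)).
      by rewrite ekl -[row3 _ _ _](scalerK x'0) -x'E; apply/kersysZ/pvk.
    have [a1 a2 _] := ki; have [b1 b2 _] := ki'.
    rewrite !row3E -?e2 in a1 a2 b1 b2.
    have E2 : scal i * be0 (tn i.1.1) = scal i' * be0 (tn i'.1.1).
      by rewrite !mulr1 in a2 b2; rewrite -a2 -b2.
    have E1 : scal i * al0 (tn i.1.1) = scal i' * al0 (tn i'.1.1).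
      by apply: (mulIf (wX_neq0 hw (kl i).2)); rewrite -a1 -b1.
    have s0 (l : triple) : scal l != 0 by rewrite mulf_neq0 ?rho_neq0 ?(wX_neq0 hw).
    have e1 : i.1.1 = i'.1.1.
      apply/tn_inj/inT => //; apply: prop_abg; apply: (mulfI (mulf_neq0 (s0 i) (s0 i'))).
      transitivity ((scal i * al0 (tn i.1.1)) * (scal i' * be0 (tn i'.1.1))); first by ring.
      by rewrite E1 -E2; ring.
    apply: scal_inj; first by rewrite [LHS]surjective_pairing e1 e2 -surjective_pairing.
    have := tnc i.1.1; rewrite -abg_prod !mulf_eq0 !negb_or => /andP [/andP [_ be] _].
    by apply: (mulIf be); rewrite E2 e1.
  rewrite -(card_in_image h_inj); exact: max_card.
Qed.

End Count.
End Kernel.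

(** * The torsion configurations *)

Section DiagonalCubics.
Variable K : numClosedFieldType.
Implicit Types (c v : 'rV[K]_3) (A : 'M[K]_3).

Definition linear_form A i : {mpoly K[3]} := \sum_j A j i *: 'X_j.
(** All members of the four pencils are combinations of cubes of three independent linear forms, for
    which smoothness amounts to nonzero coefficients. *)
Definition diagonal_cubic c A : {mpoly K[3]} := \sum_i c 0 i *: linear_form A i ^+ 3.

Lemma linear_form_eval A i v : (linear_form A i).@[v 0] = (v *m A) 0 i.
Proof.
rewrite /linear_form raddf_sum mxE; apply: eq_bigr => j _ /=.
by rewrite mevalZ mevalXU mulrC.
Qed.

Lemma linear_form_homog A i : homogeneous (linear_form A i) 1.
Proof. by apply: rpred_sum => j _; apply/rpredZ; rewrite dhomogX /= mdeg1. Qed.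

Lemma diagonal_cubic_homog c A : homogeneous (diagonal_cubic c A) 3.
Proof.
apply: rpred_sum => i _; apply/rpredZ.
exact: (dhomogMn 3 (linear_form_homog A i)).
Qed.

Lemma diagonal_cubic_eval c A v : (diagonal_cubic c A).@[v 0] = \sum_i c 0 i * (v *m A) 0 i ^+ 3.
Proof.
rewrite raddf_sum; apply: eq_bigr => i _ /=.
by rewrite mevalZ rmorphXn /= linear_form_eval.
Qed.

Lemma diagonal_cubic_deriv c A v j :
  (diagonal_cubic c A)^`M(j).@[v 0] = \sum_i A j i * (3%:R * c 0 i * (v *m A) 0 i ^+ 2).
Proof.
rewrite /diagonal_cubic (raddf_sum (mderiv j)) (raddf_sum (meval (v 0))); apply: eq_bigr => i _ /=.
have dl : (linear_form A i)^`M(j) = (A j i)%:MP.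
  rewrite /linear_form raddf_sum (bigD1 j) //= big1 => [|k kj].
    rewrite addr0 mderivZ mderivX mnm1E eqxx (_ : (_ - _)%MM = 0%MM).
      by rewrite mpolyX0 scale1r -mul_mpolyC mulr1.
    by apply/mnmP => k; rewrite mnmBE subnn mnm0E.
  by rewrite mderivZ mderivX mnm1E (negPf kj) mulr0n scale0r ?scaler0.
rewrite mderivZ mevalZ 2!exprS expr1 !mderivM dl !mevalD !mevalM !mevalD !mevalM mevalC.
rewrite linear_form_eval; ring.
Qed.

Lemma diagonal_cubic_smooth c A : A \in unitmx -> (forall i, c 0 i != 0) ->
  smooth_cubic (diagonal_cubic c A).
Proof.
move=> uA c0; split; last exact: diagonal_cubic_homog.
have key v : (forall j, (diagonal_cubic c A)^`M(j).@[v 0] = 0) -> v = 0.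
  move=> h; pose q : 'cV[K]_3 := \col_i (3%:R * c 0 i * (v *m A) 0 i ^+ 2).
  have q0 : q = 0.
    rewrite -[q](mulKmx uA) (_ : A *m q = 0) ?mulmx0 //.
    apply/colP => j; rewrite !mxE -[RHS](h j) diagonal_cubic_deriv.
    by apply: eq_bigr => i _; rewrite !mxE.
  rewrite -[v](mulmxK uA) (_ : v *m A = 0) ?mul0mx //.
  apply/rowP => i; move/colP/(_ i): q0; rewrite !mxE => /eqP.
  by rewrite mulf_eq0 expf_eq0 mulf_eq0 /= (negPf (three_neq0 K)) (negPf (c0 i)) /= => /eqP.
split; last first.
  apply/seteqP; split=> // p [_ h]; have := pt_vec_neq0 p.
  by rewrite (key (pt_vec p)) ?eqxx.
split; last by exists 3%N => //; apply: diagonal_cubic_homog.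
apply/negP => /eqP F0; have := key (row3 1 0 0); rewrite F0 => e.
have /row3_eq0 [/eqP] : row3 (1 : K) 0 0 = 0 by apply: e => j; rewrite raddf0 meval0.
by rewrite oner_eq0.
Qed.
End DiagonalCubics.

Section PencilCubics.
Variables (K : numClosedFieldType) (w : K).
Hypothesis hw : w ^+ 2 = - w - 1.
Implicit Types (t : K * K) (v : 'rV[K]_3) (k : nat).

Local Notation pencilv k v := (pencil w k (v 0 0) (v 0 1) (v 0 2%:R)).

Definition mx3 (s : seq (seq K)) : 'M[K]_3 := \matrix_(j, i) nth 0 (nth [::] s j) i.

Definition hesse_mx e := mx3 [:: [:: e; e; e]; [:: 1; w; w ^+ 2]; [:: 1; w ^+ 2; w]].

(** The coefficients make the value at a point equal to the determinant of its parameter and [t], up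
    to a factor 9 for the Hesse pencils. Their product is [t.2 ^+ 3 - t.1 ^+ 3]. *)
Definition pencil_cubic k t :=
  diagonal_cubic (row3 (t.2 - t.1) (w * t.2 - w ^+ 2 * t.1) (w ^+ 2 * t.2 - w * t.1))
    (if k == 3%N then 1%:M else hesse_mx (w ^+ k)).

Lemma hesse_mx_unit e : e ^+ 3 = 1 -> hesse_mx e \in unitmx.
Proof.
move=> e3.
have : hesse_mx e *m (3%:R^-1 *: mx3 [:: [:: e ^+ 2; 1; 1];
    [:: e ^+ 2; w ^+ 2; w]; [:: e ^+ 2; w; w ^+ 2]]) = 1%:M.
  rewrite -scalemxAr; apply: (scalerI (three_neq0 K)); rewrite scalerA divff ?three_neq0 // scale1r.
  apply/matrixP => i j; rewrite !mxE !big_ord_recl big_ord0 !mxE /=.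
  case: i => [[|[|[|//]]] ?]; case: j => [[|[|[|//]]] ?] /=.
  - by ring: e3.
  - by ring: hw.
  - by ring: hw.
  - by ring: hw.
  - by ring: hw.
  - by ring: hw.
  - by ring: hw.
  - by ring: hw.
  - by ring: hw.
by case/mulmx1_unit.
Qed.

Lemma pencil_cubic_smooth k t : ~~ crit t -> smooth_cubic (pencil_cubic k t).
Proof.
move=> ct; apply: diagonal_cubic_smooth.
  by case: ifP => _; rewrite ?unitmx1 ?hesse_mx_unit ?(wX3 hw).
have : (t.2 - t.1) * (w * t.2 - w ^+ 2 * t.1) * (w ^+ 2 * t.2 - w * t.1) != 0.
  rewrite (_ : _ * _ = t.2 ^+ 3 - t.1 ^+ 3); last by ring: hw.
  by rewrite subr_eq0 eq_sym.
rewrite !mulf_eq0 !negb_or => /andP[/andP[n0 n1] n2] i.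
by rewrite mxE; case: i => [[|[|[|//]]] ?].
Qed.

Lemma nine_neq0 : 9%:R != 0 :> K.
Proof. by rewrite pnatr_eq0. Qed.

Lemma pencil_cubic_vanb k t p : vanb (pencil_cubic k t) p = prop (pencilv k (pt_vec p)) t.
Proof.
rewrite /vanb diagonal_cubic_eval !big_ord_recl big_ord0 /prop /pencil.
move: (pt_vec p) => v.
case: ifP => _.
  rewrite mulmx1 !mxE /= addr0 -subr_eq0 (_ : lift 0 (lift 0 0) = 2%:R); last exact/val_inj.
  rewrite (_ : lift 0 0 = 1); last exact/val_inj.
  by rewrite -[RHS]subr_eq0; congr (_ == 0); rewrite subr0; ring.
rewrite !mxE /= !big_ord_recl !big_ord0 !mxE /= (_ : lift 0 (lift 0 0) = 2%:R); last exact/val_inj.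
rewrite (_ : lift 0 0 = 1); last exact/val_inj.
rewrite -[RHS]subr_eq0 -[RHS](mulrI_eq0 _ (mulfI nine_neq0)); congr (_ == 0).
by rewrite /formU /formV; ring: hw.
Qed.
End PencilCubics.

Lemma count_unique (I : eqType) (a : pred I) (s : seq I) : uniq s ->
  {in s &, forall x y, a x -> a y -> x = y} -> count a s = has a s.
Proof.
move=> us inj; case: hasP => [[x xs ax]|na].
  rewrite (_ : count a s = count_mem x s); first by rewrite count_uniq_mem ?xs.
  by apply: eq_in_count => y ys /=; apply/idP/eqP => [ay|-> //]; apply: inj.
by apply/eqP; rewrite -leqn0 leqNgt -has_count; apply/hasP.
Qed.

Section TorsionConfiguration.
Variables (K : numClosedFieldType) (w : K).
Hypothesis hw : w ^+ 2 = - w - 1.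
Implicit Types (t u : K * K) (p : proj_point K) (v : 'rV[K]_3) (k l : nat).

Local Notation pencilv k v := (pencil w k (v 0 0) (v 0 1) (v 0 2%:R)).

Lemma iter_lattes_scale n c t : exists e,
  iter n (lattes w) (c * t.1, c * t.2) =
    (e * (iter n (lattes w) t).1, e * (iter n (lattes w) t).2).
Proof.
elim: n => [|n [e eE]]; first by exists c.
by exists (e ^+ 3); rewrite !iterS eE /lattes /=; congr pair; ring.
Qed.

Lemma crit_scale c t : crit t -> crit (c * t.1, c * t.2).
Proof. by rewrite /crit /= !exprMn => /eqP ->. Qed.

Lemma base_seq_neq0 v : v \in base_seq w -> v != 0.
Proof.
move=> vB; apply/eqP => v0; move: vB; rewrite v0 => /base_seqP.
by case=> [e|e|e|[i [j [_ _ e]]]]; have /row3_eq0 [/eqP+ /eqP+ /eqP+] := esym e;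
  rewrite ?oner_eq0.
Qed.

Lemma base_points : exists B : seq (proj_point K),
  [/\ uniq B, size B = 12%N, forall p, p \in B ->
        count (fun k => pencilv k (pt_vec p) == 0) (iota 0 4) = 3%N &
      forall p k, (k < 4)%N -> pencilv k (pt_vec p) = 0 -> p \in B].
Proof.
have /choice [bp bpP] : forall v, exists p, v != 0 -> v \in val p.
  move=> v; have [->|v0] := eqVneq v 0.
    have n0 : row3 (1 : K) 0 0 != 0.
      by apply/eqP => /row3_eq0 [/eqP]; rewrite oner_eq0.
    by exists (point_of n0).
  by exists (point_of v0) => _; rewrite /= memv_line.
have bpB v : v \in base_seq w -> exists2 c, c != 0 & v = c *: pt_vec (bp v).
  move=> vB; have v0 := base_seq_neq0 vB; have /in_pointP [c e] := bpP v v0.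
  by exists c => //; apply: contra_neq v0 => c0; rewrite e c0 scale0r.
exists [seq bp v | v <- base_seq w]; split.
- rewrite map_inj_in_uniq ?(base_seq_uniq hw) // => u v uB vB e.
  have [c c0 uE] := bpB u uB; have [d d0 vE] := bpB v vB.
  apply/esym/(base_seq_inj hw uB vB (c := d / c)).
  by rewrite [in RHS]uE scalerA divfK // e.
- by rewrite size_map size_base_seq.
- move=> p /mapP [v vB ->]; apply: etrans (base_seq_count hw vB).
  have [c c0 vE] := bpB v vB.
  by apply: eq_count => k; rewrite [in RHS]vE pencilZ_eq0.
- move=> p k k4 p0; have [u uB [c c0 pE]] := base_seq_span hw (pt_vec_neq0 p) k4 p0.
  apply/mapP; exists u => //; have u0 := base_seq_neq0 uB.
  apply: (point_eq u0); last exact: bpP.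
  by apply/in_pointP; exists c^-1; rewrite pE scalerA mulVf ?scale1r.
Qed.

Variables (n : nat) (T : seq (K * K)).
Hypotheses (uT : uniq T) (inT : {in T &, forall t u, prop t u -> t = u})
  (cT : {in T, forall t, ~~ crit t /\ crit (iter n (lattes w) t)})
  (TT : forall t, ~~ crit t -> crit (iter n (lattes w) t) -> exists2 u, u \in T & prop t u).
Let M := size T.

Definition pencil_cubics := [seq pencil_cubic w k t | k <- iota 0 4, t <- T].

Lemma size_pencil_cubics : size pencil_cubics = (4 * M)%N.
Proof. by rewrite size_allpairs. Qed.

Lemma pencil_cubicsP G : G \in pencil_cubics -> smooth_cubic G.
Proof. by case/allpairsP=> -[k t] [_ /= /cT [tc _] ->]; apply: pencil_cubic_smooth. Qed.

Let cnt k p := count (prop (pencilv k (pt_vec p))) T.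

Lemma pencil_cubics_mult p : curve_mult pencil_cubics p =
  (cnt 0 p + (cnt 1 p + (cnt 2 p + cnt 3 p)))%N.
Proof.
have e k : count (fun G => vanb G p) [seq pencil_cubic w k t | t <- T] = cnt k p.
  by rewrite count_map; apply: eq_count => t /=; apply: pencil_cubic_vanb.
by rewrite /curve_mult /pencil_cubics /= !count_cat !e addn0.
Qed.

Lemma has_prop t : t != 0 ->
  count (prop t) T = ~~ crit t && crit (iter n (lattes w) t).
Proof.
move=> t0; rewrite count_unique //; last first.
  move=> u v uT' vT pu pv; apply: inT => //; apply: (@prop_trans _ _ t) => //.
  by rewrite prop_sym.
congr nat_of_bool; apply/hasP/andP => [[u uT' pu]|[nc cn]]; last first.
  by have [u uT' pu] := TT nc cn; exists u.
have [nc cn] := cT uT'; have [c tE] := prop_scale (ncrit_neq0 nc) pu.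
have c0 : c != 0 by apply: contra_neq t0 => c0; rewrite tE c0 !mul0r.
split; last first.
  by have [e eE] := iter_lattes_scale n c u; rewrite tE eE; apply: crit_scale.
apply: contra nc => /(crit_scale c^-1); rewrite tE /= !mulrA mulVf // !mul1r.
by case: (u).
Qed.

Lemma cnt_base p k : pencilv k (pt_vec p) = 0 -> cnt k p = M.
Proof.
move=> e; rewrite /cnt e (eq_count (a2 := predT)) ?count_predT // => t.
by rewrite /prop !mul0r eqxx.
Qed.

Lemma cnt_nonbase p k : pencilv k (pt_vec p) != 0 ->
  cnt k p = ~~ crit (pencilv 0 (pt_vec p)) && crit (iter n (lattes w) (pencilv k (pt_vec p))).
Proof. by move=> h; rewrite /cnt has_prop // !(crit_pencil hw). Qed.

(** The three pencils based at [p] contribute all their members. The fourth contributes none,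
    because [p] is on the nine lines and its parameter there is critical. *)
Lemma mult_base p : count (fun k => pencilv k (pt_vec p) == 0) (iota 0 4) = 3%N ->
  curve_mult pencil_cubics p = (3 * M)%N.
Proof.
move=> e; have /hasP [k _ /eqP k0] : has (fun k => pencilv k (pt_vec p) == 0) (iota 0 4).
  by rewrite has_count e.
have c l : cnt l p = ((pencilv l (pt_vec p) == 0%R) * M)%N.
  case: eqP => [/cnt_base ->|/eqP h]; first by rewrite mul1n.
  by rewrite cnt_nonbase // (crit_pencil hw) -(crit_pencil hw k) k0 /crit eqxx.
move/(congr1 (muln^~ M)): e => <-.
by rewrite pencil_cubics_mult !c -!mulnDl /= addn0.
Qed.

(** Each pencil has at most one chosen member through [p], so two members belong to different
    pencils and [pencil_two_four] applies. The second alternative is what [quadruple_points]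
    provides. *)
Lemma mult_nonbase p : (forall k, (k < 4)%N -> pencilv k (pt_vec p) != 0) ->
  (1 < curve_mult pencil_cubics p)%N \/
    ((0 < cnt 0 p)%N /\ (0 < cnt 3 p)%N) ->
  [/\ curve_mult pencil_cubics p = 4%N, (0 < cnt 0 p)%N & (0 < cnt 3 p)%N].
Proof.
move=> nz; rewrite pencil_cubics_mult !cnt_nonbase ?nz //.
have := @pencil_two_four K w hw n _ _ _ _ _ nz.
case: (crit _) => /= [_ [//|[//]]|H].
pose C k := crit (iter n (lattes w) (pencilv k (pt_vec p))).
have {}H k l : (k < 4)%N -> (l < 4)%N -> k != l -> C k -> C l -> [/\ C 0%N, C 1%N, C 2%N & C 3%N].
  by move=> k4 l4 kl ck cl; have h := H k l k4 l4 kl ck cl; split; apply: h.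
rewrite -/(C 0%N) -/(C 1%N) -/(C 2%N) -/(C 3%N).
have h01 := H 0%N 1%N isT isT isT; have h02 := H 0%N 2%N isT isT isT.
have h03 := H 0%N 3%N isT isT isT; have h12 := H 1%N 2%N isT isT isT.
have h13 := H 1%N 3%N isT isT isT; have h23 := H 2%N 3%N isT isT isT.
suff h : (1 < C 0 + (C 1 + (C 2 + C 3)))%N \/ (0 < C 0)%N /\ (0 < C 3)%N ->
    [/\ C 0%N, C 1%N, C 2%N & C 3%N] by case/h=> -> -> -> ->.
move: h01 h02 h03 h12 h13 h23.
case: (C 0%N); case: (C 1%N); case: (C 2%N); case: (C 3%N) => h01 h02 h03 h12 h13 h23 h;
  first [exact: h01 | exact: h02 | exact: h03 | exact: h12 | exact: h13 | exact: h23
        | by case: h => [|[]]].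
Qed.

Theorem torsion_configuration : (0 < M)%N -> exists (S : seq (proj_point K)) (t : nat),
  [/\ uniq S /\ size S = (12 + t)%N, forall p, p \in S <-> (1 < curve_mult pencil_cubics p)%N,
      (\sum_(p <- S) curve_mult pencil_cubics p ^ 2 = 108 * M ^ 2 + 16 * t)%N &
      (t <= 3 * M ^ 2)%N /\ (3 * M ^ 2 <= t + 9 * M)%N].
Proof.
move=> M0; have [B [uB sB cB Bc]] := base_points.
have [pts [upts ptsP [t1 t2]]] := quadruple_points hw uT inT (fun t tT => (cT tT).1).
have nbase p : p \notin B -> forall k, (k < 4)%N -> pencilv k (pt_vec p) != 0.
  by move=> pB k k4; apply: contra pB => /eqP /(Bc _ _ k4).
have base_crit p : p \in B -> crit (pencilv 0 (pt_vec p)).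
  move=> /cB e; have /hasP [k _ /eqP k0] : has (fun k => pencilv k (pt_vec p) == 0) (iota 0 4).
    by rewrite has_count e.
  by rewrite (crit_pencil hw) -(crit_pencil hw k) k0 /crit eqxx.
have ptsE p : p \in pts <-> [/\ pencilv 0 (pt_vec p) != 0, (0 < cnt 3 p)%N & (0 < cnt 0 p)%N].
  by rewrite ptsP; split=> -[h1 h2 h3]; split=> //; rewrite -?has_count; apply/hasP; rewrite // has_count.
have disj p : p \in pts -> p \notin B.
  move=> /ptsE [h _]; apply: contraTN => /base_crit.
  by rewrite -/(cnt 0 p) cnt_nonbase // => ->.
have multB p : p \in B -> curve_mult pencil_cubics p = (3 * M)%N.
  by move=> /cB; apply: mult_base.
have multpts p : p \in pts -> curve_mult pencil_cubics p = 4%N.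
  move=> pp; have [_ c3 c0] := (ptsE p).1 pp.
  by have [] := mult_nonbase (nbase p (disj p pp)) (or_intror (conj c0 c3)).
exists (B ++ pts), (size pts); split=> //.
- rewrite cat_uniq uB upts size_cat sB; split=> //; rewrite andbT /=.
  by apply/hasPn => p /disj.
- move=> p; rewrite mem_cat; split=> [/orP [/multB ->|/multpts ->] //|m1]; first by lia.
  have [//|pB] := boolP (p \in B).
  have [_ c0 c3] := mult_nonbase (nbase p pB) (or_introl m1).
  by apply/ptsE; split=> //; apply: nbase.
- rewrite big_cat /= (eq_big_seq (fun=> (9 * M ^ 2)%N)); last first.
    by move=> p /multB ->; rewrite expnMn.
  rewrite [X in (_ + X)%N](eq_big_seq (fun=> 16%N)); last by move=> p /multpts ->.
  by rewrite !big_const_seq !count_predT !iter_addn_0 sB mulnAC.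
Qed.
End TorsionConfiguration.

(** * H-values of the torsion configurations and their limit *)

Lemma homogeneous_prod (K : fieldType) (cs : seq {mpoly K[3]}) d :
  (forall G, G \in cs -> homogeneous G d) -> homogeneous (\prod_(G <- cs) G) (d * size cs).
Proof.
elim: cs => [|G cs ih] h; first by rewrite big_nil muln0; apply: dhomog1.
rewrite big_cons mulnS; apply: dhomogM; first by apply/h/mem_head.
by apply: ih => H Hcs; apply: h; rewrite inE Hcs orbT.
Qed.

Lemma exists_cube_root (K : numClosedFieldType) : exists w : K, w ^+ 2 = - w - 1.
Proof.
have [w e] := @solve_monicpoly K 2%N (fun=> -1) isT; exists w.
by rewrite e !big_ord_recl big_ord0 /= expr0 expr1; ring.
Qed.

Lemma torsion_H_value (R : realType) (n : nat) : exists (F : {mpoly R[i][3]}) (M t : nat),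
  [/\ cubic_configuration F, H_value F (Sing F) (((36 * M ^ 2)%:R - (16 * t)%:R) / (12 + t)%:R),
      (n < M)%N & (t <= 3 * M ^ 2)%N /\ (3 * M ^ 2 <= t + 9 * M)%N].
Proof.
have [w hw] := exists_cube_root R[i].
(* Level [n.+1] gives [M = 3 ^ n.+1 - 1 > n], so that [M] is positive and tends to infinity. *)
have [T [sT uT inT cT TT]] := torsion_seq hw n.+1.
have nM : (n < size T)%N.
  by rewrite sT -ltnS prednK ?expn_gt0 //; apply: ltn_expl.
have M0 : (0 < size T)%N by apply: leq_trans nM.
have [S [t [[uS sS] SP Smult [t1 t2]]]] := torsion_configuration hw uT inT cT TT M0.
set cs := pencil_cubics w T in SP Smult.
have csP : forall G, G \in cs -> smooth_cubic G := pencil_cubicsP hw cT.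
have csS G : G \in cs -> smooth_curve G by move=> /csP [].
have cs0 : cs != [::] by rewrite -size_eq0 size_pencil_cubics muln_eq0 -lt0n M0.
have SingE : Sing (\prod_(G <- cs) G) = [set p | p \in S].
  by apply/seteqP; split=> p /=; rewrite (Sing_prod _ csS) SP.
have finS : finite_set (Sing (\prod_(G <- cs) G)) by rewrite SingE; apply: finite_seq.
have permS : perm_eq (fset_set (Sing (\prod_(G <- cs) G))) S.
  apply: uniq_perm => // p; rewrite in_fset_set // SingE.
  by apply/idP/idP; rewrite inE.
exists (\prod_(G <- cs) G), (size T), t; split=> //.
  split; last by exists cs.
  apply: finite_Sing_reduced => //; apply: prod_plane_curve => // G /csS.
  by case.
have hF : homogeneous (\prod_(G <- cs) G) (12 * size T).
  have := @homogeneous_prod _ cs 3 (fun G Gcs => (csP G Gcs).2).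
  by rewrite size_pencil_cubics mulnA.
split=> //.
  have : (0 < size S)%N by rewrite sS.
  by case: (S) SingE => // p s -> _; exists p; rewrite /= mem_head.
exists (((12 * size T) ^ 2)%N%:Z - (108 * size T ^ 2 + 16 * t)%N%:Z).
  rewrite -Smult -(perm_big _ permS) /=.
  apply: self_intersection_smooth_union => // p; by case.
rewrite (perm_size permS) sS; congr (_ / _).
rewrite rmorphB /= !pmulrn; ring.
Qed.

Section Limit.
Variables (R : realType) (M t : nat -> nat).
Hypotheses (nM : forall n, (n < M n)%N) (t1 : forall n, (t n <= 3 * M n ^ 2)%N)
  (t2 : forall n, (3 * M n ^ 2 <= t n + 9 * M n)%N).

Let h n : R := ((36 * M n ^ 2)%:R - (16 * t n)%:R) / (12 + t n)%:R.

(** The excess over -4 is [(36 * M ^ 2 + 48 - 12 * t) / (12 + t)], with numerator at most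
    [108 * M + 48 <= 156 * M] and denominator at least [3 * M ^ 2 - 9 * M + 12 >= M ^ 2]. *)
Lemma H_limit_bound n : -4 <= h n <= -4 + 156%:R / n.+1%:R.
Proof.
have m0 : (12 + t n)%:R != 0 :> R by rewrite pnatr_eq0.
have -> : h n = -4 + (36 * M n ^ 2 + 48 - 12 * t n)%:R / (12 + t n)%:R.
  rewrite natrB; last by have := t1 n; lia.
  by rewrite /h; move: m0; rewrite !natrD !natrM => m0; field.
rewrite lerDl divr_ge0 ?ler0n //= lerD2l ler_pdivrMr ?ltr0n //.
rewrite mulrAC ler_pdivlMr ?ltr0n // -!natrM ler_nat.
have := t1 n; have := t2 n; have := nM n; move: (M n) (t n) => m k nm k2 k1.
apply: (@leq_trans ((108 * m + 48) * m)); first by apply: leq_mul => //; lia.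
have q : (9 * m <= 2 * m ^ 2 + 12)%N.
  rewrite -mulnn; case: (leqP m 4) => m4; last by nia.
  by move: m4; clear; case: m => [|[|[|[|[|]]]]].
rewrite -!mulnn in k1 k2 q; nia.
Qed.

Lemma H_limit : h @ \oo --> (-4 : R).
Proof.
apply: (squeeze_cvgr (f := cst (-4)) (h := fun n => -4 + 156%:R * harmonic n)).
- by apply: nearW; apply: H_limit_bound.
- exact: cvg_cst.
- rewrite -[X in _ --> X]addr0 -[X in _ + X](mulr0 156%:R).
  by apply: cvgD; [exact: cvg_cst | apply: cvgMr; exact: cvg_harmonic].
Qed.
End Limit.

Theorem proposition3 (R : realType) :
  (exists (C : nat -> {mpoly R[i][3]}) (h : nat -> R),
     [/\ forall n, cubic_configuration (C n),
         forall n, H_value (C n) (Sing (C n)) (h n) &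
         h @ \oo --> (-4 : R)]) /\
  (H_El_P2 R <= (-4)%:E)%E /\
  (H_P2 R <= H_El_P2 R)%E.
Proof.
have /choice [F /choice [M /choice [t FP]]] := torsion_H_value R.
pose h n : R := ((36 * M n ^ 2)%:R - (16 * t n)%:R) / (12 + t n)%:R.
have cF n : cubic_configuration (F n) by have [] := FP n.
have hF n : H_value (F n) (Sing (F n)) (h n) by have [] := FP n.
have lim : h @ \oo --> (-4 : R).
  by apply: H_limit => n; have [_ _ ? []] := FP n.
split; first by exists F, h.
split; last first.
  (* Elliptic configurations are reduced curves, so [H_P2] is an infimum over a larger set. *)
  apply: ereal_inf_le_tmp => _ [x [G [P [[rG _] HG]]] <-]; exists x => //.
  by exists G, P.
have eF n : elliptic_configuration (F n).
  have [rF [s sP FE]] := cF n; split=> //; exists s => // G /sP [sG hG].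
  by split=> //; apply: cubic_genus => //; case: sG => -[].
have le n : (H_El_P2 R <= (h n)%:E)%E.
  by apply: ereal_inf_lbound; exists (h n) => //; exists (F n), (Sing (F n)).
(* Every [h n] is an upper bound of [H_El_P2], hence so is their limit. *)
have hl : (EFin \o h) @ \oo --> (-4)%:E by apply: cvg_EFin => //; near=> n.
rewrite -(cvg_lim _ hl) //; apply: lime_ge; first by apply/cvg_ex; exists (-4)%:E.
exact: nearW.
Unshelve. all: by end_near.
Qed.
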